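(* If $K$ is a convex body in $\mathbb{R}^n$, $n\ge2$, with the origin in its interior, and $u\in S^{n-1}$, then $$V_K(\{u\})\cdot V_K(\{-u\})\le\frac{1}{4n^2}\big(V(K)\big)^2,$$ with equality if and only if $F(K,-u)$ is a translate of $F(K,u)$, $K=[F(K,u),F(K,-u)]$, and $h(K,u)=h(K,-u)$.
   Context: A convex body is a compact convex subset of $\mathbb{R}^n$ with non-empty interior; $V(K)$ is its volume. $h(K,x)=\max\{x\cdot y:y\in K\}$ is the support function, and $F(K,u)=\{x\in K: x\cdot u=h(K,u)\}$ is the face in direction $u\in S^{n-1}$. $[K,L]$ denotes the convex hull of $K\cup L$. For a convex body $K$ containing the origin in its interior, the cone-volume measure $V_K$ is the Borel measure on $S^{n-1}$ given by $V_K(\omega)=\frac1n\int_{\nu_K^{-1}(\omega)}x\cdot\nu_K(x)\,d\mathcal{H}^{n-1}(x)$, where $\nu_K$ is the Gauss map defined on the set of boundary points of $K$ having a unique outer unit normal and $\mathcal{H}^{n-1}$ is $(n-1)$-dimensional Hausdorff measure. In particular $V_K(\{u\})=\frac1n h(K,u)\,\mathcal{H}^{n-1}(F(K,u))$. *)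

(* Defs.v *)
From HB Require Import structures.
From mathcomp Require Import all_boot all_order all_algebra.
From mathcomp Require Import all_classical all_reals all_analysis.

Set Implicit Arguments.
Unset Strict Implicit.
Unset Printing Implicit Defensive.

Import Order.TTheory GRing.Theory Num.Theory.
Import numFieldNormedType.Exports.

Local Open Scope classical_set_scope.
Local Open Scope ring_scope.

(* R^n is 'rV[R]_n.  The library's topology on it is the usual one, but its
   norm `|x| is the sup norm, hence the Euclidean structure below. *)

Definition dot (R : realType) (n : nat) (x y : 'rV[R]_n) : R :=
  \sum_(i < n) x ord0 i * y ord0 i.

Definition enorm (R : realType) (n : nat) (x : 'rV[R]_n) : R :=
  Num.sqrt (dot x x).

Definition sphere (R : realType) (n : nat) : set 'rV[R]_n :=
  [set u | enorm u = 1].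

Definition convex_body (R : realType) (n : nat) (K : set 'rV[R]_n) : Prop :=
  [/\ compact K, convex_set K & interior K !=set0].

(* When K is compact and nonempty the supremum is a maximum. *)
Definition support_function (R : realType) (n : nat) (K : set 'rV[R]_n)
    (x : 'rV[R]_n) : R :=
  sup [set dot x y | y in K].

Definition face (R : realType) (n : nat) (K : set 'rV[R]_n) (u : 'rV[R]_n) :
    set 'rV[R]_n :=
  [set x | K x /\ dot x u = support_function K u].

Definition convex_hull (R : realType) (n : nat) (A : set 'rV[R]_n) :
    set 'rV[R]_n :=
  smallest (@convex_set R 'rV[R]_n) A.

Fixpoint lebesgue_tuple (R : realType) (n : nat) :
    set (n.-tuple (measurableTypeR R)) -> \bar R :=
  match n with
  | 0 => \d_[tuple]
  | m.+1 => pushforward (@lebesgue_measure R \x @lebesgue_tuple R m)%E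
              (fun p : measurableTypeR R * m.-tuple (measurableTypeR R) =>
                 [tuple of p.1 :: p.2])
  end.

Definition volume (R : realType) (n : nat) (A : set 'rV[R]_n) : \bar R :=
  lebesgue_tuple [set t : n.-tuple R | A (\row_i tnth t i)].

Section Hausdorff.
Local Open Scope ereal_scope.
Context (R : realType).

(* [diam set0 = -oo], so the empty set is always an admissible covering set. *)
Definition diam (n : nat) (A : set 'rV[R]_n) : \bar R :=
  ereal_sup [set (enorm (x - y)%R)%:E | x in A & y in A].

(* The case distinction makes the empty set contribute 0 also when d = 0. *)
Definition hausdorff_weight (n d : nat) (A : set 'rV[R]_n) : \bar R :=
  if A == set0 then 0 else diam A ^+ d.

Definition hausdorff_delta (n d : nat) (delta : R) (A : set 'rV[R]_n)
    : \bar R :=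
  ereal_inf [set \sum_(k <oo) hausdorff_weight d (F k) |
    F in [set F : (set 'rV[R]_n)^nat |
      A `<=` \bigcup_k F k /\ forall k, diam (F k) <= delta%:E]].

Definition hausdorff_unnormalized (n d : nat) (A : set 'rV[R]_n) : \bar R :=
  ereal_sup [set hausdorff_delta d delta A | delta in [set r : R | (0 < r)%R]].

Definition unit_cube (d : nat) : set 'rV[R]_d :=
  [set x | forall i, x ord0 i \in `[0%R, 1%R]].

(* d-dimensional Hausdorff (outer) measure on R^n, normalised so as to agree
   with Lebesgue measure on R^d, i.e. to be 1 on the unit cube of R^d. *)
Definition hausdorff (n d : nat) (A : set 'rV[R]_n) : \bar R :=
  (fine (hausdorff_unnormalized d (@unit_cube d)))^-1%:E
    * hausdorff_unnormalized d A.

End Hausdorff.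

Section HausdorffGe0.
Local Open Scope ereal_scope.
Context (R : realType) (n d : nat).
Implicit Types (A : set 'rV[R]_n) (delta : R).

Lemma diam_ge0 A : A !=set0 -> 0 <= diam A.
Proof.
move=> [x Ax]; apply: ereal_sup_ubound.
exists x => //; exists x => //; congr (_%:E).
rewrite /enorm /dot big1 ?sqrtr0// => i _.
by rewrite subrr mxE mul0r.
Qed.

Lemma hausdorff_weight_ge0 A : 0 <= hausdorff_weight d A.
Proof.
rewrite /hausdorff_weight; case: eqVneq => // /set0P A0.
exact/expe_ge0/diam_ge0.
Qed.

Lemma hausdorff_delta_ge0 delta A : 0 <= hausdorff_delta d delta A.
Proof.
apply: le_ereal_inf_tmp => _ [F _ <-].
by apply: nneseries_ge0 => k _ _; exact: hausdorff_weight_ge0.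
Qed.

Lemma hausdorff_unnormalized_ge0 A : 0 <= hausdorff_unnormalized d A.
Proof.
apply: le_trans (hausdorff_delta_ge0 1 A) _.
by apply: ereal_sup_ubound; exists 1%R => /=.
Qed.

End HausdorffGe0.

Section HausdorffOuterMeasure.
Local Open Scope ereal_scope.
Context (R : realType) (n d : nat).
Implicit Types (A : set 'rV[R]_n) (delta : R).

Let weight0' : hausdorff_weight d (set0 : set 'rV[R]_n) = 0.
Proof. by rewrite /hausdorff_weight eqxx. Qed.

Let U := g_sigma_algebraType [set: set 'rV[R]_n].

Let weight delta (A : set U) : \bar R :=
  if diam A <= delta%:E then hausdorff_weight d A else +oo.

Let weight_ge0 delta (A : set U) : 0 <= weight delta A.
Proof. by rewrite /weight; case: ifP => // _; exact: hausdorff_weight_ge0. Qed.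

Let weight0 delta : weight delta set0 = 0.
Proof.
rewrite /weight weight0' ifT// (_ : diam _ = -oo) ?leNye//.
rewrite /diam (_ : [set _ | _ in _ & _ in _] = set0) ?ereal_sup0//.
by rewrite -subset0 => ? [].
Qed.

Let hausdorff_deltaE delta A :
  hausdorff_delta d delta A = mu_ext (weight delta) A.
Proof.
apply/eqP; rewrite eq_le; apply/andP; split.
  apply: le_ereal_inf_tmp => _ [F [_ AF] <-].
  have [Fd|/existsNP[k /negP Fk]] := pselect (forall k, diam (F k) <= delta%:E).
    apply: ereal_inf_lbound; exists F => //.
    by apply: eq_eseriesr => k _; rewrite /weight Fd.
  rewrite (@eseries_pinfty _ _ xpredT k) ?leey//.
    by move=> m _; rewrite gt_eqF// (lt_le_trans _ (weight_ge0 _ _)).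
  by rewrite /weight (negbTE Fk).
apply: le_ereal_inf_tmp => _ [F [AF Fd] <-].
apply: ereal_inf_lbound; exists F.
  by split => // k; exact: sub_sigma_algebra.
by apply: eq_eseriesr => k _; rewrite /weight Fd.
Qed.

Let hausdorff0 : hausdorff d (set0 : set 'rV[R]_n) = 0.
Proof.
rewrite /hausdorff (_ : hausdorff_unnormalized _ set0 = 0) ?mule0//.
apply/eqP; rewrite eq_le hausdorff_unnormalized_ge0 andbT.
apply: ge_ereal_sup => _ [delta _ <-].
by rewrite hausdorff_deltaE mu_ext0.
Qed.

Let factor_ge0 :
  (0 <= (fine (hausdorff_unnormalized d (@unit_cube R d)))^-1)%R.
Proof. by rewrite invr_ge0 fine_ge0// hausdorff_unnormalized_ge0. Qed.

Let hausdorff_ge0 A : 0 <= hausdorff d A.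
Proof. by rewrite mule_ge0 ?hausdorff_unnormalized_ge0// lee_fin. Qed.

Let le_hausdorff : {homo @hausdorff R n d : A B / A `<=` B >-> A <= B}.
Proof.
move=> A B AB; rewrite lee_wpmul2l ?lee_fin//.
apply: ge_ereal_sup => _ [delta delta0 <-].
apply: (@le_trans _ _ (hausdorff_delta d delta B)).
  rewrite !hausdorff_deltaE; exact: le_mu_ext.
by apply: ereal_sup_ubound; exists delta.
Qed.

Let hausdorff_sigma_subadditive : sigma_subadditive (@hausdorff R n d).
Proof.
move=> F; rewrite /hausdorff nneseriesZl//; last first.
  by move=> *; exact: hausdorff_unnormalized_ge0.
rewrite lee_wpmul2l ?lee_fin//.
apply: ge_ereal_sup => _ [delta delta0 <-].
rewrite hausdorff_deltaE.
apply: le_trans (mu_ext_sigma_subadditive (weight_ge0 delta) F) _.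
apply: lee_nneseries => k _; first by rewrite mu_ext_ge0.
by rewrite -hausdorff_deltaE; apply: ereal_sup_ubound; exists delta.
Qed.

HB.instance Definition _ := isOuterMeasure.Build R 'rV[R]_n (@hausdorff R n d)
  hausdorff0 hausdorff_ge0 le_hausdorff hausdorff_sigma_subadditive.

End HausdorffOuterMeasure.

Section HausdorffMeasure.
Context (R : realType) (n d : nat).

Definition hausdorff_outer : {outer_measure set 'rV[R]_n -> \bar R} :=
  @hausdorff R n d.

Definition hausdorff_measure :
    {measure set (caratheodory_type hausdorff_outer) -> \bar R} :=
  hausdorff_outer.

End HausdorffMeasure.

Definition outer_unit_normal (R : realType) (n : nat) (K : set 'rV[R]_n)
    (x : 'rV[R]_n) : set 'rV[R]_n :=
  [set u | sphere u /\ forall y, K y -> dot (y - x) u <= 0].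

Definition regular_boundary (R : realType) (n : nat) (K : set 'rV[R]_n) :
    set 'rV[R]_n :=
  [set x | (closure K `\` interior K) x /\ exists! u, outer_unit_normal K x u].

(* The Gauss map proper is the restriction to [regular_boundary K], where the
   outer unit normal is unique. *)
Definition gauss_map (R : realType) (n : nat) (K : set 'rV[R]_n)
    (x : 'rV[R]_n) : 'rV[R]_n :=
  xget 0 (outer_unit_normal K x).

Definition cone_volume (R : realType) (n : nat) (K : set 'rV[R]_n)
    (omega : set 'rV[R]_n) : \bar R :=
  ((n%:R^-1)%:E *
   \int[hausdorff_measure R n n.-1]_(x in
          regular_boundary K `&` gauss_map K @^-1` omega)
     (dot x (gauss_map K x))%:E)%E.

(* Main.v *)
Require Import Defs.
From HB Require Import structures.
From mathcomp Require Import all_boot all_order all_algebra.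
From mathcomp Require Import all_classical all_reals all_analysis.
From mathcomp Require Import measurable_realfun.
From mathcomp Require Import zify ring lra.

Set Implicit Arguments.
Unset Strict Implicit.
Unset Printing Implicit Defensive.

Import Order.TTheory GRing.Theory Num.Theory.
Import numFieldNormedType.Exports.

Local Open Scope classical_set_scope.
Local Open Scope ring_scope.

(** Let F and G be the faces of K with normals u and -u, of areas a and b, at distances h and h'
    from the origin. The cone volumes of u and -u are h a / n and h' b / n, and
    4 h h' <= (h + h')^2, so the inequality follows from V(K) >= (h + h') sqrt (a b), that is, from
    a lower bound on the volume of a convex body by the areas of two opposite faces and the
    distance between them.

    This bound comes from slicing K parallel to the faces. By the Brunn-Minkowski inequality the
    area A(t) of the slice at relative height t satisfies A(s) A(t) <= A((s + t) / 2)^2, and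
    therefore A(t) A(1 - t) >= a b ([symmetric_product], [slice_product]). The volume does not
    change when A is replaced with the mean of A(t) and A(1 - t), which is at least sqrt (a b)
    ([slab_integral]).

    If equality holds, then h = h'. Applying the bound to the two halves of K on either side of
    the middle slice ([two_slabs_volume]) gives a stronger bound unless a, b and the area of the
    middle slice coincide ([face_volume_eq]). Then F and G are translates of each other by the
    equality case of the Brunn-Minkowski inequality. Cutting at any other height shows that no
    slice is larger than F, while each contains a translate of F by convexity, so K is the prism
    [F, G] ([face_product_eq]). Conversely the slices of such a prism are all translates of F
    ([hull_cylinder], [cylinder_vol]); one of them passes through the interior point 0, so that F
    has relative interior points, and these carry the full cone volume ([cone_volumeE]).

    The Brunn-Minkowski inequality is used in the form vol F * vol G <= vol M ^+ 2, where M
    contains all midpoints between F and G ([brunn_minkowski]). It is proved by induction on the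
    dimension, together with its equality case. Slicing reduces it to a statement about three
    functions on the line, which mass transport by quantile functions settles: along the average of
    the two transport maps, the mass of the third function accumulates at least at the rate given
    by the arithmetic-geometric mean inequality ([prekopa_midpoint]), and if equality holds, the
    two maps differ by a constant ([prekopa_midpoint_eq]). So in every direction the extents of F and G differ by a shift, which
    first moments identify as the displacement of the barycentre; hence F and G are translates of
    each other ([brunn_minkowski_eq]).

    Areas of faces are Hausdorff measures whereas volumes and slices are Lebesgue measures. A
    reflection ([frame]) makes u the first basis vector, and Hausdorff measure in R^d is Lebesgue
    measure ([hausdorff_volume]): Borel sets are Caratheodory measurable, both measures are
    translation invariant, and such measures are proportional ([translation_invariant_unique]). *)

(** * Measurable structure and volume on row vectors *)

Section RowMeasurable.
Context (R : realType) (n : nat).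

Let tup := n.-tuple (measurableTypeR R).

Definition row_of_tuple (t : tup) : 'rV[R]_n := \row_i tnth t i.
Definition tuple_of_row (x : 'rV[R]_n) : tup := [tuple x ord0 i | i < n].

Lemma row_of_tupleK : cancel row_of_tuple tuple_of_row.
Proof. by move=> t; apply: eq_from_tnth => i; rewrite tnth_mktuple mxE. Qed.

Lemma tuple_of_rowK : cancel tuple_of_row row_of_tuple.
Proof. by move=> x; apply/rowP => i; rewrite mxE tnth_mktuple. Qed.

(** The sigma-algebra is the one of tuples, through which [volume] is defined. *)
Definition row_measurable (A : set 'rV[R]_n) : Prop :=
  measurable (row_of_tuple @^-1` A).

Let row_measurable0 : row_measurable set0.
Proof. by rewrite /row_measurable preimage_set0. Qed.

Let row_measurableC A : row_measurable A -> row_measurable (~` A).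
Proof. by rewrite /row_measurable preimage_setC; exact: measurableC. Qed.

Let row_measurable_bigcup (F : (set 'rV[R]_n)^nat) :
  (forall i, row_measurable (F i)) -> row_measurable (\bigcup_i F i).
Proof. by rewrite /row_measurable preimage_bigcup => ?; exact: bigcupT_measurable. Qed.

Definition row_display : measure_display.
Proof. exact. Qed.

HB.instance Definition _ := @isMeasurable.Build row_display 'rV[R]_n
  row_measurable row_measurable0 row_measurableC row_measurable_bigcup.

Lemma measurable_row_of_tuple : measurable_fun setT row_of_tuple.
Proof. by move=> _ A mA; rewrite setTI. Qed.

Lemma measurable_tuple_of_row : measurable_fun setT tuple_of_row.
Proof.
move=> _ A mA; rewrite setTI /measurable/= /row_measurable.
rewrite (_ : _ @^-1` _ = A)//; apply/seteqP.
by split=> t /=; rewrite row_of_tupleK.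
Qed.

Lemma measurable_coord i : measurable_fun setT (fun x : 'rV[R]_n => x ord0 i).
Proof.
rewrite (_ : (fun x => _) = (fun t : tup => tnth t i) \o tuple_of_row).
  by apply: measurableT_comp measurable_tuple_of_row; exact: measurable_tnth.
by apply/funext => x /=; rewrite tnth_mktuple.
Qed.

Lemma measurable_fun_row d (T : measurableType d) (f : T -> 'rV[R]_n) :
  (forall i, measurable_fun setT (fun t => f t ord0 i)) -> measurable_fun setT f.
Proof.
move=> mf; rewrite (_ : f = row_of_tuple \o (tuple_of_row \o f)).
  apply: measurableT_comp measurable_row_of_tuple _.
  apply/measurable_fun_tnthP => i.
  rewrite (_ : _ \o _ = fun t => f t ord0 i); first exact: mf.
  by apply/funext => t /=; rewrite tnth_mktuple.
by apply/funext => t /=; rewrite tuple_of_rowK.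
Qed.

End RowMeasurable.

Definition row_cons (R : realType) (n : nat) (s : R) (y : 'rV[R]_n) : 'rV[R]_n.+1 :=
  row_mx s%:M y.

Section Cons.
Context (R : realType) (n : nat).
Implicit Types (s : R) (y : 'rV[R]_n).

Lemma row_cons0 s y : row_cons s y ord0 ord0 = s.
Proof.
have E : s = (s%:M : 'M[R]_1) ord0 ord0 by rewrite mxE eqxx mulr1n.
rewrite [RHS]E -(@row_mxEl R 1 1 n s%:M y ord0 ord0).
by congr (row_mx _ _ _ _); exact/val_inj.
Qed.

Lemma row_consS s y i : row_cons s y ord0 (lift ord0 i) = y ord0 i.
Proof.
rewrite -(@row_mxEr R 1 1 n s%:M y ord0 i); congr (row_mx _ _ _ _).
exact/val_inj.
Qed.

Definition row_tail (x : 'rV[R]_n.+1) : 'rV[R]_n := \row_i x ord0 (lift ord0 i).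

Lemma row_consK (x : 'rV[R]_n.+1) : row_cons (x ord0 ord0) (row_tail x) = x.
Proof.
apply/rowP => i; case: (unliftP ord0 i) => [j ->|->].
  by rewrite row_consS mxE.
by rewrite row_cons0.
Qed.

Lemma row_tailK s y : row_tail (row_cons s y) = y.
Proof. by apply/rowP => i; rewrite mxE row_consS. Qed.

Lemma row_cons_inj s s' y y' : row_cons s y = row_cons s' y' -> s = s' /\ y = y'.
Proof.
by move=> e; split; [rewrite -(row_cons0 s y) e row_cons0 | rewrite -(row_tailK s y) e row_tailK].
Qed.

Lemma row_consD s s' y y' : row_cons (s + s') (y + y') = row_cons s y + row_cons s' y'.
Proof.
apply/rowP => i; rewrite [RHS]mxE; case: (unliftP ord0 i) => [j ->|->].
  by rewrite !row_consS mxE.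
by rewrite !row_cons0.
Qed.

Lemma row_consZ a s y : row_cons (a * s) (a *: y) = a *: row_cons s y.
Proof.
apply/rowP => i; rewrite [RHS]mxE; case: (unliftP ord0 i) => [j ->|->].
  by rewrite !row_consS mxE.
by rewrite !row_cons0.
Qed.

Lemma measurable_row_cons :
  measurable_fun setT (fun p : measurableTypeR R * 'rV[R]_n => row_cons p.1 p.2).
Proof.
apply: measurable_fun_row => i; case: (unliftP ord0 i) => [j ->|->].
  rewrite (_ : (fun t => _) = (fun y : 'rV[R]_n => y ord0 j) \o snd).
    exact: measurableT_comp (measurable_coord j) measurable_snd.
  by apply/funext => t /=; rewrite row_consS.
rewrite (_ : (fun t => _) = fst) //.
by apply/funext => t /=; rewrite row_cons0.
Qed.

Definition slice (A : set 'rV[R]_n.+1) s : set 'rV[R]_n := [set y | A (row_cons s y)].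

Lemma measurable_slice A s : measurable A -> measurable (slice A s).
Proof.
move=> mA; rewrite -[slice A s]setTI.
have := (measurableT_comp measurable_row_cons (measurable_pair1 s)).
exact.
Qed.

End Cons.

Section Volume.
Local Open Scope ereal_scope.
Context (R : realType).

(** The recursion that defines [volume] is Fubini's theorem read backwards: a product
    measure integrates the measures of the sections. *)
Lemma volume_slices n (A : set 'rV[R]_n.+1) :
  volume A = \int[@lebesgue_measure R]_s volume (slice A s).
Proof.
rewrite /volume /=/pushforward /= /product_measure1; apply: eq_integral => s _ /=.
congr (lebesgue_tuple _); apply/seteqP.
have E (t : n.-tuple (measurableTypeR R)) : \row_i tnth [tuple of s :: t] i = row_cons s (\row_i tnth t i) :> 'rV[R]_n.+1.
  apply/rowP => i; rewrite mxE; case: (unliftP ord0 i) => [j ->|->].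
    by rewrite row_consS mxE tnthS.
  by rewrite row_cons0 tnth0.
by split=> t; rewrite /xsection/slice/= ?inE/= E.
Qed.

Lemma volume_pushforward n (A : set 'rV[R]_n.+1) :
  volume A = (@lebesgue_measure R \x @volume R n)
    ((fun p : measurableTypeR R * 'rV[R]_n => row_cons p.1 p.2) @^-1` A).
Proof.
rewrite volume_slices; apply: eq_integral => s _ /=; congr (volume _).
by apply/seteqP; split=> y; rewrite /xsection /= ?inE.
Qed.

Definition box n (a : 'rV[R]_n) (l : R) : set 'rV[R]_n :=
  [set x | forall i, x ord0 i \in `[a ord0 i, (a ord0 i + l)%R]].

Lemma measurable_box n (a : 'rV[R]_n) l : measurable (box a l).
Proof.
rewrite (_ : box a l = \bigcap_(i in [set: 'I_n])
   (fun x : 'rV[R]_n => x ord0 i) @^-1` [set` `[a ord0 i, (a ord0 i + l)%R]]).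
  apply: fin_bigcap_measurable; first by apply/finite_seqP; exists (enum 'I_n); apply/seteqP; split=> i //= _; rewrite mem_enum.
  move=> i _; rewrite -[X in measurable X]setTI.
  exact: (measurable_coord i) measurableT _ (measurable_itv _).
by apply/seteqP; split => x /= xb i; [move=> _; exact: xb|exact: xb].
Qed.

Lemma slice_box n (a : 'rV[R]_n.+1) l s :
  slice (box a l) s =
  if s \in `[a ord0 ord0, (a ord0 ord0 + l)%R] then box (row_tail a) l else set0.
Proof.
case: ifPn => sa; apply/seteqP; split=> y /=.
- by move=> yb i; have := yb (lift ord0 i); rewrite row_consS mxE.
- move=> yb i; case: (unliftP ord0 i) => [j ->|->]; last by rewrite row_cons0.
  by have := yb j; rewrite row_consS mxE.
- by move=> /(_ ord0); rewrite row_cons0 (negbTE sa).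
- by [].
Qed.

Lemma volume_set0 n : @volume R n set0 = 0.
Proof.
elim: n => [|n IH]; first by rewrite /volume /= /dirac indicE in_set0.
rewrite volume_slices (_ : (fun s => _) = cst 0) ?integral0//.
by apply/funext => s; rewrite -IH; congr volume; apply/seteqP.
Qed.

Lemma volume_box n (a : 'rV[R]_n) l : (0 <= l)%R -> volume (box a l) = (l ^+ n)%:E.
Proof.
move=> l0; elim: n a => [|n IH] a.
  rewrite /volume /= /dirac indicE mem_set//= => i; by case: i.
rewrite volume_slices.
pose I := `[a ord0 ord0, (a ord0 ord0 + l)%R].
rewrite (_ : (fun s => _) = fun s => ((l ^+ n) * \1_[set` I] s)%:E).
  under eq_integral do rewrite EFinM.
  rewrite ge0_integralZl_EFin//= ?exprn_ge0//; last first.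
    by apply/measurable_EFinP; exact: measurable_indic.
  rewrite integral_indic// setIT.
  rewrite [X in _ * X = _](_ : _ = l%:E) ?exprSr//.
  apply: etrans (lebesgue_measure_itv I) _; rewrite /= lte_fin ltrDl.
  case: ltP => [_|l0']; first by rewrite -EFinD (addrC _ l) addrK.
  by congr EFin; apply/eqP; rewrite eq_le l0 l0'.
apply/funext => s; rewrite slice_box -/I indicE mem_setE.
by case: (s \in I); rewrite ?mulr1 ?mulr0 ?IH ?volume_set0.
Qed.

Lemma volume_sigma_finite n : sigma_finite setT (@volume R n).
Proof.
exists (fun k => box (const_mx (- k%:R)%R) (k%:R *+ 2)%R).
  apply/esym; rewrite -subTset => x _.
  pose M := (\sum_i `|x ord0 i|)%R.
  exists (Num.truncn M).+1 => // i; rewrite mxE in_itv /= mulr2n addKr -ler_norml.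
  apply: le_trans (ltW (truncnS_gt _)).
  by rewrite /M (bigD1 i)//= lerDl sumr_ge0.
move=> k; split; first exact: measurable_box.
by rewrite volume_box ?ltry// mulrn_wge0.
Qed.

(** By induction on the dimension, because the product with [lebesgue_measure] is a
    measure only once the other factor is known to be sigma-finite. *)
Lemma volume_is_measure n :
  [/\ @volume R n set0 = 0, forall A, 0 <= @volume R n A &
      semi_sigma_additive (@volume R n)].
Proof.
elim: n => [|n [v0 vge vadd]].
  split; [exact: volume_set0|by move=> A|].
  move=> F mF tF mUF; rewrite (_ : @volume R 0 = pushforward
      (\d_ ([tuple] : 0.-tuple (measurableTypeR R))) (@row_of_tuple R 0)) //.
  apply: (measure_semi_sigma_additive (s := Measure.clone _ _ _
     (pushforward (\d_ ([tuple] : 0.-tuple (measurableTypeR R))) (@row_of_tuple R 0)) _)) => //.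
  exact: measurable_row_of_tuple.
pose m1 := isMeasure.Build _ _ _ _ v0 vge vadd.
pose mu1 : {measure set 'rV[R]_n -> \bar R} := HB.pack (@volume R n) m1.
pose m2 := Measure_isSigmaFinite.Build _ _ _ mu1 (@volume_sigma_finite n).
pose mu : {sigma_finite_measure set 'rV[R]_n -> \bar R} := HB.pack (@volume R n) m1 m2.
have E : @volume R n.+1 = pushforward (@lebesgue_measure R \x mu)
    (fun p : measurableTypeR R * 'rV[R]_n => row_cons p.1 p.2).
  by apply/funext => A; rewrite volume_pushforward.
split; first exact: volume_set0.
  by move=> A; rewrite volume_slices; apply: integral_ge0 => s _; exact: vge.
move=> F mF tF mUF; rewrite E.
apply: (measure_semi_sigma_additive (s := Measure.clone _ _ _
   (pushforward (@lebesgue_measure R \x mu)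
    (fun p : measurableTypeR R * 'rV[R]_n => row_cons p.1 p.2)) _)) => //.
exact: measurable_row_cons.
Qed.

HB.instance Definition _ n := isMeasure.Build _ _ _ (@volume R n)
  (let: And3 p _ _ := volume_is_measure n in p)
  (let: And3 _ p _ := volume_is_measure n in p)
  (let: And3 _ _ p := volume_is_measure n in p).

HB.instance Definition _ n := Measure_isSigmaFinite.Build _ _ _ (@volume R n)
  (@volume_sigma_finite n).

End Volume.

(** * Borel sets and translations *)

Section Borel.
Context (R : realType) (n : nat).

(** There are only countably many of these boxes, so an open set is a countable union
    of boxes. *)
Lemma ball_row_sub_box (x : 'rV[R]_n) (e : R) : 0 < e ->
  exists (q : n.-tuple rat) (k : nat),
    box (\row_i (ratr (tnth q i) - k.+1%:R^-1)) (2 / k.+1%:R) x /\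
    box (\row_i (ratr (tnth q i) - k.+1%:R^-1)) (2 / k.+1%:R) `<=` ball x e.
Proof.
move=> e0.
pose k := Num.truncn (2 / e).
have ke : 2 / k.+1%:R < e.
  by rewrite ltr_pdivrMr ?ltr0n// mulrC -ltr_pdivrMr// truncnS_gt.
pose d : R := k.+1%:R^-1.
have d0 : 0 < d by rewrite invr_gt0 ltr0n.
have /choice[q qx] : forall i : 'I_n, exists r : rat,
    ratr r \in `]x ord0 i - d, x ord0 i[.
  by move=> i; apply: rat_in_itvoo; rewrite ltrBlDr ltrDl.
exists [tuple q i | i < n], k; split.
  move=> i; rewrite mxE tnth_mktuple.
  by have := qx i; rewrite !in_itv/= -/d => /andP[h1 h2]; apply/andP; split; lra.
move=> y yb; split=> // i' i; rewrite (ord1 i') /ball/=.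
have := yb i; have := qx i; rewrite mxE tnth_mktuple !in_itv/= -/d.
move=> /andP[h1 h2] /andP[h3 h4]; rewrite -/d in ke.
by rewrite ltr_distl; apply/andP; split; lra.
Qed.

Lemma open_row_measurable (U : set 'rV[R]_n) : open U -> measurable U.
Proof.
move=> oU.
pose B (p : n.-tuple rat * nat) : set 'rV[R]_n :=
  box (\row_i (ratr (tnth p.1 i) - p.2.+1%:R^-1)) (2 / p.2.+1%:R).
rewrite (_ : U = \bigcup_p (if pselect (B p `<=` U) then B p else set0)).
  apply: countable_bigcupT_measurable; first exact: countableP.
  by move=> p; case: (pselect _) => _ /=; [exact: measurable_box|exact: measurable0].
apply/seteqP; split => x; last first.
  by move=> [p _]; case: (pselect _) => //= BU /BU.
move=> Ux; have /nbhs_ballP[e /= e0 xeU] := open_nbhs_nbhs (conj oU Ux).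
have [q [k [xB Bx]]] := ball_row_sub_box x e0.
exists (q, k) => //; case: (pselect _) => //= nBU; exfalso; apply: nBU.
exact: subset_trans Bx xeU.
Qed.

Lemma closed_row_measurable (A : set 'rV[R]_n) : closed A -> measurable A.
Proof.
move=> cA; rewrite -[A]setCK; apply: measurableC.
by apply: open_row_measurable; exact: closed_openC.
Qed.

Lemma compact_row_measurable (A : set 'rV[R]_n) : compact A -> measurable A.
Proof. by move=> /(compact_closed (@norm_hausdorff _ _)); exact: closed_row_measurable. Qed.

Lemma continuous_row_measurable (f : 'rV[R]_n -> R) :
  continuous f -> measurable_fun setT f.
Proof.
move=> cf; apply: (measurability (@RGenOpens.G R)); first exact: RGenOpens.measurableE.
move=> _ [_ [a [b ->]] <-]; rewrite setTI.
apply: open_row_measurable; apply: open_comp => // x _; exact: cf.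
Qed.

End Borel.

Section Shift.
Local Open Scope ereal_scope.
Context (R : realType).

Lemma lebesgue_measure_shift (c : R) (A : set R) : measurable A ->
  pushforward (@lebesgue_measure R) (fun x : measurableTypeR R => x + c : measurableTypeR R)%R A =
  lebesgue_measure A.
Proof.
have mf : measurable_fun setT (fun x : measurableTypeR R => x + c : measurableTypeR R)%R.
  exact: measurable_funD.
move=> mA; apply/esym/lebesgue_measure_unique => //= _ [[a b]] _ <-.
rewrite /pushforward.
rewrite [X in _ = lebesgue_measure X](_ : _ = [set` `](a - c)%R, (b - c)%R]]).
  by rewrite !lebesgue_measure_itv/= !lte_fin ltrD2r -!EFinD; case: ifP => // _; congr EFin; ring.
by apply/seteqP; split=> x /=; rewrite !in_itv/= ltrBlDr lerBrDr.
Qed.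

Lemma integral_shift (c : R) (f : R -> \bar R) : measurable_fun setT f ->
  (forall x, 0 <= f x) ->
  \int[@lebesgue_measure R]_x f (x + c)%R = \int[lebesgue_measure]_x f x.
Proof.
move=> mf f0.
have ms : measurable_fun setT (fun x : measurableTypeR R => x + c : measurableTypeR R)%R.
  exact: measurable_funD.
transitivity (\int[pushforward (@lebesgue_measure R)
    (fun x : measurableTypeR R => x + c : measurableTypeR R)%R]_y f y).
  by rewrite ge0_integral_pushforward.
by apply: eq_measure_integral => A mA _; exact: lebesgue_measure_shift.
Qed.

Lemma measurable_volume_slice n (A : set 'rV[R]_n.+1) : measurable A ->
  measurable_fun setT (fun s : measurableTypeR R => volume (slice A s)).
Proof.
move=> mA; pose f (p : measurableTypeR R * 'rV[R]_n) := row_cons p.1 p.2.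
have mE : measurable (f @^-1` A).
  by rewrite -[X in measurable X]setTI; exact: measurable_row_cons.
rewrite (_ : (fun s => _) = @volume R n \o xsection (f @^-1` A)).
  exact: measurable_fun_xsection.
by apply/funext => s /=; congr volume; apply/seteqP; split=> y; rewrite /xsection/= inE.
Qed.

Lemma volume_shift n (A : set 'rV[R]_n) p : measurable A ->
  volume ((fun x => x + p)%R @^-1` A) = volume A.
Proof.
elim: n A p => [|n IH] A p mA.
  congr volume; apply/seteqP.
  by split=> x /=; rewrite (_ : x + p = x)%R //; apply/rowP => -[].
rewrite !volume_slices -[RHS](integral_shift (p ord0 ord0)) //; last first.
  exact: measurable_volume_slice.
apply: eq_integral => s _; rewrite -(IH (slice A (s + p ord0 ord0)%R) (row_tail p)); last exact: measurable_slice.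
congr volume; apply/seteqP.
by split=> y /=; rewrite /slice/= row_consD row_consK.
Qed.

Lemma measurable_rowD n :
  measurable_fun setT (fun p : 'rV[R]_n * 'rV[R]_n => p.1 + p.2)%R.
Proof.
apply: measurable_fun_row => i.
rewrite (_ : (fun t => _) = fun t : 'rV[R]_n * 'rV[R]_n => t.1 ord0 i + t.2 ord0 i)%R.
  apply: measurable_funD.
    exact: measurableT_comp (measurable_coord i) measurable_fst.
  exact: measurableT_comp (measurable_coord i) measurable_snd.
by apply/funext => t; rewrite mxE.
Qed.

Lemma measurable_rowB n :
  measurable_fun setT (fun p : 'rV[R]_n * 'rV[R]_n => p.1 - p.2)%R.
Proof.
apply: measurable_fun_row => i.
rewrite (_ : (fun t => _) = fun t : 'rV[R]_n * 'rV[R]_n => t.1 ord0 i - t.2 ord0 i)%R.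
  apply: measurable_funB.
    exact: measurableT_comp (measurable_coord i) measurable_fst.
  exact: measurableT_comp (measurable_coord i) measurable_snd.
by apply/funext => t; rewrite !mxE.
Qed.

(** Uniqueness of the translation-invariant measure, by counting twice: the pairs with
    [S x] and [B (x + y)] have measure [mu S * volume B], the pairs with [B x] and [S
    (x - y)] have measure [mu B * volume S], and for each [y] the sections of these
    two sets in [x] are translates of each other. By the symmetry of [S], the
    condition [S (x - y)] on [y] defines a translate of [S]. *)
Lemma translation_invariant_unique n (mu : {sigma_finite_measure set 'rV[R]_n -> \bar R})
    (S B : set 'rV[R]_n) :
  (forall (A : set 'rV[R]_n) (p : 'rV[R]_n), measurable A ->
    mu ((fun x => x + p)%R @^-1` A) = mu A) ->
  measurable S -> measurable B -> (forall x, S x -> S (- x)%R) ->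
  mu S * volume B = mu B * volume S.
Proof.
move=> muD mS mB symS.
pose T := 'rV[R]_n.
have mD := @measurable_rowD n; have mN := @measurable_rowB n.
pose E1 : set (T * T) := [set p | S p.1 /\ B (p.1 + p.2)%R].
pose E2 : set (T * T) := [set p | B p.1 /\ S (p.1 - p.2)%R].
have mE1 : measurable E1.
  rewrite (_ : E1 = (fst @^-1` S) `&` ((fun p : T * T => p.1 + p.2)%R @^-1` B)) //.
  apply: measurableI; rewrite -[X in measurable X]setTI; last exact: mD.
  exact: measurable_fst.
have mE2 : measurable E2.
  rewrite (_ : E2 = (fst @^-1` B) `&` ((fun p : T * T => p.1 - p.2)%R @^-1` S)) //.
  apply: measurableI; rewrite -[X in measurable X]setTI; last exact: mN.
  exact: measurable_fst.
have swap (E : set (T * T)) : measurable E ->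
    \int[mu]_x @volume R n (xsection E x) = \int[@volume R n]_y mu (ysection E y).
  move=> mE; have := indic_fubini_tonelli mu (@volume R n) mE.
  by rewrite indic_fubini_tonelli_FE// indic_fubini_tonelli_GE.
have cst_int (A : set T) (c : \bar R) (g : T -> \bar R) : measurable A -> 0 <= c ->
    (forall x, A x -> g x = c) -> (forall x, ~ A x -> g x = 0) ->
    \int[mu]_x g x = mu A * c.
  move=> mA c0 gA gNA.
  rewrite (eq_integral (fun x => (\1_A x)%:E * c)).
    rewrite ge0_integralZr ?integral_indic ?setIT//.
    by apply/measurable_EFinP; exact: measurable_indic.
  move=> x _; rewrite indicE; have [xA|xA] := pselect (A x).
    by rewrite gA// mem_set// mul1e.
  by rewrite gNA// memNset// mul0e.
have I1 : \int[mu]_x @volume R n (xsection E1 x) = mu S * volume B.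
  apply: cst_int => //.
    move=> x Sx; rewrite -(volume_shift x mB); congr volume.
    by apply/seteqP; split=> y; rewrite /xsection /E1 /= inE/= addrC; tauto.
  move=> x Sx; rewrite (_ : xsection _ _ = set0) ?measure0//.
  by apply/seteqP; split=> y //; rewrite /xsection /E1 /= inE/= => -[].
have I2 : \int[mu]_x @volume R n (xsection E2 x) = mu B * volume S.
  apply: cst_int => //.
    move=> x Bx; rewrite -(volume_shift (- x)%R mS); congr volume.
    apply/seteqP; split=> y; rewrite /xsection /E2 /= inE/=.
      by move=> [_ /symS]; rewrite opprB.
    by move=> /symS; rewrite opprB.
  move=> x Bx; rewrite (_ : xsection _ _ = set0) ?measure0//.
  by apply/seteqP; split=> y //; rewrite /xsection /E2 /= inE/= => -[].
rewrite -I1 -I2 !swap//; apply: eq_integral => y _.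
rewrite -(muD (ysection E2 y) y); last exact: measurable_ysection.
congr (mu _); apply/seteqP; split=> x; rewrite /ysection /E1 /E2 /= !inE/= addrK; tauto.
Qed.

End Shift.

(** * The Euclidean norm *)

Section EuclideanNorm.
Context (R : realType).

Lemma dotC n (x y : 'rV[R]_n) : dot x y = dot y x.
Proof. by apply: eq_bigr => i _; rewrite mulrC. Qed.

Lemma dotDl n (x y z : 'rV[R]_n) : dot (x + y) z = dot x z + dot y z.
Proof. by rewrite -big_split; apply: eq_bigr => i _; rewrite mxE mulrDl. Qed.

Lemma dotZl n a (x z : 'rV[R]_n) : dot (a *: x) z = a * dot x z.
Proof. by rewrite mulr_sumr; apply: eq_bigr => i _; rewrite mxE mulrA. Qed.

Lemma dotNl n (x z : 'rV[R]_n) : dot (- x) z = - dot x z.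
Proof. by rewrite -scaleN1r dotZl mulN1r. Qed.

Lemma dotBl n (x y z : 'rV[R]_n) : dot (x - y) z = dot x z - dot y z.
Proof. by rewrite dotDl dotNl. Qed.

Lemma dotDr n (x y z : 'rV[R]_n) : dot z (x + y) = dot z x + dot z y.
Proof. by rewrite dotC dotDl !(dotC z). Qed.

Lemma dotZr n a (x z : 'rV[R]_n) : dot z (a *: x) = a * dot z x.
Proof. by rewrite dotC dotZl (dotC z). Qed.

Lemma dotNr n (x z : 'rV[R]_n) : dot z (- x) = - dot z x.
Proof. by rewrite dotC dotNl (dotC z). Qed.

Lemma dotBr n (x y z : 'rV[R]_n) : dot z (x - y) = dot z x - dot z y.
Proof. by rewrite dotDr dotNr. Qed.

Lemma dot0l n (x : 'rV[R]_n) : dot 0 x = 0.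
Proof. by rewrite -(scale0r (0 : 'rV[R]_n)) dotZl mul0r. Qed.

Lemma dot0r n (x : 'rV[R]_n) : dot x 0 = 0.
Proof. by rewrite dotC dot0l. Qed.

Lemma dot_ge0 n (x : 'rV[R]_n) : 0 <= dot x x.
Proof. by apply: sumr_ge0 => i _; rewrite -expr2 sqr_ge0. Qed.

Lemma dot_eq0 n (x : 'rV[R]_n) : dot x x = 0 -> x = 0.
Proof.
move=> /eqP; rewrite psumr_eq0 => [/allP x0|i _]; last by rewrite -expr2 sqr_ge0.
apply/rowP => i; rewrite mxE.
by have /eqP := x0 i (mem_index_enum i); rewrite -expr2 => /eqP; rewrite sqrf_eq0 => /eqP.
Qed.

Lemma enorm_ge0 n (x : 'rV[R]_n) : 0 <= enorm x.
Proof. exact: sqrtr_ge0. Qed.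

Lemma sqr_enorm n (x : 'rV[R]_n) : enorm x ^+ 2 = dot x x.
Proof. by rewrite sqr_sqrtr// dot_ge0. Qed.

Lemma enorm_eq1 n (x : 'rV[R]_n) : enorm x = 1 <-> dot x x = 1.
Proof.
split=> [e|e]; first by rewrite -sqr_enorm e expr1n.
by rewrite /enorm e sqrtr1.
Qed.

Lemma le_coord_enorm n (x : 'rV[R]_n) i : `|x ord0 i| <= enorm x.
Proof.
rewrite -sqrtr_sqr ler_wsqrtr// /dot (bigD1 i)//= -expr2 lerDl.
by apply: sumr_ge0 => j _; rewrite -expr2 sqr_ge0.
Qed.

Lemma enorm_le_sum n (x : 'rV[R]_n) : enorm x <= \sum_i `|x ord0 i|.
Proof.
have s0 : 0 <= \sum_i `|x ord0 i| by apply: sumr_ge0.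
rewrite -(ger0_norm s0) -sqrtr_sqr ler_wsqrtr// expr2 mulr_suml.
apply: ler_sum => i _; rewrite -expr2 -real_normK ?num_real// expr2.
by rewrite ler_wpM2l// (bigD1 i)//= lerDl sumr_ge0.
Qed.

End EuclideanNorm.

(** * Caratheodory's criterion for metric outer measures *)

Section Caratheodory.
Local Open Scope ereal_scope.
Context (R : realType) (T : Type) (mu : {outer_measure set T -> \bar R}) (f : T -> R).
Hypothesis mu_sep : forall (A B : set T) (a b : R), (a < b)%R ->
  (forall x, A x -> f x <= a)%R -> (forall x, B x -> b <= f x)%R ->
  mu A + mu B <= mu (A `|` B).
Context (alpha : R).

Let h (j : nat) : R := (alpha + j.+1%:R^-1)%R.

Let h_lt i j : (i < j)%N -> (h j < h i)%R.
Proof. by move=> ij; rewrite ltrD2l ltf_pV2 ?posrE ?ltr0n// ltr_nat. Qed.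

Let h_le i j : (i <= j)%N -> (h j <= h i)%R.
Proof. by rewrite leq_eqVlt => /orP[/eqP->//|/h_lt/ltW]. Qed.

Let shell (X : set T) (j : nat) : set T := [set x | X x /\ (h j.+1 <= f x < h j)%R].

Let shell_sum X p N : \sum_(0 <= j < N) mu (shell X (j.*2 + p)) <= mu X.
Proof.
apply: (@le_trans _ _ (mu (\bigcup_(j in `I_N) shell X (j.*2 + p)))); last first.
  by apply: le_outer_measure => x [j _ []].
elim: N => [|N IH]; first by rewrite big_geq// outer_measure_ge0.
rewrite big_nat_recr//=.
apply: (@le_trans _ _ (mu (\bigcup_(j in `I_N) shell X (j.*2 + p)) +
  mu (shell X (N.*2 + p)))); first exact: leeD2r.
rewrite addeC.
have [N0|N0] := posnP N.
  rewrite N0 (_ : \bigcup_(_ in _) _ = set0) ?outer_measure0 ?adde0; last first.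
    by apply/seteqP; split => x //= [].
  by apply: le_outer_measure => x ?; exists 0%N.
apply: (@le_trans _ _ (mu (shell X (N.*2 + p) `|`
    \bigcup_(j in `I_N) shell X (j.*2 + p)))).
  apply: (@mu_sep _ _ (h (N.*2 + p)) (h (N.*2 + p).-1)).
  - by apply: h_lt; lia.
  - by move=> x [_ /andP[_ /ltW]].
  - move=> x [j /= jN [_ /andP[+ _]]]; apply: le_trans; apply: h_le; lia.
apply: le_outer_measure => x [?|[j jN ?]]; first by exists N => //=.
by exists j => //=; rewrite (leq_trans jN).
Qed.

Let shell_summable X : mu X < +oo -> \sum_(0 <= j <oo) mu (shell X j) < +oo.
Proof.
move=> Xoo; apply: (@le_lt_trans _ _ (mu X + mu X)); last exact: lte_add_pinfty.
apply: lime_le.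
  by apply: is_cvg_nneseries => k _ _; exact: outer_measure_ge0.
apply: nearW => N.
have E : \sum_(0 <= j < N.*2) mu (shell X j) =
    \sum_(0 <= j < N) mu (shell X (j.*2 + 0)) + \sum_(0 <= j < N) mu (shell X (j.*2 + 1)).
  elim: N => [|N IH]; first by rewrite !big_geq// adde0.
  rewrite doubleS !big_nat_recr//= IH addn0 addn1 -!addeA; congr (_ + _).
  by rewrite addeCA.
apply: (@le_trans _ _ (\sum_(0 <= j < N.*2) mu (shell X j))).
  rewrite (@big_cat_nat _ _ _ N 0 N.*2)//=; last by rewrite -addnn leq_addr.
  by rewrite leeDl// sume_ge0// => *; exact: outer_measure_ge0.
by rewrite E leeD// shell_sum.
Qed.

(** The part of [X] above the level [alpha] is cut by the levels [h j], which decrease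
    to [alpha], into shells. Shells of equal parity are separated, so the measures of
    all shells have a finite sum. Its tail bounds what is lost when that part of [X]
    is replaced with its part above [h k], which is separated from the part of [X] up
    to [alpha]. *)
Lemma caratheodory_sublevel : mu.-caratheodory [set x | (f x <= alpha)%R].
Proof.
apply: le_caratheodory_measurable => X; set A := [set x | _].
have [->|/negPf Xoo] := eqVneq (mu X) +oo; first by rewrite leey.
have {}Xoo : mu X < +oo by rewrite ltey Xoo.
have := nneseries_tail_cvg (shell_summable Xoo) (fun k _ => outer_measure_ge0 mu (shell X k)).
move=> tail0; apply/lee_addgt0Pr => e e0.
have [k tail_k] : exists k, \sum_(k <= j <oo) mu (shell X j) <= e%:E.
  move/fine_cvgP : tail0 => [fin0 /cvgrPdist_lt/(_ _ e0) near0].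
  have [k _ /(_ k (leqnn k))[+ +]] := filterI fin0 near0.
  move=> fk; rewrite sub0r normrN => /ltW fke; exists k.
  by rewrite -(fineK fk) lee_fin; exact: le_trans (ler_norm _) fke.
pose Xk := [set x | X x /\ (h k <= f x)%R].
have XkE : X `&` ~` A `<=` Xk `|` \bigcup_(j in [set j | (k <= j)%N]) shell X j.
  move=> x [Xx /negP]; rewrite -ltNge => fx.
  have [hk|hk] := leP (h k) (f x); [by left|right].
  have exm : exists m, (h m <= f x)%R.
    exists (Num.truncn (f x - alpha)^-1); rewrite /h -lerBrDl.
    by rewrite -[leRHS]invrK lef_pV2 ?posrE ?ltr0n ?invr_gt0 ?subr_gt0// ltW ?truncnS_gt.
  have [m hm mmin] := ex_minnP exm.
  have km : (k < m)%N by rewrite ltnNge; apply/negP => /h_le; lra.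
  exists m.-1; first by rewrite /=; lia.
  split => //; rewrite prednK ?(leq_ltn_trans _ km)// hm/= ltNge.
  by apply/negP => /mmin; lia.
apply: (@le_trans _ _ (mu (X `&` A) + (mu Xk + e%:E))).
  rewrite leeD2l//; apply: le_trans (le_outer_measure _ _ _ XkE) _.
  apply: le_trans (outer_measureU2 _ _ _) _; rewrite leeD2l//.
  apply: le_trans tail_k; rewrite -nneseries_addn; last by move=> *; exact: outer_measure_ge0.
  apply: le_trans (outer_measure_sigma_subadditive mu (fun j => shell X (j + k))).
  apply: le_outer_measure => x [j /= kj xj]; exists (j - k)%N => //.
  by rewrite /= subnK.
rewrite addeA leeD2r//.
apply: (@le_trans _ _ (mu ((X `&` A) `|` Xk))).
  apply: (@mu_sep _ _ alpha (h k)) => [|x []//|x []//].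
  by rewrite ltrDl invr_gt0 ltr0n.
by apply: le_outer_measure => x [[]|[]].
Qed.

End Caratheodory.

(** * Hausdorff measure and volume *)

Section HausdorffMetric.
Local Open Scope ereal_scope.
Context (R : realType).
Implicit Types (n d : nat).

Lemma diam_le n (A : set 'rV[R]_n) (r : \bar R) :
  (forall x y, A x -> A y -> (enorm (x - y))%:E <= r) -> diam A <= r.
Proof. by move=> Ar; apply: ge_ereal_sup => _ [x Ax [y Ay <-]]; exact: Ar. Qed.

Lemma enorm_le_diam n (A : set 'rV[R]_n) x y : A x -> A y ->
  (enorm (x - y))%:E <= diam A.
Proof. by move=> Ax Ay; apply: ereal_sup_ubound; exists x => //; exists y. Qed.

Lemma diam_set0 n : diam (set0 : set 'rV[R]_n) = -oo.
Proof.
rewrite /diam (_ : [set _ | _ in _ & _ in _] = set0) ?ereal_sup0//.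
by rewrite -subset0 => ? [].
Qed.

Lemma hausdorff_weight_set0 n d : hausdorff_weight d (set0 : set 'rV[R]_n) = 0.
Proof. by rewrite /hausdorff_weight eqxx. Qed.

Lemma hausdorff_delta_le n d delta (A : set 'rV[R]_n) (F : (set 'rV[R]_n)^nat) :
  A `<=` \bigcup_k F k -> (forall k, diam (F k) <= delta%:E) ->
  hausdorff_delta d delta A <= \sum_(k <oo) hausdorff_weight d (F k).
Proof. by move=> AF Fd; apply: ereal_inf_lbound; exists F. Qed.

Lemma hausdorff_delta_ge n d delta (A : set 'rV[R]_n) r :
  (forall F : (set 'rV[R]_n)^nat, A `<=` \bigcup_k F k ->
     (forall k, diam (F k) <= delta%:E) ->
     r <= \sum_(k <oo) hausdorff_weight d (F k)) ->
  r <= hausdorff_delta d delta A.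
Proof. by move=> H; apply: le_ereal_inf_tmp => _ [F [AF Fd] <-]; exact: H. Qed.

Lemma hausdorff_delta_anti n d (A : set 'rV[R]_n) (e1 e2 : R) : (e1 <= e2)%R ->
  hausdorff_delta d e2 A <= hausdorff_delta d e1 A.
Proof.
move=> e12; apply: hausdorff_delta_ge => F AF Fe.
by apply: hausdorff_delta_le => // k; rewrite (le_trans (Fe k))// lee_fin.
Qed.

Lemma hausdorff_delta_le_unnormalized n d (A : set 'rV[R]_n) (e : R) : (0 < e)%R ->
  hausdorff_delta d e A <= hausdorff_unnormalized d A.
Proof. by move=> e0; apply: ereal_sup_ubound; exists e. Qed.

Lemma hausdorff_delta_sep n d (A B : set 'rV[R]_n) (e delta : R) : (delta < e)%R ->
  (forall x y, A x -> B y -> e <= enorm (x - y))%R ->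
  hausdorff_delta d delta A + hausdorff_delta d delta B <=
  hausdorff_delta d delta (A `|` B).
Proof.
move=> de AB; apply: hausdorff_delta_ge => F ABF Fd.
pose G (C : set 'rV[R]_n) k := if `[< F k `&` C !=set0 >] then F k else set0.
have Gd C k : diam (G C k) <= delta%:E.
  by rewrite /G; case: asboolP => // _; rewrite diam_set0 leNye.
have GC C : C `<=` A `|` B -> C `<=` \bigcup_k G C k.
  move=> CAB x Cx; have [k _ Fx] := ABF x (CAB x Cx); exists k => //.
  by rewrite /G; case: asboolP => // -[]; exists x.
apply: (@le_trans _ _ (\sum_(k <oo) hausdorff_weight d (G A k) +
    \sum_(k <oo) hausdorff_weight d (G B k))).
  by apply: leeD; apply: hausdorff_delta_le => //; apply: GC => x ?; [left|right].
rewrite -nneseriesD; [|by move=> *; exact: hausdorff_weight_ge0..].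
apply: lee_nneseries => [k _ _|k _].
  by apply: adde_ge0; exact: hausdorff_weight_ge0.
rewrite /G; case: asboolP => [[x [Fx Ax]]|_]; last first.
  rewrite hausdorff_weight_set0 add0e.
  by case: asboolP => // _; rewrite hausdorff_weight_set0 hausdorff_weight_ge0.
case: asboolP => [[y [Fy By]]|_]; last by rewrite hausdorff_weight_set0 adde0.
have := le_trans (enorm_le_diam Fx Fy) (Fd k); rewrite lee_fin => xy.
by have := le_lt_trans (le_trans (AB _ _ Ax By) xy) de; rewrite ltxx.
Qed.

Lemma hausdorff_unnormalized_sep n d (A B : set 'rV[R]_n) (e : R) : (0 < e)%R ->
  (forall x y, A x -> B y -> e <= enorm (x - y))%R ->
  hausdorff_unnormalized d A + hausdorff_unnormalized d B <=
  hausdorff_unnormalized d (A `|` B).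
Proof.
move=> e0 AB.
have key (d1 d2 : R) : (0 < d1)%R -> (0 < d2)%R ->
    hausdorff_delta d d1 A + hausdorff_delta d d2 B <=
    hausdorff_unnormalized d (A `|` B).
  move=> d10 d20; pose dd := Num.min (Num.min d1 d2) (e / 2)%R.
  have dd0 : (0 < dd)%R by rewrite !lt_min d10 d20 divr_gt0.
  apply: le_trans (hausdorff_delta_le_unnormalized _ _ dd0).
  apply: (le_trans _ (hausdorff_delta_sep (e := e) _ _ _)) => //; last first.
    by rewrite gt_min ltr_pdivrMr// mulr_natr mulr2n ltrDl e0 orbT.
  by apply: leeD; apply: hausdorff_delta_anti; rewrite !ge_min lexx ?orbT.
have [Hoo|Hfin] := eqVneq (hausdorff_unnormalized d (A `|` B)) +oo.
  by rewrite Hoo leey.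
have fin2 (d2 : R) : (0 < d2)%R -> hausdorff_delta d d2 B \is a fin_num.
  move=> d20; rewrite ge0_fin_numE ?hausdorff_delta_ge0//.
  have := key 1%R d2 ltr01 d20; rewrite -ltey in Hfin => /le_lt_trans/(_ Hfin).
  by apply: le_lt_trans; rewrite leeDr// hausdorff_delta_ge0.
have AB' : hausdorff_unnormalized d B \is a fin_num.
  rewrite ge0_fin_numE ?hausdorff_unnormalized_ge0//.
  apply: (@le_lt_trans _ _ (hausdorff_unnormalized d (A `|` B))); last by rewrite ltey.
  apply: ge_ereal_sup => _ [d2 d20 <-]; apply: le_trans (key _ _ d20 d20).
  by rewrite leeDr// hausdorff_delta_ge0.
rewrite -leeBrDr//; apply: ge_ereal_sup => _ [d1 d10 <-].
have fin1 : hausdorff_delta d d1 A \is a fin_num.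
  rewrite ge0_fin_numE ?hausdorff_delta_ge0//.
  apply: (@le_lt_trans _ _ (hausdorff_unnormalized d (A `|` B))); last by rewrite ltey.
  by apply: le_trans (key _ _ d10 d10); rewrite leeDl// hausdorff_delta_ge0.
rewrite leeBrDr// addeC -leeBrDr//; apply: ge_ereal_sup => _ [d2 d20 <-].
by rewrite leeBrDr// addeC; exact: key.
Qed.

Lemma hausdorff_sep n d (A B : set 'rV[R]_n) (e : R) : (0 < e)%R ->
  (forall x y, A x -> B y -> e <= enorm (x - y))%R ->
  hausdorff d A + hausdorff d B <= hausdorff d (A `|` B).
Proof.
move=> e0 AB; rewrite /hausdorff -ge0_muleDr ?hausdorff_unnormalized_ge0//.
apply: lee_wpmul2l; last exact: (hausdorff_unnormalized_sep _ e0).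
by rewrite lee_fin invr_ge0 fine_ge0// hausdorff_unnormalized_ge0.
Qed.

Lemma caratheodory_lipschitz n d (f : 'rV[R]_n -> R) (a : R) :
  (forall x y, `|f x - f y| <= enorm (x - y))%R ->
  (hausdorff_outer R n d).-caratheodory [set x | f x <= a]%R.
Proof.
move=> fL; apply: caratheodory_sublevel => A B s t st As Bt.
apply: (@hausdorff_sep _ _ _ _ (t - s)); first by rewrite subr_gt0.
move=> x y /As fx /Bt fy; apply: le_trans (fL x y).
by rewrite distrC; apply: le_trans (ler_norm _); rewrite lerD// lerN2.
Qed.

Lemma measurable_lipschitz n d (f : 'rV[R]_n -> R) :
  (forall x y, `|f x - f y| <= enorm (x - y))%R ->
  measurable_fun setT (f : caratheodory_type (hausdorff_outer R n d) -> R).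
Proof.
move=> fL; apply: (measurability (@RGenOInfty.G R)); first exact: RGenOInfty.measurableE.
move=> _ [_ [a ->] <-]; rewrite setTI.
rewrite (_ : f @^-1` _ = ~` [set x | f x <= a]%R).
  apply: measurableC; exact: caratheodory_lipschitz.
by apply/seteqP; split=> x /=; rewrite in_itv/= andbT ltNge => /negP.
Qed.

Lemma lee_expe (x y : \bar R) k : 0 <= x -> x <= y -> x ^+ k <= y ^+ k.
Proof.
move=> x0 xy; elim: k => [|k IH]; first by rewrite !expe0.
by rewrite !expeS lee_pmul// expe_ge0.
Qed.

Lemma hausdorff_weight_le m n d (A : set 'rV[R]_m) (B : set 'rV[R]_n) :
  (A !=set0 -> B !=set0) -> diam A <= diam B ->
  hausdorff_weight d A <= hausdorff_weight d B.
Proof.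
move=> AB dAB; rewrite /hausdorff_weight.
case: eqVneq => [_|/set0P A0]; first exact: hausdorff_weight_ge0.
case: eqVneq => [B0|/set0P B0]; first by have [x] := AB A0; rewrite B0.
by apply: lee_expe => //; exact: diam_ge0.
Qed.

(** Coverings travel along an isometry in both directions, by images and by preimages. *)
Lemma hausdorff_unnormalized_isometry m n d (phi : 'rV[R]_m -> 'rV[R]_n)
    (A : set 'rV[R]_m) :
  (forall x y, enorm (phi x - phi y) = enorm (x - y))%R ->
  hausdorff_unnormalized d (phi @` A) = hausdorff_unnormalized d A.
Proof.
move=> iso; congr ereal_sup; apply/seteqP.
suff E delta : hausdorff_delta d delta (phi @` A) = hausdorff_delta d delta A.
  by split=> _ [delta d0 <-]; exists delta; rewrite ?E.
apply/eqP; rewrite eq_le; apply/andP; split; apply: hausdorff_delta_ge => F AF Fd.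
- apply: (@le_trans _ _ (\sum_(k <oo) hausdorff_weight d (phi @` F k))).
    apply: hausdorff_delta_le => [_ [x /AF[k _ Fx] <-]|k].
      by exists k => //; exists x.
    apply: diam_le => _ _ [x Fx <-] [y Fy <-]; rewrite iso.
    exact: le_trans (enorm_le_diam Fx Fy) (Fd k).
  apply: lee_nneseries => [k _ _|k _]; first exact: hausdorff_weight_ge0.
  apply: hausdorff_weight_le; first by move=> [_ [x Fx _]]; exists x.
  by apply: diam_le => _ _ [x Fx <-] [y Fy <-]; rewrite iso; exact: enorm_le_diam.
- apply: (@le_trans _ _ (\sum_(k <oo) hausdorff_weight d (phi @^-1` F k))).
    apply: hausdorff_delta_le => [x Ax|k].
      by have [k _ Fx] := AF _ (imageP phi Ax); exists k.
    apply: diam_le => x y Fx Fy; rewrite -iso.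
    exact: le_trans (@enorm_le_diam _ (F k) _ _ Fx Fy) (Fd k).
  apply: lee_nneseries => [k _ _|k _]; first exact: hausdorff_weight_ge0.
  apply: hausdorff_weight_le; first by move=> [x Fx]; exists (phi x).
  by apply: diam_le => x y Fx Fy; rewrite -iso; exact: (@enorm_le_diam _ (F k)).
Qed.

Lemma hausdorff_isometry m n d (phi : 'rV[R]_m -> 'rV[R]_n) (A : set 'rV[R]_m) :
  (forall x y, enorm (phi x - phi y) = enorm (x - y))%R ->
  hausdorff d (phi @` A) = hausdorff d A.
Proof. by move=> iso; rewrite /hausdorff hausdorff_unnormalized_isometry. Qed.

Lemma diam_box d (a : 'rV[R]_d) (l : R) : (0 <= l)%R -> diam (box a l) <= (d%:R * l)%:E.
Proof.
move=> l0; apply: diam_le => x y xb yb; rewrite lee_fin.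
apply: le_trans (enorm_le_sum _) _; rewrite mulr_natl -[X in (_ *+ X)%R](card_ord d) -sumr_const.
apply: ler_sum => i _; rewrite !mxE ler_norml.
have := xb i; have := yb i; rewrite !in_itv/= => /andP[? ?] /andP[? ?].
by apply/andP; split; lra.
Qed.

(** The box is covered by the [N.+1 ^ d] cells of a grid whose step [s] is so small
    that the diameter of a cell, at most [d * s], does not exceed [delta]. *)
Lemma hausdorff_delta_box d (a : 'rV[R]_d) (l delta : R) : (0 < l)%R -> (0 < delta)%R ->
  hausdorff_delta d delta (box a l) <= ((d%:R * l) ^+ d)%:E.
Proof.
move=> l0 delta0.
pose N := Num.truncn (d%:R * l / delta)%R.
pose s : R := (l / N.+1%:R)%R.
have s0 : (0 < s)%R by rewrite divr_gt0// ltr0n.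
have Ns : (N.+1%:R * s = l)%R by rewrite /s mulrC divfK// pnatr_eq0.
have ds : (d%:R * s <= delta)%R.
  rewrite mulrA ler_pdivrMr ?ltr0n// [leRHS]mulrC -ler_pdivrMr//.
  exact/ltW/truncnS_gt.
pose T := {ffun 'I_d -> 'I_N.+1}.
pose cell (c : T) := box (\row_i (a ord0 i + (c i)%:R * s)%R) s.
pose F k := if insub k is Some o then cell (enum_val (o : 'I_#|T|)) else set0.
have Fcov : box a l `<=` \bigcup_k F k.
  move=> x xb.
  have /choice[c cx] : forall i, exists c : 'I_N.+1,
      (a ord0 i + c%:R * s <= x ord0 i <= a ord0 i + c%:R * s + s)%R.
    move=> i; have := xb i; rewrite in_itv/= => /andP[x1 x2].
    pose t := ((x ord0 i - a ord0 i) / s)%R.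
    have t0 : (0 <= t)%R by rewrite divr_ge0 ?(ltW s0)// subr_ge0.
    have /andP[t1 t2] := truncn_itv t0.
    have [tN|Nt] := ltnP (Num.truncn t) N.+1.
      exists (Ordinal tN) => /=; rewrite -lerBrDl -ler_pdivlMr// t1/=.
      by rewrite -addrA -lerBlDl -[X in (_ <= _ + X)%R]mul1r -mulrDl natr1 -ler_pdivrMr// ltW.
    exists ord_max => /=; have lE : (l = N%:R * s + s)%R.
      by rewrite -[X in (_ + X)%R]mul1r -mulrDl natr1 mulrC divfK// pnatr_eq0.
    rewrite -addrA -lE x2 andbT -lerBrDl -ler_pdivlMr// -/t.
    by apply: le_trans t1; rewrite ler_nat; apply: leq_trans Nt.
  exists (enum_rank (finfun c : T)) => //; rewrite /F valK enum_rankK => i.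
  by rewrite mxE ffunE in_itv/=; exact: cx.
have Fd k : diam (F k) <= delta%:E.
  rewrite /F; case: insub => [j| ]; last by rewrite diam_set0 leNye.
  by apply: le_trans (diam_box _ (ltW s0)) _; rewrite lee_fin.
apply: le_trans (hausdorff_delta_le d Fcov Fd) _.
rewrite (nneseries_split 0 #|T|); last by move=> *; exact: hausdorff_weight_ge0.
rewrite add0n eseries0 ?adde0; last first.
  by move=> k kT _; rewrite /F insubF ?hausdorff_weight_set0// ltnNge kT.
have w_le k : hausdorff_weight d (F k) <= ((d%:R * s) ^+ d)%:E.
  rewrite EFin_expe /hausdorff_weight; case: eqVneq => [_|/set0P F0].
    by rewrite expe_ge0// lee_fin mulr_ge0// ltW.
  have {}Fd : diam (F k) <= (d%:R * s)%:E.
    rewrite /F; case: insub => [j| ]; last by rewrite diam_set0 leNye.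
    exact: diam_box (ltW s0).
  by apply: lee_expe => //; exact: diam_ge0.
apply: (@le_trans _ _ (\sum_(0 <= k < #|T|) ((d%:R * s) ^+ d)%:E)).
  by apply: lee_sum => k _; exact: w_le.
rewrite sumEFin big_const_nat subn0 iter_addr_0 lee_fin card_ffun !card_ord.
by rewrite -[X in (X <= _)%R]mulr_natl natrX -exprMn mulrCA Ns.
Qed.

Lemma hausdorff_unnormalized_box d (a : 'rV[R]_d) (l : R) : (0 < l)%R ->
  hausdorff_unnormalized d (box a l) <= ((d%:R * l) ^+ d)%:E.
Proof.
by move=> l0; apply: ge_ereal_sup => _ [delta delta0 <-]; exact: hausdorff_delta_box.
Qed.

Lemma unit_cubeE d : @unit_cube R d = box 0%R 1%R.
Proof. by apply/seteqP; split=> x /= xb i; have := xb i; rewrite mxE add0r. Qed.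

(** A set of diameter [r] lies in a box of side [2 * r]; hence a covering weighs at
    least [2 ^- d] times the volume that it covers. *)
Lemma hausdorff_unnormalized_cube_gt0 d : 0 < hausdorff_unnormalized d (@unit_cube R d).
Proof.
apply: (@lt_le_trans _ _ ((2 ^+ d)^-1)%:E); first by rewrite lte_fin invr_gt0 exprn_gt0.
apply: le_trans (hausdorff_delta_le_unnormalized _ _ (ltr01 : (0 < 1 :> R)%R)).
apply: hausdorff_delta_ge => F QF Fd.
have d2 : (0 < (2 ^+ d)^-1 :> R)%R by rewrite invr_gt0 exprn_gt0.
have v1 : volume (@unit_cube R d) = 1 by rewrite unit_cubeE volume_box// expr1n.
rewrite -[leLHS]mule1 -[X in _ * X <= _]v1.
have /choice[B BP] : forall k, exists B : set 'rV[R]_d, [/\ measurable B, F k `<=` B &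
    ((2 ^+ d)^-1)%:E * volume B <= hausdorff_weight d (F k)].
  move=> k; have [F0|/set0P[x Fx]] := eqVneq (F k) set0.
    by exists set0; split; rewrite ?F0// measure0 mule0 hausdorff_weight_set0.
  have dF0 : 0 <= diam (F k) by apply: diam_ge0; exists x.
  have dFfin : diam (F k) \is a fin_num.
    by rewrite ge0_fin_numE// (le_lt_trans (Fd k))// ltry.
  pose r := fine (diam (F k)).
  have r0 : (0 <= r)%R by rewrite fine_ge0.
  exists (box (x - const_mx r)%R (r *+ 2)%R); split.
  - exact: measurable_box.
  - move=> y Fy i; have := enorm_le_diam Fx Fy; rewrite -(fineK dFfin) lee_fin -/r.
    move=> /(le_trans (le_coord_enorm _ i)); rewrite !mxE in_itv/= ler_norml mulr2n.
    by move=> /andP[? ?]; apply/andP; split; lra.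
  - rewrite volume_box ?mulrn_wge0// /hausdorff_weight; case: eqVneq => [F0|_].
      by move: Fx; rewrite F0.
    rewrite -(fineK dFfin) -/r -EFin_expe -EFinM lee_fin -[(r *+ 2)%R]mulr_natl exprMn mulKf ?expf_neq0//.
apply: (@le_trans _ _ (\sum_(k <oo) ((2 ^+ d)^-1)%:E * volume (B k))).
  rewrite nneseriesZl//.
  rewrite lee_pmul2l ?lte_fin//.
  apply: measure_sigma_subadditive => [k||x Qx].
  - by have [] := BP k.
  - by rewrite unit_cubeE; exact: measurable_box.
  - by have [k _ Fx] := QF x Qx; exists k => //; have [_ + _] := BP k; exact.
apply: lee_nneseries => [k _ _|k _]; last by have [] := BP k.
by apply: mule_ge0 => //; rewrite lee_fin ltW.
Qed.

Lemma hausdorff_unnormalized_cube_fin d :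
  hausdorff_unnormalized d (@unit_cube R d) \is a fin_num.
Proof.
rewrite ge0_fin_numE ?hausdorff_unnormalized_ge0// unit_cubeE.
exact: le_lt_trans (hausdorff_unnormalized_box _ ltr01) (ltry _).
Qed.

Lemma hausdorff_cube d : hausdorff d (@unit_cube R d) = 1.
Proof.
have Hfin := hausdorff_unnormalized_cube_fin d.
rewrite /hausdorff -[X in _ * X](fineK Hfin) -EFinM mulVf//.
by rewrite gt_eqF// fine_gt0// hausdorff_unnormalized_cube_gt0 ltey_eq Hfin.
Qed.

(** The coordinates are 1-Lipschitz, and the sublevel sets of 1-Lipschitz functions
    are Caratheodory measurable. *)
Lemma measurable_caratheodory_id n d :
  measurable_fun setT (id : caratheodory_type (hausdorff_outer R n d) -> 'rV[R]_n).
Proof.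
apply: measurable_fun_row => i; apply: measurable_lipschitz => x y.
by rewrite (_ : _ - _ = (x - y) ord0 i)%R ?le_coord_enorm// !mxE.
Qed.

Lemma caratheodory_borel n d (A : set 'rV[R]_n) : measurable A ->
  (hausdorff_outer R n d).-cara.-measurable A.
Proof.
move=> mA; rewrite -[A]/(id @^-1` A) -[X in measurable X]setTI.
exact: measurable_caratheodory_id.
Qed.

(** [hausdorff] on the Borel sets, where it is to be compared with [volume]. *)
Definition borel_hausdorff n d : set 'rV[R]_n -> \bar R := @hausdorff R n d.

Let borel_hausdorff_semi_sigma_additive n d : semi_sigma_additive (@borel_hausdorff n d).
Proof.
move=> F mF tF mUF.
apply: (measure_semi_sigma_additive (s := hausdorff_measure R n d)) => //.
  by move=> i; exact: caratheodory_borel.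
exact: caratheodory_borel.
Qed.

HB.instance Definition _ n d := isMeasure.Build _ _ _ (@borel_hausdorff n d)
  (outer_measure0 (hausdorff_outer R n d)) (outer_measure_ge0 (hausdorff_outer R n d))
  (@borel_hausdorff_semi_sigma_additive n d).

Lemma hausdorff_translation n d (A : set 'rV[R]_n) (p : 'rV[R]_n) :
  hausdorff d ((fun x => x + p)%R @^-1` A) = hausdorff d A.
Proof.
rewrite -[RHS](@hausdorff_isometry _ _ _ (fun x => x - p)%R); last first.
  by move=> x y; rewrite opprB addrA subrK.
congr hausdorff; apply/seteqP; split=> [x Ax|_ [x Ax <-]] /=; last by rewrite subrK.
by exists (x + p)%R => //; rewrite addrK.
Qed.

Let borel_hausdorff_sigma_finite d : sigma_finite setT (@borel_hausdorff d d).
Proof.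
exists (fun k => box (const_mx (- k.+1%:R)%R) (k.+1%:R *+ 2)%R).
  apply/esym; rewrite -subTset => x _.
  pose M := (\sum_i `|x ord0 i|)%R.
  exists (Num.truncn M) => // i; rewrite mxE in_itv /= mulr2n addKr -ler_norml.
  apply: le_trans (ltW (truncnS_gt _)).
  by rewrite /M (bigD1 i)//= lerDl sumr_ge0.
move=> k; split; first exact: measurable_box.
rewrite /borel_hausdorff /hausdorff lte_mul_pinfty//.
  by rewrite lee_fin invr_ge0 fine_ge0// hausdorff_unnormalized_ge0.
apply: le_lt_trans (ltry _); apply: hausdorff_unnormalized_box.
by rewrite mulrn_wgt0// ltr0n.
Qed.

HB.instance Definition _ d := Measure_isSigmaFinite.Build _ _ _ (@borel_hausdorff d d)
  (@borel_hausdorff_sigma_finite d).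

(** Both sides are translation invariant and finite on boxes, hence proportional, and
    the normalisation of [hausdorff] on the unit cube makes the factor 1. *)
Theorem hausdorff_volume d (A : set 'rV[R]_d) : measurable A ->
  hausdorff d A = volume A.
Proof.
move=> mA.
(* the symmetric set of the uniqueness lemma is the box [-1, 1]^d *)
have uniq (B : set 'rV[R]_d) : measurable B -> hausdorff d (box (const_mx (-1)%R : 'rV[R]_d) 2%R) * volume B =
    hausdorff d B * (2 ^+ d)%:E.
  move=> mB; rewrite -(volume_box (const_mx (-1)%R : 'rV[R]_d) (ler0n R 2)).
  apply: (@translation_invariant_unique R d (@borel_hausdorff d d)) => //.
  - by move=> C p _; exact: hausdorff_translation.
  - exact: measurable_box.
  - move=> x xb i; have := xb i; rewrite !mxE !in_itv/= => /andP[? ?].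
    by apply/andP; split; lra.
have H2 : hausdorff d (box (const_mx (-1)%R : 'rV[R]_d) 2%R) = (2 ^+ d)%:E.
  have := uniq (@unit_cube R d); rewrite hausdorff_cube unit_cubeE.
  rewrite volume_box// expr1n mule1 mul1e; apply.
  exact: measurable_box.
have := uniq A mA; rewrite H2 muleC => E.
have d0 : 0 < (2 ^+ d : R)%:E by rewrite lte_fin exprn_gt0.
have dfin : (2 ^+ d : R)%:E \is a fin_num by [].
apply/eqP; rewrite eq_le; apply/andP; split.
  by rewrite -(lee_pmul2r dfin d0) E.
by rewrite -(lee_pmul2r dfin d0) E.
Qed.

End HausdorffMetric.

(** * Isometries and adapted coordinates *)

Section Isometry.
Context (R : realType).

Lemma mx_norm_le_enorm n (x : 'rV[R]_n) : `|x| <= enorm x.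
Proof.
rewrite [leLHS]/Num.norm /= mx_normrE; apply/bigmax_leP; split; first exact: enorm_ge0.
by move=> [i j] _ /=; rewrite (ord1 i); exact: le_coord_enorm.
Qed.

Lemma coord_le_mx_norm n (x : 'rV[R]_n) i : `|x ord0 i| <= `|x|.
Proof.
rewrite [leRHS]/Num.norm /= mx_normrE; apply/bigmax_geP; right.
by exists (ord0, i).
Qed.

Lemma enorm_le_mx_norm n (x : 'rV[R]_n) : enorm x <= n%:R * `|x|.
Proof.
apply: le_trans (enorm_le_sum _) _.
rewrite mulr_natl -[X in _ *+ X](card_ord n) -sumr_const.
by apply: ler_sum => i _; exact: coord_le_mx_norm.
Qed.

Lemma lipschitz_continuous (V W : normedModType R) (f : V -> W) (k : R) : 0 <= k ->
  (forall x y, `|f x - f y| <= k * `|x - y|) -> continuous f.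
Proof.
move=> k0 fL x; apply/(@cvgrPdist_lt _ _ _ (nbhs x)) => e e0; near=> y.
apply: le_lt_trans (fL _ _) _.
apply: (@le_lt_trans _ _ ((k + 1) * `|x - y|)); first by rewrite ler_wpM2r// lerDl.
rewrite mulrC -ltr_pdivlMr ?ltr_wpDl//; near: y.
by apply: cvgr_dist_lt => //; rewrite divr_gt0// ltr_wpDl.
Unshelve. all: by end_near. Qed.

Lemma isometry_continuous m n (phi : 'rV[R]_m -> 'rV[R]_n) :
  (forall x y, enorm (phi x - phi y) = enorm (x - y)) -> continuous phi.
Proof.
move=> iso; apply: (@lipschitz_continuous _ _ _ m%:R) => // x y.
apply: le_trans (mx_norm_le_enorm _) _; rewrite iso.
exact: enorm_le_mx_norm.
Qed.

Lemma dot_continuous n (u : 'rV[R]_n) : continuous (fun x => dot x u).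
Proof.
apply: (@lipschitz_continuous 'rV[R]_n R _ (\sum_i `|u ord0 i|)); first exact: sumr_ge0.
move=> x y; rewrite -dotBl (le_trans (ler_norm_sum _ _ _))// mulr_suml.
apply: ler_sum => i _; rewrite normrM mulrC ler_wpM2l//.
exact: coord_le_mx_norm.
Qed.

(** For [w = 0] this is the identity, as [frame] needs when [u] is the first basis
    vector. *)
Definition reflect n (w x : 'rV[R]_n) : 'rV[R]_n := x - (2 * dot x w / dot w w) *: w.

Lemma reflectD n (w x y : 'rV[R]_n) : reflect w (x + y) = reflect w x + reflect w y.
Proof.
rewrite /reflect dotDl mulrDr mulrDl scalerDl opprD !addrA; congr (_ - _).
by rewrite addrAC.
Qed.

Lemma reflectZ n (w x : 'rV[R]_n) a : reflect w (a *: x) = a *: reflect w x.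
Proof. by rewrite /reflect dotZl scalerBr scalerA mulrCA !mulrA. Qed.

Lemma reflectB n (w x y : 'rV[R]_n) : reflect w (x - y) = reflect w x - reflect w y.
Proof. by rewrite reflectD -scaleN1r reflectZ scaleN1r. Qed.

Lemma reflect_dot n (w x y : 'rV[R]_n) : dot (reflect w x) (reflect w y) = dot x y.
Proof.
rewrite /reflect dotBl !dotBr !dotZl !dotZr (dotC w y).
have [->|w0] := eqVneq (dot w w) 0; first by rewrite invr0; ring.
by field.
Qed.

Lemma reflectK n (w : 'rV[R]_n) : involutive (reflect w).
Proof.
move=> x; rewrite {1}/reflect [reflect w x]/reflect.
have [w0|w0] := eqVneq (dot w w) 0; first by rewrite w0 invr0 !mulr0 scale0r !subr0.
rewrite dotBl dotZl -addrA -opprD -scalerDl [X in X *: _](_ : _ = 0) ?scale0r ?subr0//.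
by field.
Qed.

Lemma reflect_isometry n (w x y : 'rV[R]_n) :
  enorm (reflect w x - reflect w y) = enorm (x - y).
Proof. by rewrite -reflectB /enorm reflect_dot. Qed.

Lemma measurable_dot n (u : 'rV[R]_n) : measurable_fun setT (fun x : 'rV[R]_n => dot x u).
Proof. by apply: continuous_row_measurable; exact: dot_continuous. Qed.

Lemma measurable_isometry m n (phi : 'rV[R]_m -> 'rV[R]_n) :
  (forall x y, enorm (phi x - phi y) = enorm (x - y)) -> measurable_fun setT phi.
Proof.
move=> iso; apply: measurable_fun_row => i; apply: continuous_row_measurable => x.
apply: (continuous_comp (f := phi) (g := fun y => y ord0 i)).
  exact: isometry_continuous.
exact: coord_continuous.
Qed.

(** Volume is Hausdorff measure, which depends on distances only. *)
Lemma volume_reflect n (w : 'rV[R]_n) (A : set 'rV[R]_n) : measurable A ->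
  volume (reflect w @^-1` A) = volume A.
Proof.
move=> mA; have iso := reflect_isometry w.
have mHA : measurable (reflect w @^-1` A).
  by rewrite -[X in measurable X]setTI; exact: (measurable_isometry iso).
rewrite -!hausdorff_volume// -(hausdorff_isometry _ _ iso); congr hausdorff.
apply/seteqP; split=> [_ [x Ax <-]//|x Ax].
by exists (reflect w x); rewrite /= reflectK.
Qed.

Lemma integral_reflect n (w : 'rV[R]_n) (f : 'rV[R]_n -> \bar R) :
  measurable_fun setT f -> (forall x, 0 <= f x)%E ->
  (\int[@volume R n]_x f (reflect w x) = \int[@volume R n]_x f x)%E.
Proof.
move=> mf f0; have ms := measurable_isometry (reflect_isometry w).
transitivity (\int[pushforward (@volume R n) (reflect w)]_y f y)%E.
  by rewrite ge0_integral_pushforward.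
by apply: eq_measure_integral => A mA _; exact: volume_reflect.
Qed.

Definition e0 n : 'rV[R]_n.+1 := row_cons 1 0.

Lemma dot_cons n s t (x y : 'rV[R]_n) : dot (row_cons s x) (row_cons t y) = s * t + dot x y.
Proof.
rewrite /dot big_ord_recl !row_cons0; congr (_ + _).
by apply: eq_bigr => i _; rewrite !row_consS.
Qed.

Lemma dot_e0 n (x : 'rV[R]_n.+1) : dot x (e0 n) = x ord0 ord0.
Proof. by rewrite -[x in LHS]row_consK dot_cons dot0r mulr1 addr0. Qed.

(** The reflection that exchanges the first basis vector and the unit vector [u]: it
    turns the sections of a body orthogonal to [u] into coordinate slices. *)
Definition frame n (u : 'rV[R]_n.+1) := reflect (u - e0 n).

Lemma frame_e0 n (u : 'rV[R]_n.+1) : dot u u = 1 -> frame u (e0 n) = u.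
Proof.
move=> u1; rewrite /frame /reflect.
have e1 : dot (e0 n) (e0 n) = 1 by rewrite dot_e0 row_cons0.
have E : dot (u - e0 n) (u - e0 n) = 2 * (1 - dot u (e0 n)).
  rewrite dotBl !dotBr u1 e1 (dotC (e0 n) u); ring.
rewrite E dotBr e1 (dotC _ u).
have [ue|ue] := eqVneq (1 - dot u (e0 n)) 0.
  have : u - e0 n = 0 by apply: dot_eq0; rewrite E ue mulr0.
  by move/eqP; rewrite subr_eq0 => /eqP ->; rewrite subrr scaler0 subr0.
rewrite [X in X *: _](_ : _ = -1); first by rewrite scaleN1r opprK addrC subrK.
rewrite -[dot u (e0 n) - 1]opprB; move: (1 - _) ue => z z0; field.
by rewrite z0.
Qed.

Lemma dot_frame n (u : 'rV[R]_n.+1) x : dot u u = 1 -> dot (frame u x) u = x ord0 ord0.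
Proof. by move=> u1; rewrite -[X in dot _ X](frame_e0 u1) reflect_dot dot_e0. Qed.

Lemma row_cons_isometry n s (x y : 'rV[R]_n) :
  enorm (row_cons s x - row_cons s y) = enorm (x - y).
Proof.
have -> : row_cons s x - row_cons s y = row_cons 0 (x - y).
  by rewrite -scaleN1r -row_consZ -row_consD scaleN1r mulN1r subrr.
by rewrite /enorm dot_cons mul0r add0r.
Qed.

End Isometry.

(** * Distribution functions and quantiles *)

Section Densities.
Context (R : realType).
Notation mu := (@lebesgue_measure R).

(** Positivity and continuity are asked for in the open interval: the volume of the
    slices of a convex body may jump at its two ends. *)
Definition density (f : R -> R) (a b : R) : Prop :=
  [/\ a < b, measurable_fun setT f, (forall x, 0 <= f x),
      (forall x, x \in `]a, b[ -> 0 < f x /\ {for x, continuous f}) &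
      exists M, forall x, f x <= M].

Definition cdf (f : R -> R) (a x : R) : R := parameterized_integral mu a x f.

Definition mass (f : R -> R) (a b : R) : R := cdf f a b.

Section Cdf.
Context (f : R -> R) (a b : R) (df : density f a b).

Lemma density_integrable (c u : R) : mu.-integrable `[c, u] (EFin \o f).
Proof.
have [_ mf f0 _ [M fM]] := df.
apply: measurable_bounded_integrable => //.
- by rewrite /= lebesgue_measure_itv/=; case: ifP => _; rewrite ?ltry// -EFinD ltry.
- exact: measurable_funTS.
- exists M; split; first exact: num_real.
  by move=> t Mt x _; rewrite /= ger0_norm// (le_trans (fM x))// ltW.
Qed.

Lemma cdf_continuous : {within `[a, b], continuous (cdf f a)}.
Proof.
have [ab _ _ _ _] := df.
by apply: parameterized_integral_continuous; [exact: ltW|exact: density_integrable].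
Qed.

Lemma cdf_derive x : x \in `]a, b[ -> is_derive x 1 (cdf f a) (f x).
Proof.
have [ab _ _ fpos _] := df.
move=> xab; have [_ cx] := fpos x xab.
have [||dF FE] := @continuous_FTC1_closed R f a x b _ (density_integrable a b) _ cx.
- by rewrite (itvP xab).
- by rewrite (itvP xab).
apply: DeriveDef; first exact: dF.
by rewrite -derive1E; exact: FE.
Qed.

Lemma cdfa : cdf f a a = 0.
Proof. by rewrite /cdf /parameterized_integral set_itv1 Rintegral_set1. Qed.

Lemma cdf_lt : {in `[a, b] &, {homo cdf f a : x y / x < y}}.
Proof.
move=> x y xab yab xy.
have sub : `[x, y] `<=` `[a, b].
  by apply: subset_itv; rewrite bnd_simp ?(itvP xab) ?(itvP yab).
have [z||z zxy E] := @MVT R (cdf f a) f x y xy.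
- move=> zxy; apply: cdf_derive; move: zxy; apply: subset_itv.
    by rewrite bnd_simp (itvP xab).
  by rewrite bnd_simp (itvP yab).
- by apply: continuous_subspaceW sub _; exact: cdf_continuous.
rewrite -subr_gt0 E mulr_gt0 ?subr_gt0//.
have [_ _ _ fpos _] := df; apply: (fpos z _).1.
by move: xab yab zxy; rewrite !in_itv/=; lra.
Qed.

Lemma cdf_inj : {in `[a, b] &, injective (cdf f a)}.
Proof.
move=> x y xab yab E; have [xy|yx|//] := ltgtP x y.
  by have := cdf_lt xab yab xy; rewrite E ltxx.
by have := cdf_lt yab xab yx; rewrite E ltxx.
Qed.

Lemma mass_gt0 : 0 < mass f a b.
Proof.
have [ab _ _ _ _] := df.
by rewrite -cdfa; apply: cdf_lt => //; rewrite in_itv/= lexx (ltW ab).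
Qed.

Lemma cdf_bound x : x \in `[a, b] -> 0 <= cdf f a x <= mass f a b.
Proof.
have [ab _ _ _ _] := df; move=> xab.
apply/andP; split.
  have [->|xa] := eqVneq x a; first by rewrite cdfa.
  rewrite -cdfa ltW// cdf_lt//; first by rewrite in_itv/= lexx (ltW ab).
  by rewrite lt_neqAle eq_sym xa (itvP xab).
have [->//|xb] := eqVneq x b.
rewrite ltW// cdf_lt//; first by rewrite in_itv/= lexx (ltW ab).
by rewrite lt_neqAle xb (itvP xab).
Qed.

(** The distribution function, divided by the total mass, increases strictly from 0 to
    1 with a positive derivative; the quantile function is its inverse. *)
Lemma quantile_exists : exists X : R -> R,
  [/\ forall t : R, t \in `]0, 1[ -> X t \in `]a, b[,
      forall t : R, t \in `]0, 1[ -> cdf f a (X t) = mass f a b * t,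
      forall t : R, t \in `]0, 1[ -> is_derive t 1 X (mass f a b / f (X t)) &
      forall x, x \in `]a, b[ -> exists2 t : R, t \in `]0, 1[ & X t = x].
Proof.
have [ab _ _ fpos _] := df; have p0 := mass_gt0.
set p := mass f a b in p0 *.
pose F x := cdf f a x / p.
have Foo x : x \in `]a, b[ -> F x \in `]0, 1[.
  move=> xab; have aab : a \in `[a, b] by rewrite in_itv/= lexx (ltW ab).
  have bab : b \in `[a, b] by rewrite in_itv/= lexx (ltW ab).
  have xab' : x \in `[a, b] by apply: subset_itv_oo_cc xab.
  rewrite in_itv/= /F divr_gt0//=; last by rewrite -cdfa cdf_lt// (itvP xab).
  by rewrite ltr_pdivrMr// mul1r cdf_lt// (itvP xab).
have /choice[X XP] : forall t : R, exists x : R, (t \in `]0, 1[) -> (x \in `]a, b[) /\ F x = t.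
  move=> t; have [t01|] := boolP (t \in `]0, 1[); last by exists 0.
  have [|x xab xE] := IVT (ltW ab) cdf_continuous (v := p * t).
    rewrite cdfa -/(mass f a b) -/p; move: t01; rewrite in_itv/= => /andP[t0 t1].
    by rewrite min_l ?max_r ?(ltW p0)// mulr_ge0 ?(ltW t0) ?(ltW p0)//= ler_piMr ?(ltW p0) ?(ltW t1).
  exists x => _; rewrite /F xE mulrC mulrA mulVf ?mul1r ?gt_eqF//; split=> //.
  have xa : x != a.
    apply: contraTneq t01 => xa; move: xE; rewrite xa cdfa => /esym/eqP.
    by rewrite mulf_eq0 gt_eqF//= => /eqP ->; rewrite in_itv/= ltxx.
  have xb : x != b.
    apply: contraTneq t01 => xb; move: xE; rewrite xb -/(mass f a b) -/p => /eqP.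
    by rewrite -{1}(mulr1 p) (inj_eq (mulfI (lt0r_neq0 p0))) => /eqP <-; rewrite in_itv/= ltxx andbF.
  by move: xab; rewrite !in_itv/= !lt_neqAle (eq_sym a) xa xb.
have XK x : x \in `]a, b[ -> X (F x) = x.
  move=> xab; have [XFab FXF] := XP (F x) (Foo x xab).
  apply: cdf_inj; [exact: subset_itv_oo_cc XFab|exact: subset_itv_oo_cc xab|].
  by move: FXF; rewrite /F => /(mulIf _) -> //; rewrite invr_eq0 gt_eqF.
exists X; split.
- by move=> t /XP[].
- by move=> t /XP[_ /(canRL (divfK _))]; rewrite gt_eqF// mulrC; apply.
- move=> t t01; have [Xab FX] := XP t t01.
  rewrite -[in is_derive t]FX -invf_div.
  apply: (@is_derive_inverse R F X).
  + near=> x; apply: XK; near: x.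
    exact: near_in_itvoo.
  + near=> x.
    have xab : x \in `]a, b[ by near: x; exact: near_in_itvoo.
    apply: differentiable_continuous; apply/derivable1_diffP.
    apply: derivableM; last exact: derivable_cst.
    by case: (cdf_derive xab).
  + rewrite /F; have dX := cdf_derive Xab.
    by apply: is_derive_eq; rewrite scaler0 add0r mulrC.
  + by rewrite mulf_neq0// ?invr_eq0 gt_eqF// (fpos _ Xab).1.
- by move=> x xab; exists (F x); [exact: Foo|exact: XK].
Unshelve. all: by end_near. Qed.

End Cdf.

End Densities.

(** * The midpoint inequality on the line, by transport *)

Lemma mid_itv (R : realType) (a1 b1 a2 b2 a3 b3 x y : R) :
  a3 <= (a1 + a2) / 2 -> (b1 + b2) / 2 <= b3 ->
  x \in `]a1, b1[ -> y \in `]a2, b2[ -> (x + y) / 2 \in `]a3, b3[.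
Proof.
by move=> ? ?; rewrite !in_itv/= => /andP[? ?] /andP[? ?]; apply/andP; split; lra.
Qed.

Section Transport.
Context (R : realType).
Context (f g h : R -> R) (a1 b1 a2 b2 a3 b3 : R).
Hypotheses (df : density f a1 b1) (dg : density g a2 b2) (dh : density h a3 b3).
Hypotheses (ha : a3 <= (a1 + a2) / 2) (hb : (b1 + b2) / 2 <= b3).
Hypothesis hfg : forall x y, x \in `]a1, b1[ -> y \in `]a2, b2[ ->
  f x * g y <= h ((x + y) / 2) ^+ 2.

Let p := mass f a1 b1.
Let q := mass g a2 b2.
Let r := mass h a3 b3.
Let k := Num.sqrt (p * q).

Let p0 : 0 < p. Proof. exact: mass_gt0. Qed.
Let q0 : 0 < q. Proof. exact: mass_gt0. Qed.
Let k0 : 0 < k. Proof. by rewrite sqrtr_gt0 mulr_gt0. Qed.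
Let k2 : k ^+ 2 = p * q. Proof. by rewrite sqr_sqrtr// ltW// mulr_gt0. Qed.

Let mid x y : x \in `]a1, b1[ -> y \in `]a2, b2[ -> (x + y) / 2 \in `]a3, b3[.
Proof. exact: mid_itv. Qed.

Context (X Y : R -> R).
Hypothesis X01 : forall t : R, t \in `]0, 1[ -> X t \in `]a1, b1[.
Hypothesis Y01 : forall t : R, t \in `]0, 1[ -> Y t \in `]a2, b2[.
Hypothesis dX : forall t : R, t \in `]0, 1[ -> is_derive t 1 X (p / f (X t)).
Hypothesis dY : forall t : R, t \in `]0, 1[ -> is_derive t 1 Y (q / g (Y t)).

Let Z t := (X t + Y t) / 2.
Let Psi t := cdf h a3 (Z t).
Let psi t := h (Z t) * ((p / f (X t) + q / g (Y t)) / 2).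

Let dPsi (t : R) : t \in `]0, 1[ -> is_derive t 1 Psi (psi t).
Proof.
move=> t01; have dxt := dX t01; have dyt := dY t01.
have dh' := cdf_derive dh (mid (X01 t01) (Y01 t01)).
have dz : is_derive t 1 Z ((p / f (X t) + q / g (Y t)) / 2).
  by apply: is_derive_eq; rewrite !scaler0 add0r [RHS]mulrC.
exact: (@is_derive1_comp _ (cdf h a3) Z t).
Qed.

(* the arithmetic-geometric mean inequality for p / f (X t) and q / g (Y t), whose product times
   f (X t) * g (Y t) is p * q *)
Let psi_ge t : t \in `]0, 1[ -> k <= psi t.
Proof.
move=> t01; have xt := X01 t01; have yt := Y01 t01.
have fx : 0 < f (X t) by have [_ _ _ /(_ _ xt)[]] := df.
have gy : 0 < g (Y t) by have [_ _ _ /(_ _ yt)[]] := dg.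
have hz : 0 < h (Z t) by have [_ _ _ /(_ _ (mid xt yt))[]] := dh.
have := hfg xt yt; rewrite -/(Z t) /psi; move: fx gy hz.
move: (f _) (g _) (h _) => u v w u0 v0 w0 uvw.
have s0 : 0 <= w * ((p / u + q / v) / 2).
  by rewrite mulr_ge0 ?(ltW w0)// divr_ge0// addr_ge0// divr_ge0// ltW.
rewrite -(ger0_norm s0) -sqrtr_sqr ler_wsqrtr//.
have amgm : p * q <= u * v * ((p / u + q / v) / 2) ^+ 2.
  have -> : p * q = u * v * (p / u * (q / v)) by field; rewrite !gt_eqF.
  apply: ler_wpM2l; first by rewrite mulr_ge0 ?ltW.
  move: (p / u) (q / v) => s t'; have := sqr_ge0 (s - t'); rewrite !expr2; lra.
by rewrite exprMn; apply: le_trans amgm _; rewrite ler_wpM2r// sqr_ge0.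
Qed.

Let Psi_incr (s t : R) : s \in `]0, 1[ -> t \in `]0, 1[ -> s < t -> k * (t - s) <= Psi t - Psi s.
Proof.
move=> s01 t01 st.
have sub c : c \in `[s, t] -> c \in `](0 : R), 1[.
  by move: s01 t01; rewrite !in_itv/=; lra.
have dP c : c \in `]s, t[ -> is_derive c 1 Psi (psi c).
  by move=> cst; apply: dPsi; apply: sub; exact: subset_itv_oo_cc cst.
have cP : {within `[s, t], continuous Psi}.
  apply: continuous_in_subspaceT => c /set_mem /= /sub c01.
  apply: differentiable_continuous; apply/derivable1_diffP.
  by case: (dPsi c01).
have [c cst ->] := MVT st dP cP.
rewrite ler_wpM2r ?subr_ge0 ?(ltW st)//; apply: psi_ge; apply: sub.
exact: subset_itv_oo_cc cst.
Qed.

Let Psi_bound (t : R) : t \in `]0, 1[ -> 0 <= Psi t <= r.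
Proof.
by move=> t01; apply: cdf_bound => //; apply: subset_itv_oo_cc; exact: mid (X01 t01) (Y01 t01).
Qed.

(** [Psi] grows at least at the rate [k] and takes its values between 0 and [r]. *)
Lemma transport_ge : k <= r.
Proof.
rewrite leNgt; apply/negP => rk.
have r0 : 0 < r by exact: mass_gt0.
(* with this margin the growth of Psi from e to 1 - e would already exceed r *)
pose e := (k - r) / (4 * k).
have e0 : 0 < e by rewrite divr_gt0 ?mulr_gt0// subr_gt0.
have e4 : e < 1 / 4.
  by rewrite ltr_pdivrMr ?mulr_gt0//; lra.
have s01 : e \in `]0, 1[ by rewrite in_itv/=; lra.
have t01 : 1 - e \in `]0, 1[ by rewrite in_itv/=; lra.
have ek : e * k = (k - r) / 4 by rewrite /e; field; rewrite gt_eqF.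
have st : e < 1 - e by lra.
have := Psi_incr s01 t01 st; have := Psi_bound s01; have := Psi_bound t01.
nra.
Qed.

Hypothesis rk : r = k.

(* growth at least at the rate k within a total range of length k leaves no freedom *)
Let PsiE (t : R) : t \in `]0, 1[ -> Psi t = k * t.
Proof.
move=> t01; apply/eqP; rewrite eq_le; apply/andP; split.
- apply/ler_addgt0Pr => e e0.
  pose d := Num.min (e / k) ((1 - t) / 2).
  have d0 : 0 < d by rewrite lt_min divr_gt0//=; move: t01; rewrite in_itv/=; lra.
  have dle : d <= e / k by rewrite ge_min lexx.
  have dt : d <= (1 - t) / 2 by rewrite ge_min lexx orbT.
  have s01 : 1 - d \in `]0, 1[ by move: t01; rewrite !in_itv/=; lra.
  have ts : t < 1 - d by move: t01; rewrite !in_itv/=; lra.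
  have := Psi_incr t01 s01 ts; have /andP[_] := Psi_bound s01; rewrite rk.
  have : k * d <= e by rewrite mulrC -ler_pdivlMr.
  lra.
- apply/ler_addgt0Pr => e e0.
  pose d := Num.min (e / k) (t / 2).
  have d0 : 0 < d by rewrite lt_min divr_gt0//=; move: t01; rewrite in_itv/=; lra.
  have dle : d <= e / k by rewrite ge_min lexx.
  have dt : d <= t / 2 by rewrite ge_min lexx orbT.
  have s01 : d \in `]0, 1[ by move: t01; rewrite !in_itv/=; lra.
  have ts : d < t by move: t01; rewrite !in_itv/=; lra.
  have := Psi_incr s01 t01 ts; have /andP[+ _] := Psi_bound s01.
  have : k * d <= e by rewrite mulrC -ler_pdivlMr.
  lra.
Qed.

Let psiE (t : R) : t \in `]0, 1[ -> psi t = k.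
Proof.
move=> t01; have [_ <-] := dPsi t01.
have dk : is_derive t 1 (fun s : R => k * s) k.
  by apply: is_derive_eq; rewrite [_ *: _]mulr1.
have [_ <-] := dk; apply: near_eq_derive => //.
by near=> s; apply: PsiE; near: s; exact: near_in_itvoo.
Unshelve. all: by end_near. Qed.

(** This is the equality case of the arithmetic-geometric mean inequality used for
    [psi_ge]. *)
Lemma transport_eq_derive (t : R) : t \in `]0, 1[ -> p / f (X t) = q / g (Y t).
Proof.
move=> t01; have := psiE t01.
have xt := X01 t01; have yt := Y01 t01.
have fx : 0 < f (X t) by have [_ _ _ /(_ _ xt)[]] := df.
have gy : 0 < g (Y t) by have [_ _ _ /(_ _ yt)[]] := dg.
have hz : 0 < h (Z t) by have [_ _ _ /(_ _ (mid xt yt))[]] := dh.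
have := hfg xt yt; rewrite -/(Z t) /psi; move: fx gy hz.
move: (f _) (g _) (h _) => u v w u0 v0 w0 uvw E.
have : w ^+ 2 * ((p / u + q / v) / 2) ^+ 2 = u * v * (p / u * (q / v)).
  by rewrite -exprMn E k2; field; rewrite !gt_eqF.
have pu : 0 < p / u by rewrite divr_gt0.
have qv : 0 < q / v by rewrite divr_gt0.
move: (p / u) (q / v) pu qv => s t' s0 t'0 E2.
have : u * v * ((s + t') / 2) ^+ 2 <= u * v * (s * t').
  by rewrite -E2 ler_wpM2r// sqr_ge0.
rewrite ler_pM2l ?mulr_gt0// => H.
have : (s - t') ^+ 2 <= 0 by move: H; rewrite !expr2; lra.
by rewrite le_eqVlt ltNge sqr_ge0 orbF sqrf_eq0 subr_eq0 => /eqP.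
Qed.

(** The derivatives of the two transport maps agree, so the maps differ by a constant. *)
Lemma transport_eq_shift : exists c, forall t : R, t \in `]0, 1[ -> X t = Y t + c.
Proof.
exists (X (1 / 2) - Y (1 / 2)) => t t01.
pose D s := X s - Y s.
suff : D t = D (1 / 2) by rewrite /D => <-; rewrite addrC subrK.
have dD (s : R) : s \in `]0, 1[ -> is_derive s 1 D 0.
  move=> s01; have dxs := dX s01; have dys := dY s01.
  by apply: is_derive_eq; rewrite (transport_eq_derive s01) subrr.
have half : 1 / 2 \in `](0 : R), 1[ by rewrite in_itv/=; lra.
have key (s s' : R) : s \in `]0, 1[ -> s' \in `]0, 1[ -> s < s' -> D s = D s'.
  move=> s01 s'01 ss'.
  have sub c : c \in `[s, s'] -> c \in `](0 : R), 1[.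
    by move: s01 s'01; rewrite !in_itv/=; lra.
  have dP c : c \in `]s, s'[ -> is_derive c 1 D (cst 0 c).
    by move=> cst; apply: dD; apply: sub; exact: subset_itv_oo_cc cst.
  have cP : {within `[s, s'], continuous D}.
    apply: continuous_in_subspaceT => c /set_mem /= /sub c01.
    apply: differentiable_continuous; apply/derivable1_diffP.
    by case: (dD c c01).
  have [c _] := MVT ss' dP cP; rewrite mul0r => /eqP.
  by rewrite subr_eq0 => /eqP.
have [lt|lt|->//] := ltgtP t (1 / 2); first exact: key.
by apply/esym; exact: key.
Qed.

End Transport.

Section TransportResult.
Context (R : realType).
Context (f g h : R -> R) (a1 b1 a2 b2 a3 b3 : R).
Hypotheses (df : density f a1 b1) (dg : density g a2 b2) (dh : density h a3 b3).
Hypotheses (ha : a3 <= (a1 + a2) / 2) (hb : (b1 + b2) / 2 <= b3).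
Hypothesis hfg : forall x y, x \in `]a1, b1[ -> y \in `]a2, b2[ ->
  f x * g y <= h ((x + y) / 2) ^+ 2.

(** The Prekopa-Leindler inequality for the parameter 1/2, in the multiplicative form
    that avoids square roots. For the quantile functions [X] and [Y] of [f] and [g],
    the mass of [h] below [(X t + Y t) / 2] grows in [t] at least at the rate given by
    the geometric mean of the two masses. *)
Lemma prekopa_midpoint : mass f a1 b1 * mass g a2 b2 <= mass h a3 b3 ^+ 2.
Proof.
have [X [X01 _ dX _]] := quantile_exists df.
have [Y [Y01 _ dY _]] := quantile_exists dg.
have := transport_ge df dg dh ha hb hfg X01 Y01 dX dY.
have p0 := mass_gt0 df; have q0 := mass_gt0 dg; have r0 := mass_gt0 dh.
rewrite -(@ler_pXn2r _ 2) ?nnegrE ?sqrtr_ge0 ?(ltW r0)//.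
by rewrite sqr_sqrtr// mulr_ge0// ltW.
Qed.

(** The quantile maps differ by a constant [c] and each is onto its interval, so the
    shift by [c] carries one interval to the other. *)
Lemma prekopa_midpoint_eq p : mass f a1 b1 = p -> mass g a2 b2 = p -> mass h a3 b3 = p ->
  exists c, [/\ a1 = a2 + c, b1 = b2 + c & forall x, x \in `]a1, b1[ -> f x = g (x - c)].
Proof.
move=> fp gp hp.
have [X [X01 _ dX Xonto]] := quantile_exists df.
have [Y [Y01 _ dY Yonto]] := quantile_exists dg.
have p0 : 0 < p by rewrite -fp; exact: mass_gt0.
have rk : mass h a3 b3 = Num.sqrt (mass f a1 b1 * mass g a2 b2).
  by rewrite fp gp hp -expr2 sqrtr_sqr gtr0_norm.
have [c cXY] := transport_eq_shift df dg dh ha hb hfg X01 Y01 dX dY rk.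
have fg := transport_eq_derive df dg dh ha hb hfg X01 Y01 dX dY rk.
have [ab1 _ _ _ _] := df; have [ab2 _ _ _ _] := dg.
have in2 x : x \in `]a1, b1[ -> x - c \in `]a2, b2[.
  by move=> /Xonto[t t01 <-]; rewrite cXY// addrK; exact: Y01.
have in1 y : y \in `]a2, b2[ -> y + c \in `]a1, b1[.
  by move=> /Yonto[t t01 <-]; rewrite -cXY//; exact: X01.
have below (u a b : R) : a < u -> a < b -> exists m : R, [/\ m <= u, a < m & m < b].
  move=> au ab; have [ub|bu] := ltP u b.
    by exists ((a + u) / 2); split; lra.
  by exists ((a + b) / 2); split; lra.
have above (u a b : R) : u < b -> a < b -> exists m : R, [/\ u <= m, a < m & m < b].
  move=> ub ab; have [au|ua] := ltP a u.
    by exists ((u + b) / 2); split; lra.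
  by exists ((a + b) / 2); split; lra.
exists c; split.
- apply/eqP; rewrite eq_le !leNgt; apply/andP; split; apply/negP => lt.
    have [m [m1 m2 m3]] := below (a1 - c) a2 b2 ltac:(lra) ab2.
    by have := in1 m; rewrite !in_itv/= m2 m3 => /(_ isT)/andP[? ?]; lra.
  have [m [m1 m2 m3]] := below (a2 + c) a1 b1 ltac:(lra) ab1.
  by have := in2 m; rewrite !in_itv/= m2 m3 => /(_ isT)/andP[? ?]; lra.
- apply/eqP; rewrite eq_le !leNgt; apply/andP; split; apply/negP => lt.
    have [m [m1 m2 m3]] := above (b2 + c) a1 b1 ltac:(lra) ab1.
    by have := in2 m; rewrite !in_itv/= m2 m3 => /(_ isT)/andP[? ?]; lra.
  have [m [m1 m2 m3]] := above (b1 - c) a2 b2 ltac:(lra) ab2.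
  by have := in1 m; rewrite !in_itv/= m2 m3 => /(_ isT)/andP[? ?]; lra.
- move=> x /Xonto[t t01 <-]; have := fg t t01; rewrite {3}cXY// addrK fp gp.
  by move=> /(mulfI (lt0r_neq0 p0)) /invr_inj.
Qed.

End TransportResult.

(** * Lipschitz images *)

Section LipschitzHausdorff.
Local Open Scope ereal_scope.
Context (R : realType).

Lemma hausdorff_lipschitz m n d (phi : 'rV[R]_m -> 'rV[R]_n) (L : R) (A : set 'rV[R]_m) :
  (0 < L)%R -> (forall x y, enorm (phi x - phi y) <= L * enorm (x - y))%R ->
  hausdorff d (phi @` A) <= (L ^+ d)%:E * hausdorff d A.
Proof.
move=> L0 phiL; rewrite /hausdorff muleCA; apply: lee_wpmul2l.
  by rewrite lee_fin invr_ge0 fine_ge0// hausdorff_unnormalized_ge0.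
have Ld0 : (0 < L ^+ d)%R by rewrite exprn_gt0.
apply: ge_ereal_sup => _ [delta delta0 <-].
have dL0 : (0 < delta / L)%R by rewrite divr_gt0.
apply: (@le_trans _ _ ((L ^+ d)%:E * hausdorff_delta d (delta / L)%R A)); last first.
  by apply: lee_wpmul2l; [rewrite lee_fin ltW|exact: hausdorff_delta_le_unnormalized].
rewrite -lee_pdivrMl//; apply: hausdorff_delta_ge => F AF Fd.
rewrite lee_pdivrMl//.
have dimg k : diam (phi @` F k) <= L%:E * diam (F k).
  apply: diam_le => _ _ [x Fx <-] [y Fy <-].
  apply: (@le_trans _ _ (L%:E * (enorm (x - y))%:E)); first by rewrite -EFinM lee_fin.
  by rewrite lee_pmul2l ?lte_fin// enorm_le_diam.
apply: (@le_trans _ _ (\sum_(k <oo) hausdorff_weight d (phi @` F k))).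
  apply: hausdorff_delta_le => [_ [x /AF[k _ Fx] <-]|k].
    by exists k => //; exists x.
  apply: le_trans (dimg k) _; rewrite -lee_pdivlMl// -EFinM.
  by apply: le_trans (Fd k) _; rewrite lee_fin mulrC.
rewrite -nneseriesZl; last by move=> *; exact: hausdorff_weight_ge0.
apply: lee_nneseries => [k _ _|k _]; first exact: hausdorff_weight_ge0.
rewrite /hausdorff_weight; case: eqVneq => [_|/set0P pF0].
  by apply: mule_ge0; [rewrite lee_fin ltW|exact: hausdorff_weight_ge0].
have F0 : F k !=set0 by case: pF0 => _ [x Fx _]; exists x.
case: eqVneq => [E|_]; first by move: F0; rewrite E => -[].
apply: (@le_trans _ _ ((L%:E * diam (F k)) ^+ d)).
  by apply: lee_expe => //; exact: diam_ge0.
have dF0 := diam_ge0 F0; elim: d {Ld0 Fd} => [|d IH].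
  by rewrite !expe0 expr0 mule1.
rewrite !expeS exprS EFinM muleACA lee_pmul//.
  by rewrite mule_ge0// lee_fin ltW.
by rewrite expe_ge0// mule_ge0// lee_fin ltW.
Qed.

Lemma volume_lipschitz n (phi : 'rV[R]_n -> 'rV[R]_n) (L : R) (A : set 'rV[R]_n) :
  (0 < L)%R -> (forall x y, enorm (phi x - phi y) <= L * enorm (x - y))%R ->
  measurable A -> measurable (phi @` A) ->
  volume (phi @` A) <= (L ^+ n)%:E * volume A.
Proof. by move=> L0 phiL mA mpA; rewrite -!hausdorff_volume//; exact: hausdorff_lipschitz. Qed.

End LipschitzHausdorff.

(** * Slices of compact convex sets *)

Section CompactConvex.
Context (R : realType).

Definition compact_convex n (A : set 'rV[R]_n) : Prop :=
  compact A /\ forall x y t, A x -> A y -> 0 <= t <= 1 -> A ((1 - t) *: x + t *: y).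

Lemma convex_setP n (A : set 'rV[R]_n) : convex_set A <->
  forall x y t, A x -> A y -> 0 <= t <= 1 -> A ((1 - t) *: x + t *: y).
Proof.
split=> convA.
  move=> x y t Ax Ay /andP[t0 t1].
  have t0' : 0 <= 1 - t by rewrite subr_ge0.
  have t1' : 1 - t <= 1 by rewrite lerBlDr lerDl.
  have /set_mem H := convA x y (Itv01 t0' t1') (mem_set Ax) (mem_set Ay).
  rewrite -[X in _ + X *: y](subKr 1 t); exact: H.
move=> x y l /set_mem Ax /set_mem Ay; apply/mem_set.
have := convA y x l%:num Ay Ax; rewrite addrC; apply.
by apply/andP; split.
Qed.

(** A real number, because the bodies measured with it are compact. *)
Definition vol n (A : set 'rV[R]_n) : R := fine (volume A).

Lemma compact_sub_box n (A : set 'rV[R]_n) : compact A ->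
  exists2 M : R, 0 < M & forall x, A x -> forall i, `|x ord0 i| <= M.
Proof.
move=> /compact_bounded[M [_ AM]]; exists (Num.max M 0 + 1).
  by rewrite ltr_wpDl// le_max lexx orbT.
move=> x Ax i; apply: le_trans (coord_le_mx_norm x i) _.
by apply: AM Ax; rewrite (@le_lt_trans _ _ (Num.max M 0)) ?le_max ?lexx// ltrDl.
Qed.

Lemma volume_bounded n (A : set 'rV[R]_n) (M : R) : 0 < M -> measurable A ->
  (forall x, A x -> forall i, `|x ord0 i| <= M) ->
  (volume A <= ((M *+ 2) ^+ n)%:E)%E.
Proof.
move=> M0 mA AM; rewrite -(volume_box (const_mx (- M))) ?mulrn_wge0 ?(ltW M0)//.
apply: le_measure; rewrite ?inE//; first exact: measurable_box.
by move=> x Ax i; rewrite mxE in_itv/= mulr2n addKr -ler_norml; exact: AM.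
Qed.

Lemma volume_compact_fin n (A : set 'rV[R]_n) : compact A -> volume A \is a fin_num.
Proof.
move=> cA; have [M M0 AM] := compact_sub_box cA.
rewrite ge0_fin_numE//; apply: le_lt_trans (ltry _).
by apply: volume_bounded AM => //; exact: compact_row_measurable.
Qed.

Lemma volE n (A : set 'rV[R]_n) : compact A -> volume A = (vol A)%:E.
Proof. by move=> cA; rewrite /vol fineK// volume_compact_fin. Qed.

Lemma vol_ge0 n (A : set 'rV[R]_n) : 0 <= vol A.
Proof. by rewrite /vol fine_ge0. Qed.

Lemma vol_le n (A B : set 'rV[R]_n) : compact A -> compact B -> A `<=` B -> vol A <= vol B.
Proof.
move=> cA cB AB; rewrite -lee_fin -!volE//.
by apply: le_measure; rewrite ?inE//; exact: compact_row_measurable.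
Qed.

Lemma row_cons_continuous n (s : R) : continuous (@row_cons R n s).
Proof. exact/isometry_continuous/row_cons_isometry. Qed.

Lemma row_tail_continuous n : continuous (@row_tail R n).
Proof.
apply: (@lipschitz_continuous _ 'rV[R]_n.+1 'rV[R]_n _ 1) => // x y.
rewrite mul1r [leLHS]/Num.norm /= mx_normrE; apply/bigmax_leP; split=> //.
move=> [i j] _ /=; rewrite (ord1 i) !mxE.
by apply: le_trans (coord_le_mx_norm _ (lift ord0 j)); rewrite !mxE.
Qed.

Lemma compact_slice n (A : set 'rV[R]_n.+1) s : compact A -> compact (slice A s).
Proof.
move=> cA; apply: (@subclosed_compact _ _ (@row_tail R n @` A)).
- apply: closed_comp (compact_closed (@norm_hausdorff _ _) cA) => y _.
  exact: row_cons_continuous.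
- by apply: continuous_compact cA; apply: continuous_subspaceT; exact: row_tail_continuous.
- by move=> y Ay; exists (row_cons s y) => //; exact: row_tailK.
Qed.

Lemma compact_convex_slice n (A : set 'rV[R]_n.+1) s :
  compact_convex A -> compact_convex (slice A s).
Proof.
move=> [cA convA]; split; first exact: compact_slice.
move=> x y t Ax Ay t01; rewrite /slice/=.
have -> : row_cons s ((1 - t) *: x + t *: y) =
    (1 - t) *: row_cons s x + t *: row_cons s y.
  by rewrite -!row_consZ -row_consD; congr row_cons; ring.
exact: convA.
Qed.

Lemma slice_conv n (A : set 'rV[R]_n.+1) s0 s1 t x y : compact_convex A -> 0 <= t <= 1 ->
  slice A s0 x -> slice A s1 y -> slice A ((1 - t) * s0 + t * s1) ((1 - t) *: x + t *: y).
Proof.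
move=> [_ convA] t01 Ax Ay; rewrite /slice/= row_consD !row_consZ.
exact: convA.
Qed.

(** The inverse of the homothety is Lipschitz with constant [(1 - t)^-1]. *)
Lemma vol_homothety n (A : set 'rV[R]_n) y t (phi := fun x => (1 - t) *: x + t *: y) :
  compact A -> 0 <= t < 1 ->
  compact (phi @` A) /\ (1 - t) ^+ n * vol A <= vol (phi @` A).
Proof.
move=> cA /andP[t0 t1].
pose psi (x : 'rV[R]_n) := (1 - t)^-1 *: (x - t *: y).
have r0 : 0 < 1 - t by lra.
have cphi : continuous phi.
  apply: (@lipschitz_continuous _ _ _ _ (1 - t)) => [|x x']; first exact: ltW.
  by rewrite /phi opprD addrACA subrr addr0 -scalerBr normrZ ger0_norm// ltW.
have phiK : cancel phi psi.
  by move=> x; rewrite /psi /phi addrK scalerA mulVf ?scale1r// gt_eqF.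
have cimg : compact (phi @` A).
  by apply: continuous_compact cA; exact: continuous_subspaceT.
split=> //.
have E : A = psi @` (phi @` A).
  apply/seteqP; split=> [x Ax|_ [_ [x Ax <-] <-]]; last by rewrite phiK.
  by exists (phi x); [exists x|exact: phiK].
have : (volume A <= ((1 - t)^-1 ^+ n)%:E * volume (phi @` A))%E.
  rewrite {1}E; apply: volume_lipschitz.
  - by rewrite invr_gt0.
  - move=> x x'; rewrite /psi -scalerBr opprB addrA subrK /enorm dotZl dotZr mulrA.
    by rewrite sqrtrM ?mulr_ge0 ?invr_ge0 ?(ltW r0)// -expr2 sqrtr_sqr ger0_norm// invr_ge0 ltW.
  - exact: compact_row_measurable.
  - by rewrite -E; exact: compact_row_measurable.
by rewrite !volE// -EFinM lee_fin exprVn mulrC ler_pdivlMr ?exprn_gt0// mulrC.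
Qed.

(** The slice at the intermediate abscissa contains the image of the slice at [s0]
    under the homothety of ratio [1 - t] centred at a point of the slice at [s1]. *)
Lemma slice_homothety n (A : set 'rV[R]_n.+1) s0 s1 t : compact_convex A -> 0 <= t < 1 ->
  slice A s1 !=set0 ->
  (1 - t) ^+ n * vol (slice A s0) <= vol (slice A ((1 - t) * s0 + t * s1)).
Proof.
move=> cA t01 [y Ay].
have [cimg le_img] := vol_homothety y (compact_slice (s := s0) cA.1) t01.
apply: le_trans le_img _; apply: vol_le => //; first exact: compact_slice cA.1.
case/andP: t01 => t0 t1 _ [x Ax <-].
by apply: slice_conv => //; rewrite t0 ltW.
Qed.

Lemma bernoulli (t : R) m : 0 <= t <= 1 -> 1 - m%:R * t <= (1 - t) ^+ m.
Proof.
move=> /andP[t0 t1]; elim: m => [|m IH]; first by rewrite mul0r subr0 expr0.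
have le1 : (1 - t) ^+ m <= 1 by rewrite exprn_ile1// ?subr_ge0// lerBlDr lerDl.
rewrite exprS mulrBl mul1r -natr1 mulrDl mul1r.
have : t * (1 - t) ^+ m <= t by rewrite ler_piMr.
lra.
Qed.

Section SliceDensity.
Context (n : nat) (A : set 'rV[R]_n.+1) (cA : compact_convex A).

Definition slice_vol (s : R) : R := vol (slice A s).

Lemma slice_vol_measurable : measurable_fun setT slice_vol.
Proof.
apply: measurableT_comp (measurable_volume_slice _) => //.
exact: compact_row_measurable cA.1.
Qed.

Lemma slice_vol_bounded : exists2 M, 0 < M & forall s, slice_vol s <= M.
Proof.
have [M M0 AM] := compact_sub_box cA.1.
exists ((M *+ 2) ^+ n); first by rewrite exprn_gt0// mulrn_wgt0.
move=> s; rewrite -lee_fin -volE; last exact: compact_slice cA.1.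
apply: volume_bounded => //.
  exact: measurable_slice (compact_row_measurable cA.1).
by move=> y Ay i; have := AM _ Ay (lift ord0 i); rewrite row_consS.
Qed.

Context (a b : R) (sa : slice A a !=set0) (sb : slice A b !=set0).
Hypothesis Aab : forall x, A x -> a <= x ord0 ord0 <= b.

Lemma slice_vol_out s : ~ (a <= s <= b) -> slice_vol s = 0.
Proof.
move=> sab; rewrite /slice_vol (_ : slice A s = set0) ?/vol ?volume_set0//.
by apply/seteqP; split=> // y Ay; apply: sab; have := Aab Ay; rewrite row_cons0.
Qed.

(** Moving from a slice towards a nonempty one costs at most the factor [(1 - t) ^+ n]
    in volume, by [slice_homothety]. Moving from a slice of positive volume towards
    either end shows positivity; comparing two interior slices in both directions
    gives a Lipschitz bound near each interior abscissa. *)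
Lemma slice_vol_density s0 : 0 < slice_vol s0 -> a < b -> density slice_vol a b.
Proof.
move=> f0 ab.
have s0ab : a <= s0 <= b.
  by apply: contrapT => /slice_vol_out E; move: f0; rewrite E ltxx.
have [M M0 fM] := slice_vol_bounded.
(* moving from x towards the abscissa e of a nonempty slice, up to y *)
have toward x y e : slice A e !=set0 -> 0 <= (y - x) / (e - x) < 1 -> e != x ->
    (1 - (y - x) / (e - x)) ^+ n * slice_vol x <= slice_vol y.
  move=> se t01 ex; have := slice_homothety x cA t01 se.
  rewrite -/(slice_vol x) (_ : _ * x + _ = y)//.
  by field; rewrite subr_eq0.
have pos x : x \in `]a, b[ -> 0 < slice_vol x.
  rewrite in_itv/= => /andP[ax xb].
  have [xs|sx] := ltP x s0.
    have sa0 : a - s0 < 0 by lra.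
    apply: lt_le_trans (toward s0 x a sa _ _); last by rewrite lt_eqF//; lra.
      rewrite mulr_gt0// exprn_gt0// subr_gt0 ltr_ndivrMr//; lra.
    by rewrite -mulrNN -invrN divr_ge0 ?ltr_pdivrMr/=; lra.
  have [->//|xs0] := eqVneq x s0.
  have sx' : s0 < x by rewrite lt_neqAle eq_sym xs0.
  have sb0 : 0 < b - s0 by lra.
  apply: lt_le_trans (toward s0 x b sb _ _); last by rewrite gt_eqF//; lra.
    rewrite mulr_gt0// exprn_gt0// subr_gt0 ltr_pdivrMr//; lra.
  by rewrite divr_ge0 ?ltr_pdivrMr/=; lra.
have drop x y e : slice A e !=set0 -> 0 <= (y - x) / (e - x) < 1 -> e != x ->
    slice_vol x - n%:R * M * ((y - x) / (e - x)) <= slice_vol y.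
  move=> se t01 ex; apply: le_trans (toward x y e se t01 ex).
  set t := (y - x) / (e - x) in t01 *.
  have tt : 0 <= t <= 1 by case/andP: t01 => -> /ltW.
  apply: le_trans (ler_wpM2r (vol_ge0 _) (bernoulli n tt)).
  have : n%:R * t * slice_vol x <= n%:R * t * M.
    by apply: ler_wpM2l => //; rewrite mulr_ge0//; case/andP: tt.
  rewrite -/(slice_vol x); lra.
split=> //.
- exact: slice_vol_measurable.
- by move=> x; exact: vol_ge0.
- move=> x xab; split; first exact: pos.
  pose eta := Num.min (x - a) (b - x).
  have eta0 : 0 < eta by move: xab; rewrite in_itv/= lt_min => /andP[? ?]; apply/andP; split; lra.
  have [ea eb] : eta <= x - a /\ eta <= b - x by rewrite !ge_min !lexx orbT.
  have lip y : y \in `]a, b[ -> `|slice_vol x - slice_vol y| <= n%:R * M / eta * `|x - y|.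
    move: xab; rewrite !in_itv/= => /andP[ax xb] /andP[ay yb].
    have tau (u v : R) : 0 <= u -> eta <= v -> n%:R * M * (u / v) <= n%:R * M / eta * u.
      move=> u0 ev; rewrite -!mulrA; apply: ler_wpM2l => //; apply: ler_wpM2l; first exact: ltW.
      by rewrite mulrC ler_wpM2r// lef_pV2 ?posrE//; lra.
    have frac (u v : R) : 0 <= u -> u < v -> 0 <= u / v < 1.
      by move=> u0 uv; rewrite divr_ge0 ?ltr_pdivrMr ?mul1r//=; lra.
    have flip (u v w : R) : (u - v) / (w - v) = (v - u) / (v - w).
      by rewrite -mulrNN -invrN !opprB.
    have [yx|xy|<-] := ltgtP y x; last by rewrite !subrr normr0 mulr0.
    - rewrite [X in _ * X]gtr0_norm ?subr_gt0// ler_norml.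
      have H1 := drop x y a sa; rewrite flip in H1.
      have {}H1 := H1 (frac (x - y) (x - a) ltac:(lra) ltac:(lra)) ltac:(by rewrite lt_eqF).
      have H2 := drop y x b sb (frac (x - y) (b - y) ltac:(lra) ltac:(lra)) ltac:(by rewrite gt_eqF).
      have t1 := tau (x - y) (x - a) ltac:(lra) ea.
      have t2 := tau (x - y) (b - y) ltac:(lra) ltac:(lra).
      by apply/andP; split; lra.
    - rewrite [X in _ * X]ltr0_norm ?subr_lt0// opprB ler_norml.
      have H1 := drop x y b sb (frac (y - x) (b - x) ltac:(lra) ltac:(lra)) ltac:(by rewrite gt_eqF).
      have H2 := drop y x a sa; rewrite flip in H2.
      have {}H2 := H2 (frac (y - x) (y - a) ltac:(lra) ltac:(lra)) ltac:(by rewrite lt_eqF).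
      have t1 := tau (y - x) (b - x) ltac:(lra) eb.
      have t2 := tau (y - x) (y - a) ltac:(lra) ltac:(lra).
      by apply/andP; split; lra.
  apply/(@cvgrPdist_le _ _ _ (nbhs x)) => e e0.
  have k0 : 0 <= n%:R * M / eta by rewrite divr_ge0 ?(ltW eta0)// mulr_ge0// ltW.
  near=> y; apply: le_trans (lip y _) _.
    by near: y; exact: near_in_itvoo.
  apply: (@le_trans _ _ ((n%:R * M / eta + 1) * `|x - y|)); first by rewrite ler_wpM2r// lerDl.
  rewrite mulrC -ler_pdivlMr ?ltr_wpDl//; near: y.
  by apply: cvgr_dist_le => //; rewrite divr_gt0// ltr_wpDl.
- by exists M.
Unshelve. all: by end_near. Qed.

End SliceDensity.

End CompactConvex.

(** * The Brunn-Minkowski inequality *)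

Section BrunnMinkowski.
Context (R : realType).

Lemma slice_extent n (A : set 'rV[R]_n.+1) : compact A -> A !=set0 ->
  exists a b, [/\ slice A a !=set0, slice A b !=set0 &
    forall x, A x -> a <= x ord0 ord0 <= b].
Proof.
move=> cA A0.
have cc : {within A, continuous (fun x : 'rV[R]_n.+1 => x ord0 ord0)}.
  by apply: continuous_subspaceT => x; exact: coord_continuous.
have [x /set_mem Ax xmin] := compact_EVT_min A0 cA cc.
have [y /set_mem Ay ymax] := compact_EVT_max A0 cA cc.
exists (x ord0 ord0), (y ord0 ord0); split.
- by exists (row_tail x); rewrite /slice/= row_consK.
- by exists (row_tail y); rewrite /slice/= row_consK.
- by move=> z Az; rewrite xmin ?inE// ymax ?inE.
Qed.

Lemma volume_slice_vol n (A : set 'rV[R]_n.+1) : compact A ->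
  volume A = (\int[@lebesgue_measure R]_s (slice_vol A s)%:E)%E.
Proof.
move=> cA; rewrite volume_slices; apply: eq_integral => s _.
by rewrite volE//; exact: compact_slice.
Qed.

Lemma integral_slice_vol n (A : set 'rV[R]_n.+1) a b : compact_convex A ->
  (forall x, A x -> a <= x ord0 ord0 <= b) ->
  volume A = (\int[@lebesgue_measure R]_(s in `[a, b]) (slice_vol A s)%:E)%E.
Proof.
move=> cA Aab; rewrite volume_slice_vol ?cA.1//; last exact: cA.1.
rewrite [RHS]integral_mkcond; apply: eq_integral => s _; rewrite patchE.
case: ifPn => //; rewrite notin_setE/= in_itv/= => sab.
by rewrite (slice_vol_out Aab).
Qed.

Lemma mass_slice_vol n (A : set 'rV[R]_n.+1) a b : compact_convex A ->
  (forall x, A x -> a <= x ord0 ord0 <= b) ->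
  mass (slice_vol A) a b = vol A.
Proof. by move=> cA Aab; rewrite /vol (integral_slice_vol cA Aab). Qed.

Lemma vol_gt0_slice n (A : set 'rV[R]_n.+1) a b : compact_convex A ->
  (forall x, A x -> a <= x ord0 ord0 <= b) -> 0 < vol A ->
  a < b /\ exists s, 0 < slice_vol A s.
Proof.
move=> cA Aab V0; have I := integral_slice_vol cA Aab.
split.
  rewrite ltNge; apply/negP => ba; move: V0; rewrite /vol I.
  rewrite null_set_integral ?ltxx//.
  - apply: measurableT_comp => //; apply: measurable_funTS; exact: slice_vol_measurable.
  - have := @lebesgue_measure_itv R `[a, b]; rewrite /= => ->.
    by rewrite lte_fin ltNge ba.
apply: contrapT => no; move: V0; rewrite /vol I integral0_eq ?ltxx// => s _.
congr EFin; apply/eqP; rewrite eq_le vol_ge0 andbT leNgt; apply/negP => s0.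
by apply: no; exists s.
Qed.

(** An inclusion rather than the Minkowski mean itself: slices of the mean need not be
    means of slices, but they do contain them. *)
Definition midpoint_in n (F G M : set 'rV[R]_n) : Prop :=
  forall x y, F x -> G y -> M (2^-1 *: (x + y)).

Lemma slice_midpoint n (F G M : set 'rV[R]_n.+1) s t : midpoint_in F G M ->
  midpoint_in (slice F s) (slice G t) (slice M ((s + t) / 2)).
Proof.
move=> FGM x y Fx Gy; have := FGM _ _ Fx Gy.
by rewrite /slice/= -row_consD -row_consZ mulrC.
Qed.

Lemma vol0 n : vol (set0 : set 'rV[R]_n) = 0.
Proof. by rewrite /vol volume_set0. Qed.

Lemma vol_gt0_nonempty n (A : set 'rV[R]_n) : 0 < vol A -> A !=set0.
Proof.
move=> V0; apply: contrapT => no; move: V0.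
rewrite (_ : A = set0) ?vol0 ?ltxx//.
by apply/seteqP; split=> // x Ax; apply: no; exists x.
Qed.

(** This prepares the one-dimensional inequality for the slice volumes of three
    bodies; its premise on slices is the Brunn-Minkowski inequality one dimension
    lower. *)
Lemma slice_densities n (F G M : set 'rV[R]_n.+1) :
  (forall F G M : set 'rV[R]_n, compact_convex F -> compact_convex G -> compact_convex M ->
     midpoint_in F G M -> vol F * vol G <= vol M ^+ 2) ->
  compact_convex F -> compact_convex G -> compact_convex M -> midpoint_in F G M ->
  0 < vol F -> 0 < vol G ->
  exists a1 b1 a2 b2 a3 b3,
   [/\ density (slice_vol F) a1 b1 /\ (forall x, F x -> a1 <= x ord0 ord0 <= b1),
       density (slice_vol G) a2 b2 /\ (forall x, G x -> a2 <= x ord0 ord0 <= b2),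
       density (slice_vol M) a3 b3 /\ (forall x, M x -> a3 <= x ord0 ord0 <= b3),
       a3 <= (a1 + a2) / 2 /\ (b1 + b2) / 2 <= b3 &
       [/\ slice F b1 !=set0, slice G b2 !=set0 &
        forall x y, x \in `]a1, b1[ -> y \in `]a2, b2[ ->
        slice_vol F x * slice_vol G y <= slice_vol M ((x + y) / 2) ^+ 2]].
Proof.
move=> IH cF cG cM FGM F0 G0.
have [a1 [b1 [Fa Fb Fab]]] := slice_extent cF.1 (vol_gt0_nonempty F0).
have [a2 [b2 [Ga Gb Gab]]] := slice_extent cG.1 (vol_gt0_nonempty G0).
have [ab1 [s1 s10]] := vol_gt0_slice cF Fab F0.
have [ab2 [s2 s20]] := vol_gt0_slice cG Gab G0.
have FGMs x y : slice_vol F x * slice_vol G y <= slice_vol M ((x + y) / 2) ^+ 2.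
  by apply: IH; [exact: compact_convex_slice..|exact: slice_midpoint].
have Ma : slice M ((a1 + a2) / 2) !=set0.
  by have [x Fx] := Fa; have [y Gy] := Ga; exists (2^-1 *: (x + y)); exact: slice_midpoint FGM _ _ Fx Gy.
have Mb : slice M ((b1 + b2) / 2) !=set0.
  by have [x Fx] := Fb; have [y Gy] := Gb; exists (2^-1 *: (x + y)); exact: slice_midpoint FGM _ _ Fx Gy.
have M0 : M !=set0 by have [x Mx] := Ma; exists (row_cons ((a1 + a2) / 2) x).
have [a3 [b3 [Ma3 Mb3 Mab]]] := slice_extent cM.1 M0.
have ha : a3 <= (a1 + a2) / 2.
  by have [x /Mab] := Ma; rewrite row_cons0 => /andP[].
have hb : (b1 + b2) / 2 <= b3.
  by have [x /Mab] := Mb; rewrite row_cons0 => /andP[].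
have s30 : 0 < slice_vol M ((s1 + s2) / 2).
  rewrite lt0r vol_ge0 andbT; apply/eqP => E; have := FGMs s1 s2.
  by rewrite E expr0n/= leNgt mulr_gt0.
exists a1, b1, a2, b2, a3, b3; split=> //; split=> //.
- exact: slice_vol_density s10 _.
- exact: slice_vol_density s20 _.
- by apply: slice_vol_density s30 _ => //; lra.
Qed.

Lemma vol_rV0 (A : set 'rV[R]_0) : A !=set0 -> vol A = 1.
Proof.
move=> [x Ax]; rewrite /vol /volume /= /dirac indicE mem_set//=.
by rewrite (_ : \row_i _ = x)//; apply/rowP => -[].
Qed.

(** By induction on the dimension: the slice volumes satisfy the midpoint inequality
    by the case of lower dimension, and [prekopa_midpoint] integrates it. *)
Theorem brunn_minkowski n (F G M : set 'rV[R]_n) :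
  compact_convex F -> compact_convex G -> compact_convex M ->
  midpoint_in F G M -> vol F * vol G <= vol M ^+ 2.
Proof.
elim: n F G M => [|n IH] F G M cF cG cM FGM.
  have [[x Fx]|F0] := pselect (F !=set0); last first.
    rewrite (_ : F = set0) ?vol0 ?mul0r ?sqr_ge0//.
    by apply/seteqP; split=> // x Fx; apply: F0; exists x.
  have [[y Gy]|G0] := pselect (G !=set0); last first.
    rewrite (_ : G = set0) ?vol0 ?mulr0 ?sqr_ge0//.
    by apply/seteqP; split=> // y Gy; apply: G0; exists y.
  have Mxy := FGM x y Fx Gy.
  rewrite (vol_rV0 (ex_intro _ _ Fx)) (vol_rV0 (ex_intro _ _ Gy)).
  by rewrite (vol_rV0 (ex_intro _ _ Mxy)) mulr1 expr1n.
have [F0|F0] := ltP 0 (vol F); last first.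
  by rewrite (le_trans (mulr_le0_ge0 F0 (vol_ge0 _))) ?sqr_ge0.
have [G0|G0] := ltP 0 (vol G); last first.
  by rewrite (le_trans (mulr_ge0_le0 (vol_ge0 _) G0)) ?sqr_ge0.
have [a1 [b1 [a2 [b2 [a3 [b3 [[dF Fab] [dG Gab] [dM Mab] [ha hb] [_ _ FGMs]]]]]]]] :=
  slice_densities IH cF cG cM FGM F0 G0.
have := prekopa_midpoint dF dG dM ha hb FGMs.
by rewrite !mass_slice_vol.
Qed.

(** The volumes of the slices orthogonal to one direction are governed by the equality
    case on the line. *)
Lemma brunn_minkowski_eq_slices n (F G M : set 'rV[R]_n.+1) p :
  compact_convex F -> compact_convex G -> compact_convex M ->
  midpoint_in F G M -> 0 < p -> vol F = p -> vol G = p -> vol M = p ->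
  exists a1 b1 a2 b2 c,
   [/\ (forall x, F x -> a1 <= x ord0 ord0 <= b1) /\ slice F b1 !=set0,
       (forall x, G x -> a2 <= x ord0 ord0 <= b2) /\ slice G b2 !=set0,
       a1 = a2 + c, b1 = b2 + c &
       forall x, x \in `]a1, b1[ -> slice_vol F x = slice_vol G (x - c)].
Proof.
move=> cF cG cM FGM p0 Fp Gp Mp.
have F0 : 0 < vol F by rewrite Fp.
have G0 : 0 < vol G by rewrite Gp.
have [a1 [b1 [a2 [b2 [a3 [b3 [[dF Fab] [dG Gab] [dM Mab] [ha hb] [Fb Gb FGMs]]]]]]]] :=
  slice_densities (@brunn_minkowski n) cF cG cM FGM F0 G0.
have mF : mass (slice_vol F) a1 b1 = p by rewrite mass_slice_vol.
have mG : mass (slice_vol G) a2 b2 = p by rewrite mass_slice_vol.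
have mM : mass (slice_vol M) a3 b3 = p by rewrite mass_slice_vol.
have [c [ac bc fg]] := prekopa_midpoint_eq dF dG dM ha hb FGMs mF mG mM.
by exists a1, b1, a2, b2, c.
Qed.

End BrunnMinkowski.

(** * Barycentres *)

Section Moments.
Context (R : realType).

Lemma integral_shiftT (c : R) (f : R -> \bar R) : measurable_fun setT f ->
  (\int[@lebesgue_measure R]_x f (x + c)%R = \int[lebesgue_measure]_x f x)%E.
Proof.
move=> mf; rewrite integralE [RHS]integralE; congr (_ - _)%E.
  have mp := measurable_funepos mf.
  have p0 x : (0 <= f^\+ x)%E by [].
  rewrite -(integral_shift c mp p0); apply: eq_integral => x _.
  by rewrite !(funeposE,funenegE).
have mp := measurable_funeneg mf.
  have p0 x : (0 <= f^\- x)%E by [].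
  rewrite -(integral_shift c mp p0); apply: eq_integral => x _.
  by rewrite !(funeposE,funenegE).
Qed.

Lemma integral_reflectT n (w : 'rV[R]_n) (f : 'rV[R]_n -> \bar R) :
  measurable_fun setT f ->
  (\int[@volume R n]_x f (reflect w x) = \int[@volume R n]_x f x)%E.
Proof.
move=> mf; rewrite integralE [RHS]integralE; congr (_ - _)%E.
  have mp := measurable_funepos mf.
  have p0 x : (0 <= f^\+ x)%E by [].
  rewrite -(integral_reflect w mp p0); apply: eq_integral => x _.
  by rewrite !(funeposE,funenegE).
have mp := measurable_funeneg mf.
  have p0 x : (0 <= f^\- x)%E by [].
  rewrite -(integral_reflect w mp p0); apply: eq_integral => x _.
  by rewrite !(funeposE,funenegE).
Qed.

Lemma dot_bounded n (F : set 'rV[R]_n) (v : 'rV[R]_n) : compact F ->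
  exists M, forall x, F x -> `|dot x v| <= M.
Proof.
move=> cF; have [M M0 FM] := compact_sub_box cF.
exists (\sum_i M * `|v ord0 i|) => x Fx.
apply: le_trans (ler_norm_sum _ _ _) _; apply: ler_sum => i _.
by rewrite normrM ler_wpM2r// FM.
Qed.

Lemma dot_integrable n (F : set 'rV[R]_n) (v : 'rV[R]_n) : compact F ->
  (@volume R n).-integrable F (EFin \o (fun x => dot x v)).
Proof.
move=> cF; have [M FM] := dot_bounded v cF.
apply: measurable_bounded_integrable.
- exact: compact_row_measurable.
- have := volume_compact_fin cF; rewrite ge0_fin_numE//; exact.
- exact: measurable_funTS (measurable_dot v).
- exists M; split; first exact: num_real.
  by move=> t Mt x Fx; rewrite /= (le_trans (FM x Fx))// ltW.
Qed.

Definition moment n (F : set 'rV[R]_n) (v : 'rV[R]_n) : R :=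
  \int[@volume R n]_(x in F) dot x v.

(** Without division by the volume, since the bodies to be compared have equal
    volumes. *)
Definition barycentre n (F : set 'rV[R]_n) : 'rV[R]_n :=
  \row_i moment F (delta_mx ord0 i).

Lemma dot_delta n (x : 'rV[R]_n) i : dot x (delta_mx ord0 i) = x ord0 i.
Proof.
rewrite /dot (bigD1 i)//= mxE !eqxx mulr1 big1 ?addr0// => j ji.
by rewrite mxE (negbTE ji) andbF mulr0.
Qed.

Lemma momentE n (F : set 'rV[R]_n) (v : 'rV[R]_n) : compact F ->
  moment F v = dot (barycentre F) v.
Proof.
move=> cF; have mF := compact_row_measurable cF.
have int i := dot_integrable (delta_mx ord0 i) cF.
rewrite /moment /Rintegral.
under eq_integral => x _.
  rewrite /dot -sumEFin; under eq_bigr do rewrite EFinM -dot_delta muleC.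
  over.
rewrite integral_sum//=; last by move=> i; apply: integrableZl => //; exact: int.
rewrite /dot.
have E i : (\int[@volume R n]_(x in F) ((v ord0 i)%:E * (dot x (delta_mx ord0 i))%:E))%E =
    (barycentre F ord0 i * v ord0 i)%:E.
  rewrite (integralZl mF (int i)) mulrC EFinM; congr (_ * _)%E; rewrite mxE.
  by rewrite /moment /Rintegral fineK//; apply: integrable_fin_num => //; exact: int.
by under eq_bigr do rewrite E; rewrite sumEFin.
Qed.

Lemma moment_reflect n (w v : 'rV[R]_n) (F : set 'rV[R]_n) : compact F ->
  moment (reflect w @^-1` F) (reflect w v) = moment F v.
Proof.
move=> cF; rewrite /moment /Rintegral; congr fine.
have mF := compact_row_measurable cF.
rewrite integral_mkcond [RHS]integral_mkcond.
rewrite -(integral_reflectT w); last first.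
  apply/(measurable_restrictT _ _).1.
    rewrite -[X in measurable X]setTI.
    exact: (measurable_isometry (reflect_isometry w)).
  by apply: measurable_funTS; apply/measurable_EFinP; exact: measurable_dot.
apply: eq_integral => x _; rewrite /= !patchE.
rewrite (_ : (reflect w x \in reflect w @^-1` F) = (reflect w (reflect w x) \in F)); last first.
  by apply/idP/idP => /set_mem ?; apply/mem_set.
by rewrite reflectK reflect_dot.
Qed.

Lemma moment_slices n (F : set 'rV[R]_n.+1) : compact F ->
  moment F (e0 R n) = fine (\int[@lebesgue_measure R]_s (s * slice_vol F s)%:E)%E.
Proof.
move=> cF; rewrite /moment /Rintegral; congr fine.
have mF := compact_row_measurable cF.
pose cons (p : measurableTypeR R * 'rV[R]_n) := row_cons p.1 p.2.
have mcons : measurable_fun setT cons by exact: measurable_row_cons.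
have mD : measurable (cons @^-1` F) by rewrite -[X in measurable X]setTI; exact: mcons.
pose f (x : 'rV[R]_n.+1) : \bar R := (dot x (e0 R n))%:E.
have mf : measurable_fun setT f by apply/measurable_EFinP; exact: measurable_dot.
have [M FM] := dot_bounded (e0 R n) cF.
have intD : (@lebesgue_measure R \x @volume R n)%E.-integrable (cons @^-1` F) (f \o cons).
  apply: (@measurable_bounded_integrable _ _ _ _ (fun p => dot (cons p) (e0 R n))) => //.
  - have := volume_compact_fin cF; rewrite ge0_fin_numE// volume_pushforward; exact.
  - apply: measurable_funTS; apply: (measurableT_comp (measurable_dot _) mcons).
  - exists M; split; first exact: num_real.
    by move=> t Mt p Fp; rewrite /= (le_trans (FM _ Fp))// ltW.
transitivity (\int[pushforward (@lebesgue_measure R \x @volume R n) cons]_(x in F) f x)%E.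
  by apply: eq_measure_integral => A mA _; exact: volume_pushforward.
rewrite integral_pushforward// integral_mkcond.
rewrite -integral12_prod_meas1; last first.
  by apply/integrable_restrict => //=; rewrite setTI.
apply: eq_integral => s _; rewrite /fubini_F.
transitivity (\int[@volume R n]_(y in slice F s) s%:E)%E.
  rewrite [RHS]integral_mkcond; apply: eq_integral => y _; rewrite !patchE.
  rewrite (_ : ((s, y) \in cons @^-1` F) = (y \in slice F s)); last first.
    by apply/idP/idP => /set_mem ?; apply/mem_set.
  by case: ifP => // _; rewrite /f /cons /= dot_e0 row_cons0.
rewrite integral_cst; last exact: measurable_slice.
by rewrite EFinM; congr (_ * _)%E; apply: volE; exact: compact_slice.
Qed.

End Moments.

(** * Equality in the Brunn-Minkowski inequality *)

Section EqualityCase.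
Context (R : realType).

Lemma dot_self_continuous n : continuous (fun y : 'rV[R]_n => dot y y).
Proof.
rewrite /dot; elim: (index_enum _) => [|i s IH].
  rewrite (_ : (fun y => _) = cst 0); first exact: cst_continuous.
  by apply/funext => y; rewrite big_nil.
rewrite (_ : (fun y => _) = (fun y : 'rV[R]_n => y ord0 i * y ord0 i) \+
    (fun y => \sum_(j <- s) y ord0 j * y ord0 j)).
  have ci := @coord_continuous R 1 n ord0 i.
  by move=> x; exact: (cvgD (cvgM (ci x) (ci x)) (IH x)).
by apply/funext => y; rewrite big_cons.
Qed.

(** The separating hyperplane is orthogonal to the segment that joins the point to the
    nearest point of the set. *)
Lemma separation n (G : set 'rV[R]_n) (x : 'rV[R]_n) : compact_convex G -> G !=set0 ->
  ~ G x -> exists2 u, dot u u = 1 & exists r, r < dot x u /\ forall y, G y -> dot y u <= r.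
Proof.
move=> [cG convG] G0 nGx.
have cd : {within G, continuous (fun y => dot (y - x) (y - x))}.
  apply: continuous_subspaceT => y.
  apply: (continuous_comp (f := fun y : 'rV[R]_n => y - x) (g := fun z => dot z z)); last exact: dot_self_continuous.
  apply: (@lipschitz_continuous _ 'rV[R]_n 'rV[R]_n _ 1) => // z z'.
  by rewrite mul1r opprB addrA subrK.
have [q /set_mem Gq qmin] := compact_EVT_min G0 cG cd.
pose w := x - q.
have w0 : 0 < dot w w.
  rewrite lt0r dot_ge0 andbT; apply/eqP => /dot_eq0 /eqP.
  by rewrite subr_eq0 => /eqP xq; apply: nGx; rewrite xq.
have obtuse y : G y -> dot (y - q) w <= 0.
  move=> Gy; rewrite leNgt; apply/negP => a0.
  pose a := dot (y - q) w; pose b := dot (y - q) (y - q).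
  have b0 : 0 <= b by exact: dot_ge0.
  (* small enough for t * b < 2 * a, so that moving from q towards y comes closer to x *)
  pose t := a / (a + b + 1).
  have d0 : 0 < a + b + 1 by rewrite -/a in a0; lra.
  have td : t * (a + b + 1) = a by rewrite /t divfK// gt_eqF.
  have t0 : 0 < t by rewrite divr_gt0.
  have t1 : t <= 1 by rewrite ler_pdivrMr// mul1r; lra.
  have := qmin _ (mem_set (convG q y t Gq Gy _)); rewrite (ltW t0) t1 => /(_ isT).
  have -> : (1 - t) *: q + t *: y - x = t *: (y - q) - w.
    by apply/rowP => i; rewrite /w !mxE; ring.
  have -> : q - x = - w by rewrite opprB.
  have sq (z v : 'rV[R]_n) :
      dot (t *: z - v) (t *: z - v) = t * t * dot z z - 2 * t * dot z v + dot v v.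
    by rewrite dotBl !dotBr !dotZl !dotZr (dotC v z); ring.
  rewrite sq dotNl dotNr opprK -/a -/b.
  have : 0 < t * t by rewrite mulr_gt0.
  rewrite -/a in a0; nra.
pose k := Num.sqrt (dot w w).
have k0 : 0 < k by rewrite sqrtr_gt0.
have k2 : k ^+ 2 = dot w w by rewrite sqr_sqrtr// ltW.
exists (k^-1 *: w); first by rewrite dotZl dotZr -k2; field; rewrite gt_eqF.
exists (dot q (k^-1 *: w)); split.
  by rewrite -subr_gt0 -dotBl dotZr mulr_gt0// invr_gt0.
move=> y /obtuse; rewrite !dotZr dotBl subr_le0 => H.
by rewrite ler_wpM2l// invr_ge0 ltW.
Qed.

Lemma compact_convex_reflect n (w : 'rV[R]_n) (A : set 'rV[R]_n) :
  compact_convex A -> compact_convex (reflect w @^-1` A).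
Proof.
move=> [cA convA]; split.
  rewrite (_ : _ @^-1` A = reflect w @` A).
    apply: continuous_compact cA; apply: continuous_subspaceT.
    by apply: isometry_continuous; exact: reflect_isometry.
  apply/seteqP; split=> [x Ax|_ [x Ax <-]]; last by rewrite /= reflectK.
  by exists (reflect w x) => //; rewrite reflectK.
by move=> x y t Ax Ay t01; rewrite /= reflectD !reflectZ; exact: convA.
Qed.

Lemma vol_reflect n (w : 'rV[R]_n) (A : set 'rV[R]_n) : compact A ->
  vol (reflect w @^-1` A) = vol A.
Proof. by move=> cA; rewrite /vol volume_reflect//; exact: compact_row_measurable. Qed.

Lemma slice_moment_shift n (F G : set 'rV[R]_n.+1) p a1 b1 a2 b2 c :
  compact_convex F -> compact_convex G -> vol G = p ->
  (forall x, F x -> a1 <= x ord0 ord0 <= b1) ->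
  (forall x, G x -> a2 <= x ord0 ord0 <= b2) ->
  a1 = a2 + c -> b1 = b2 + c ->
  (forall s, s \in `]a1, b1[ -> slice_vol F s = slice_vol G (s - c)) ->
  moment F (e0 R n) = moment G (e0 R n) + c * p.
Proof.
move=> cF cG Gp Fab Gab ac bc FG.
have mf := slice_vol_measurable cF; have mg := slice_vol_measurable cG.
have cF1 := cF.1; have cG1 := cG.1.
have msf : measurable_fun setT (fun s : R => s * slice_vol F s) by exact: measurable_funM.
have msg : measurable_fun setT (fun s : R => s * slice_vol G s) by exact: measurable_funM.
have msg' : measurable_fun setT (fun s : R => (s + c) * slice_vol G s).
  by apply: measurable_funM => //; exact: measurable_funD.
rewrite !moment_slices//.
have E : (\int[@lebesgue_measure R]_s (s * slice_vol F s)%:E =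
    \int[@lebesgue_measure R]_s ((s + c) * slice_vol G s)%:E)%E.
  transitivity (\int[@lebesgue_measure R]_s (s * slice_vol G (s - c))%:E)%E.
    apply: ae_eq_integral => //.
    - by apply/measurable_EFinP.
    - apply/measurable_EFinP; apply: measurable_funM => //.
      apply: (measurableT_comp mg); exact: measurable_funB.
    - exists [set s | s = a1 \/ s = b1]; split.
      + apply: countable_measurable => //.
        by apply: finite_set_countable; apply: finite_set2.
      + apply: countable_lebesgue_measure0.
        by apply: finite_set_countable; apply: finite_set2.
      + move=> s nE; apply: contrapT => /not_orP[/eqP sa /eqP sb]; apply: nE => _.
        have [sab|sab] := boolP (s \in `]a1, b1[); first by rewrite FG.
        have out : ~ (a1 <= s <= b1).
          by move: sab; rewrite in_itv/= !lt_neqAle (eq_sym a1) sa sb => /negP.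
        rewrite (slice_vol_out Fab out) (slice_vol_out Gab) ?mulr0//.
        by move=> out'; apply: out; lra.
  rewrite -(integral_shiftT (- c) (f := fun s => ((s + c) * slice_vol G s)%:E)).
    by apply: eq_integral => s _; rewrite subrK.
  exact/measurable_EFinP.
have supp (phi : R -> R) : (\int[@lebesgue_measure R]_s (phi s * slice_vol G s)%:E =
    \int[@lebesgue_measure R]_(s in `[a2, b2]) (phi s * slice_vol G s)%:E)%E.
  rewrite [RHS]integral_mkcond; apply: eq_integral => s _; rewrite patchE.
  case: ifPn => //; rewrite notin_setE/= in_itv/= => sab.
  by rewrite (slice_vol_out Gab sab) mulr0.
have [N N0 GN] := slice_vol_bounded cG.
have int (phi : R -> R) (K : R) : measurable_fun setT phi ->
    (forall s, s \in `[a2, b2] -> `|phi s| <= K) ->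
    (@lebesgue_measure R).-integrable `[a2, b2] (EFin \o (fun s => phi s * slice_vol G s)).
  move=> mphi phiK; apply: measurable_bounded_integrable => //.
  - by rewrite /= lebesgue_measure_itv/=; case: ifP => _; rewrite ?ltry// -EFinD ltry.
  - by apply: measurable_funTS; exact: measurable_funM.
  - exists (K * N); split; first exact: num_real.
    move=> t Kt s sab; apply: le_trans (ltW Kt).
    by rewrite /= normrM ler_pM// ?phiK// ger0_norm ?vol_ge0.
have int1 : (@lebesgue_measure R).-integrable `[a2, b2] (EFin \o (fun s => s * slice_vol G s)).
  apply: (int idfun (Num.max `|a2| `|b2|)); first exact: measurable_id.
  move=> s; rewrite in_itv/= => /andP[sa sb].
  rewrite /= ler_norml; have := ler_norm b2; have := ler_norm (- a2); rewrite normrN => ha hb.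
  have h1 : `|a2| <= Num.max `|a2| `|b2| by rewrite le_max lexx.
  have h2 : `|b2| <= Num.max `|a2| `|b2| by rewrite le_max lexx orbT.
  by apply/andP; split; lra.
have int2 : (@lebesgue_measure R).-integrable `[a2, b2] (EFin \o (fun s => c * slice_vol G s)).
  exact: (int (cst c) `|c|).
rewrite E (supp (fun s => s + c)) (supp idfun).
under eq_integral do rewrite mulrDl EFinD.
rewrite integralD//= fineD; [|exact: integrable_fin_num..].
congr (_ + _); under eq_integral do rewrite EFinM.
have int3 : (@lebesgue_measure R).-integrable `[a2, b2] (EFin \o slice_vol G).
  have := int (cst 1) 1 (measurable_cst _).
  have le1 s : s \in `[a2, b2] -> `|cst (1 : R) s| <= 1 by rewrite /= normr1.
  move=> /(_ le1).
  by congr (_.-integrable _ _); apply/funext => s /=; rewrite mul1r.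
rewrite integralZl//= fineM//; last exact: integrable_fin_num.
by rewrite -(integral_slice_vol cG Gab) -Gp.
Qed.

(** Orthogonally to [u] the slice volumes of [F] and [G] agree up to a shift [c],
    which also relates the extents of the two bodies; comparing the first moments
    identifies [c] as the difference of the barycentres in the direction [u]. *)
Lemma brunn_minkowski_eq_direction n (F G M : set 'rV[R]_n) p u :
  compact_convex F -> compact_convex G -> compact_convex M ->
  midpoint_in F G M -> 0 < p -> vol F = p -> vol G = p -> vol M = p ->
  dot u u = 1 ->
  forall x, F x -> exists2 y, G y &
    dot x u <= dot y u + p^-1 * (dot (barycentre F) u - dot (barycentre G) u).
Proof.
case: n F G M u => [|n] F G M u cF cG cM FGM p0 Fp Gp Mp u1 x Fx.
  by move: u1; rewrite /dot big_ord0 => /esym/eqP; rewrite oner_eq0.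
pose H := frame u.
have cF' : compact_convex (H @^-1` F) by exact: compact_convex_reflect.
have cG' : compact_convex (H @^-1` G) by exact: compact_convex_reflect.
have cM' : compact_convex (H @^-1` M) by exact: compact_convex_reflect.
have FGM' : midpoint_in (H @^-1` F) (H @^-1` G) (H @^-1` M).
  by move=> y z Fy Gz; rewrite /= /H /frame reflectZ reflectD; exact: FGM.
have vF : vol (H @^-1` F) = p by rewrite vol_reflect; [exact: Fp|exact: cF.1].
have vG : vol (H @^-1` G) = p by rewrite vol_reflect; [exact: Gp|exact: cG.1].
have vM : vol (H @^-1` M) = p by rewrite vol_reflect; [exact: Mp|exact: cM.1].
have [a1 [b1 [a2 [b2 [c [[Fab _] [Gab [y Gy]] ac bc FG]]]]]] :=
  brunn_minkowski_eq_slices cF' cG' cM' FGM' p0 vF vG vM.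
have := slice_moment_shift cF' cG' vG Fab Gab ac bc FG.
have mom A : compact A -> moment (H @^-1` A) (e0 R n) = dot (barycentre A) u.
  move=> cA; rewrite -momentE// -(moment_reflect (u - e0 R n) u cA); congr moment.
  by rewrite -{2}(frame_e0 u1) /frame reflectK.
rewrite !mom; [|exact: cG.1|exact: cF.1]; move=> mE.
exists (H (row_cons b2 y)) => //.
have -> : p^-1 * (dot (barycentre F) u - dot (barycentre G) u) = c.
  by rewrite mE addrAC subrr add0r mulrC mulfK// gt_eqF.
rewrite /H dot_frame// row_cons0 -bc.
have := Fab (H x); rewrite /= /H /frame reflectK => /(_ Fx)/andP[_].
by rewrite -(dot_frame _ u1) /frame reflectK.
Qed.

(** Moving the barycentre of [F] to that of [G] takes [F] into [G]: otherwise a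
    hyperplane would separate some moved point from [G], against
    [brunn_minkowski_eq_direction]. The inclusion in the other direction follows by
    exchanging [F] and [G]. *)
Theorem brunn_minkowski_eq n (F G M : set 'rV[R]_n) p :
  compact_convex F -> compact_convex G -> compact_convex M ->
  midpoint_in F G M -> 0 < p -> vol F = p -> vol G = p -> vol M = p ->
  exists t, F = (fun x => x + t) @` G.
Proof.
move=> cF cG cM FGM p0 Fp Gp Mp.
have half (A B : set 'rV[R]_n) : compact_convex A -> compact_convex B ->
    midpoint_in A B M -> vol A = p -> vol B = p ->
    forall x, A x -> B (x - p^-1 *: (barycentre A - barycentre B)).
  move=> cA cB ABM Ap Bp x Ax; apply: contrapT => nB.
  have B0 : B !=set0 by apply: vol_gt0_nonempty; rewrite Bp.
  have [u u1 [r [rx Br]]] := separation cB B0 nB.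
  have [y By] := brunn_minkowski_eq_direction cA cB cM ABM p0 Ap Bp Mp u1 Ax.
  have := Br y By; move: rx; rewrite dotBl dotZl dotBl; lra.
have GFM : midpoint_in G F M by move=> x y Gx Fy; rewrite addrC; exact: FGM.
exists (p^-1 *: (barycentre F - barycentre G)); apply/seteqP; split=> [x Fx|_ [y Gy <-]].
  by exists (x - p^-1 *: (barycentre F - barycentre G)); rewrite ?subrK//; exact: half.
have := half G F cG cF GFM Gp Fp y Gy.
by rewrite -scalerN opprB.
Qed.

End EqualityCase.

(** * The volume between two parallel slices *)

Section Slabs.
Context (R : realType).
Notation leb := (@lebesgue_measure R).

Lemma lebesgue_measure_flip (c : R) (A : set R) : measurable A ->
  pushforward leb (fun x : measurableTypeR R => c - x : measurableTypeR R) A = leb A.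
Proof.
have mf : measurable_fun setT (fun x : measurableTypeR R => c - x : measurableTypeR R).
  exact: measurable_funB.
move=> mA; apply/esym/lebesgue_measure_unique => //= _ [[a b]] _ <-.
rewrite /pushforward.
rewrite [X in _ = leb X](_ : _ = [set` `[c - b, c - a[]).
  by rewrite !lebesgue_measure_itv/= !lte_fin ltrD2l ltrN2 -!EFinD; case: ifP => // _; congr EFin; ring.
by apply/seteqP; split=> x /=; rewrite !in_itv/= => /andP[xa xb]; apply/andP; split; lra.
Qed.

Lemma integral_flip (c : R) (f : R -> \bar R) : measurable_fun setT f ->
  (forall x, (0 <= f x)%E) ->
  (\int[leb]_x f (c - x)%R = \int[leb]_x f x)%E.
Proof.
move=> mf f0.
have ms : measurable_fun setT (fun x : measurableTypeR R => c - x : measurableTypeR R).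
  exact: measurable_funB.
transitivity (\int[pushforward leb
    (fun x : measurableTypeR R => c - x : measurableTypeR R)%R]_y f y)%E.
  by rewrite ge0_integral_pushforward.
by apply: eq_measure_integral => A mA _; exact: lebesgue_measure_flip.
Qed.

(** Let [psi s] be the product on the right. The midpoint hypothesis gives [psi s ^+ 2
    >= psi s0 * psi (2 * s - s0)] for [s] in the left half of the interval. With [mu]
    the infimum of [psi], this yields [mu ^+ 2 >= psi s0 * mu], and [mu] is positive,
    so that [mu >= psi s0]. *)
Lemma symmetric_product (f : R -> R) (s0 s1 d : R) : s0 <= s1 ->
  (forall s, 0 <= f s) ->
  (forall s t, s \in `[s0, s1] -> t \in `[s0, s1] -> f s * f t <= f ((s + t) / 2) ^+ 2) ->
  0 < d -> (forall s, s \in `[s0, s1] -> d <= f s * f (s0 + s1 - s)) ->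
  forall s, s \in `[s0, s1] -> f s0 * f s1 <= f s * f (s0 + s1 - s).
Proof.
move=> s01 f0 fmid d0 fd.
pose ab := f s0 * f s1; have ab0 : 0 <= ab by exact: mulr_ge0.
pose psi s := f s * f (s0 + s1 - s).
have psi0 s : 0 <= psi s by exact: mulr_ge0.
pose P := [set psi s | s in [set s | s \in `[s0, s1]]].
have P0 : P !=set0 by exists (psi s0); exists s0 => //=; rewrite in_itv/= lexx.
have lbP : lbound P d by move=> _ [s ss <-]; exact: fd.
pose mu := inf P.
have dmu : d <= mu by exact: lb_le_inf.
have muP s : s \in `[s0, s1] -> mu <= psi s.
  by move=> ss; apply: ge_inf; [exists d|exists s].
have low s : s \in `[s0, s1] -> s <= s0 + s1 - s -> ab * mu <= psi s ^+ 2.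
  move=> ss sh; move: (ss); rewrite in_itv/= => /andP[sa sb].
  have i0 : s0 \in `[s0, s1] by rewrite in_itv/= lexx.
  have i1 : s1 \in `[s0, s1] by rewrite in_itv/= lexx andbT.
  have i2 : 2 * s - s0 \in `[s0, s1] by rewrite in_itv/=; apply/andP; split; lra.
  have i3 : s0 + s1 - (2 * s - s0) \in `[s0, s1].
    by rewrite in_itv/=; apply/andP; split; lra.
  have := fmid _ _ i0 i2; have -> : (s0 + (2 * s - s0)) / 2 = s by field.
  have := fmid _ _ i1 i3.
  have -> : (s1 + (s0 + s1 - (2 * s - s0))) / 2 = s0 + s1 - s by field.
  move=> h1 h2; rewrite /psi exprMn.
  apply: le_trans (ler_pM _ _ h2 h1); rewrite ?mulr_ge0//.
  have -> : f s0 * f (2 * s - s0) * (f s1 * f (s0 + s1 - (2 * s - s0))) =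
    ab * psi (2 * s - s0) by rewrite /ab /psi; ring.
  by rewrite ler_wpM2l// muP.
have sq s : s \in `[s0, s1] -> ab * mu <= psi s ^+ 2.
  move=> ss; have [|/ltW sh] := leP s (s0 + s1 - s); first exact: low.
  have -> : psi s = psi (s0 + s1 - s) by rewrite /psi subKr mulrC.
  apply: low; last by rewrite subKr.
  by move: ss; rewrite !in_itv/= => /andP[sa sb]; apply/andP; split; lra.
have mu0 : 0 < mu by exact: lt_le_trans dmu.
have : Num.sqrt (ab * mu) <= mu.
  apply: lb_le_inf => // _ [s ss <-].
  by rewrite -(ger0_norm (psi0 s)) -sqrtr_sqr ler_wsqrtr// sq.
move=> h s ss; apply: le_trans (muP _ ss).
have h2 : ab * mu <= mu ^+ 2.
  by rewrite -[leLHS]sqr_sqrtr ?mulr_ge0 ?(ltW mu0)// ler_sqr ?nnegrE ?sqrtr_ge0 ?(ltW mu0).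
by rewrite -/ab -(ler_pM2r mu0).
Qed.

(** The flipped function has the same integral as [f], and the sum of both is at least
    [2 * c] by the arithmetic-geometric mean inequality. *)
Lemma slab_integral (f : R -> R) (s0 s1 c : R) : s0 <= s1 ->
  measurable_fun setT f -> (forall s, 0 <= f s) -> 0 <= c ->
  (forall s, s \in `[s0, s1] -> c ^+ 2 <= f s * f (s0 + s1 - s)) ->
  (((s1 - s0) * c)%:E <= \int[leb]_(s in `[s0, s1]) (f s)%:E)%E.
Proof.
move=> s01 mf f0 c0 fc.
pose g s := f (s0 + s1 - s).
have mg : measurable_fun setT g by apply: (measurableT_comp mf); exact: measurable_funB.
have gf : (\int[leb]_(s in `[s0, s1]) (g s)%:E = \int[leb]_(s in `[s0, s1]) (f s)%:E)%E.
  rewrite integral_mkcond [RHS]integral_mkcond.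
  rewrite -[RHS](integral_flip (s0 + s1)); last 2 first.
  - by rewrite -measurable_restrictT//; apply/measurable_EFinP; exact: measurable_funTS.
  - by move=> s; rewrite patchE; case: ifP => // _; rewrite lee_fin.
  apply: eq_integral => s _; rewrite !patchE.
  have -> // : (s0 + s1 - s \in [set` `[s0, s1]]) = (s \in [set` `[s0, s1]]).
  by rewrite !mem_setE !in_itv/=; apply/andP/andP => -[h1 h2]; split; lra.
have : ((2 * ((s1 - s0) * c))%:E <=
    \int[leb]_(s in `[s0, s1]) (f s)%:E + \int[leb]_(s in `[s0, s1]) (g s)%:E)%E.
  have g0 s : 0 <= g s by exact: f0.
  rewrite -ge0_integralD//=; first last.
  - by apply/measurable_EFinP; exact: measurable_funTS.
  - by move=> s _; rewrite lee_fin.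
  - by apply/measurable_EFinP; exact: measurable_funTS.
  - by move=> s _; rewrite lee_fin.
  have -> : (2 * ((s1 - s0) * c))%:E = (\int[leb]_(s in `[s0, s1]) (2 * c)%:E)%E.
    rewrite integral_cst//= lebesgue_measure_itv/= lte_fin.
    case: ltgtP s01 => // [s01 _|<- _]; rewrite ?mule0 -?EFinD -?EFinM; congr EFin; ring.
  apply: ge0_le_integral => //.
  - by move=> s _; rewrite lee_fin mulr_ge0.
  - by apply/measurable_EFinP/measurable_funTS; exact: measurable_funD.
  move=> s ss; rewrite -EFinD lee_fin.
  have h := fc s ss; have h1 := f0 s; have h2 := g0 s.
  have : (2 * c) ^+ 2 <= (f s + g s) ^+ 2.
    have := sqr_ge0 (f s - g s); rewrite -/(g s) in h; nra.
  by rewrite ler_sqr ?nnegrE ?addr_ge0 ?mulr_ge0.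
rewrite gf; set I := (\int[_]_(_ in _) _)%E.
have : (0 <= I)%E by apply: integral_ge0 => s _; rewrite lee_fin.
case: I => [r| |] // _; first by rewrite -EFinD !lee_fin; lra.
by move=> _; rewrite leey.
Qed.

End Slabs.

(** The numerical content of equality for a body cut at half height, where [x], [y]
    and [z] are the square roots of the areas of the bottom, top and middle slices. *)
Lemma two_slabs_rigid (R : realType) (w x y z : R) :
  0 < w -> 0 < x -> 0 < y -> 0 <= z -> x ^+ 2 * y ^+ 2 <= z ^+ 2 ^+ 2 ->
  w / 2 * (x * z) + w / 2 * (z * y) <= w * (x * y) -> x = y.
Proof.
move=> w0 x0 y0 z0 h1 h2.
have h3 : x * y <= z ^+ 2.
  rewrite -ler_sqr ?nnegrE ?mulr_ge0 ?(ltW x0) ?(ltW y0) ?sqr_ge0//.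
  by rewrite exprMn.
have h4 : z * (x + y) <= 2 * (x * y).
  have d0 : 0 < w / 2 by rewrite divr_gt0.
  by rewrite -(ler_pM2l d0); lra.
have h5 : (x + y) ^+ 2 <= 4 * (x * y).
  have xy0 : 0 < x * y by exact: mulr_gt0.
  have : (z * (x + y)) ^+ 2 <= (2 * (x * y)) ^+ 2.
    by rewrite ler_sqr ?nnegrE ?mulr_ge0 ?addr_ge0 ?(ltW xy0) ?(ltW x0) ?(ltW y0).
  rewrite exprMn => h; rewrite -(ler_pM2l xy0).
  apply: le_trans (_ : z ^+ 2 * (x + y) ^+ 2 <= _); first by rewrite ler_wpM2r ?sqr_ge0.
  by apply: le_trans h _; rewrite le_eqVlt; apply/orP; left; apply/eqP; ring.
apply/eqP; rewrite -subr_eq0 -sqrf_eq0; apply/eqP/le_anti; rewrite sqr_ge0 andbT.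
by nra.
Qed.

Lemma midpoint_in_self (R : realType) n (B : set 'rV[R]_n) : compact_convex B -> midpoint_in B B B.
Proof.
move=> cB x y Bx By; rewrite (_ : _ *: _ = (1 - 2^-1) *: x + 2^-1 *: y).
  by apply: cB.2 => //; lra.
by rewrite scalerDr (_ : 1 - 2^-1 = 2^-1 :> R)//; field.
Qed.

Lemma conv_itv (R : realType) (a b t : R) : a <= b -> 0 <= t <= 1 ->
  (1 - t) * a + t * b \in `[a, b].
Proof. by move=> ab /andP[t0 t1]; rewrite in_itv/=; apply/andP; split; nra. Qed.

Section Bodies.
Context (R : realType) (n : nat) (B : set 'rV[R]_n.+1) (cB : compact_convex B).
Notation leb := (@lebesgue_measure R).
Local Notation f := (slice_vol B).

Lemma slice_between (s0 s1 s : R) : s0 < s1 -> s \in `[s0, s1] ->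
  exists2 t, 0 <= t <= 1 & s = (1 - t) * s0 + t * s1 /\ s0 + s1 - s = (1 - t) * s1 + t * s0.
Proof.
rewrite -subr_gt0 in_itv/= => d0 /andP[sa sb].
exists ((s - s0) / (s1 - s0)).
  apply/andP; split; first by rewrite divr_ge0 ?(ltW d0) ?subr_ge0.
  by rewrite ler_pdivrMr// mul1r lerB.
by split; field; rewrite gt_eqF.
Qed.

(** The Brunn-Minkowski inequality makes the slice volumes satisfy the midpoint
    hypothesis of [symmetric_product], and [slice_homothety] provides the positive
    lower bound. *)
Lemma slice_product s0 s1 : s0 <= s1 -> slice B s0 !=set0 -> slice B s1 !=set0 ->
  forall s, s \in `[s0, s1] -> f s0 * f s1 <= f s * f (s0 + s1 - s).
Proof.
rewrite le_eqVlt => /predU1P[<- _ _ s|s01 B0 B1].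
  rewrite in_itv/= -eq_le eq_sym => /eqP->.
  by rewrite addrK.
have f0 s : 0 <= f s by exact: vol_ge0.
have [f00|f0p] := leP (f s0) 0.
  have -> : f s0 = 0 by apply/le_anti; rewrite f00 f0.
  by move=> s _; rewrite mul0r mulr_ge0.
have [f10|f1p] := leP (f s1) 0.
  have -> : f s1 = 0 by apply/le_anti; rewrite f10 f0.
  by move=> s _; rewrite mulr0 mulr_ge0.
(* each slice retains the fraction c of the volume of the nearer end *)
pose c : R := 2^-1 ^+ n; have c0 : 0 < c by rewrite exprn_gt0.
pose d := c * f s0 * (c * f s1).
apply: (@symmetric_product _ _ _ _ d) => //; first exact: ltW.
- move=> s t _ _; apply: brunn_minkowski; [exact: compact_convex_slice..|].
  exact: slice_midpoint (midpoint_in_self cB).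
- by rewrite !mulr_gt0.
have half t s0' s1' : 0 <= t -> t <= 2^-1 -> slice B s1' !=set0 ->
    c * f s0' <= f ((1 - t) * s0' + t * s1').
  move=> t0 th B1'; apply: le_trans (slice_homothety s0' cB _ B1'); last by lra.
  by rewrite ler_wpM2r// lerXn2r ?nnegrE//; lra.
move=> s /(slice_between s01)[t /andP[t0 t1] [-> ->]].
have [th|/ltW th] := leP t 2^-1; first by apply: ler_pM; rewrite ?mulr_ge0 ?(ltW c0)// half.
rewrite /d (mulrC (c * f s0)).
have t0' : 0 <= 1 - t by lra.
have th' : 1 - t <= 2^-1 by lra.
have := half _ s1 s0 t0' th' B0; have := half _ s0 s1 t0' th' B1.
rewrite subKr [t * s0 + _]addrC [t * s1 + _]addrC => h1 h2.
have p0 x : 0 <= c * f x by rewrite mulr_ge0 ?(ltW c0).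
exact: (ler_pM (p0 s1) (p0 s0) h2 h1).
Qed.

Lemma slab_volume s0 s1 : s0 <= s1 -> slice B s0 !=set0 -> slice B s1 !=set0 ->
  (((s1 - s0) * (Num.sqrt (f s0) * Num.sqrt (f s1)))%:E
     <= \int[leb]_(s in `[s0, s1]) (f s)%:E)%E.
Proof.
move=> s01 B0 B1; have f0 s : 0 <= f s by exact: vol_ge0.
apply: slab_integral => //; first exact: slice_vol_measurable.
move=> s ss; rewrite exprMn !sqr_sqrtr//.
exact: slice_product.
Qed.

Context (a b : R) (Bab : forall x, B x -> a <= x ord0 ord0 <= b).
Context (Ba : slice B a !=set0) (Bb : slice B b !=set0).

Lemma slice_ends : a <= b.
Proof. by have [y /Bab] := Ba; rewrite row_cons0 => /andP[]. Qed.

Lemma slice_nonempty s : s \in `[a, b] -> slice B s !=set0.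
Proof.
have := slice_ends; rewrite le_eqVlt => /predU1P[ab|ab ss].
  by rewrite -ab in_itv/= -eq_le => /eqP <-.
have [t t01 [-> _]] := slice_between ab ss.
have [x Bx] := Ba; have [y By] := Bb.
exists ((1 - t) *: x + t *: y); exact: slice_conv.
Qed.

(** Cutting the body before bounding the two pieces is what detects a slice that is
    too large for equality. *)
Lemma two_slabs_volume s : s \in `[a, b] ->
  (s - a) * (Num.sqrt (f a) * Num.sqrt (f s)) +
  (b - s) * (Num.sqrt (f s) * Num.sqrt (f b)) <= vol B.
Proof.
move=> ss; have Bs := slice_nonempty ss; move: ss; rewrite in_itv/= => /andP[sa sb].
have mf := slice_vol_measurable cB.
rewrite -lee_fin -volE; last exact: cB.1.
rewrite (integral_slice_vol cB Bab).
rewrite (_ : [set` `[a, b]] = [set` `[a, s[] `|` [set` `[s, b]]); last first.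
  apply/seteqP; split=> x /=; rewrite !in_itv/=.
    by move=> /andP[xa xb]; have [xs|xs] := ltP x s; [left; rewrite xa|right].
  by move=> [|] /andP[h1 h2]; apply/andP; split; lra.
rewrite ge0_integral_setU//=; last 3 first.
- by apply/measurable_EFinP; exact: measurable_funTS.
- by move=> x _; rewrite lee_fin vol_ge0.
- by apply/disj_setPS => x [] /=; rewrite !in_itv/= => /andP[_ h1] /andP[h2 _]; lra.
rewrite integral_itv_bndo_bndc; last by apply/measurable_EFinP; exact: measurable_funTS.
by rewrite EFinD; apply: leeD; exact: slab_volume.
Qed.

Lemma face_product_le : f a * f b * (b - a) ^+ 2 <= vol B ^+ 2.
Proof.
have ab := slice_ends.
have := @two_slabs_volume a; rewrite in_itv/= lexx ab subrr mul0r add0r => /(_ isT) h.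
have p0 : 0 <= (b - a) * (Num.sqrt (f a) * Num.sqrt (f b)).
  by rewrite mulr_ge0 ?subr_ge0// mulr_ge0 ?sqrtr_ge0.
have : ((b - a) * (Num.sqrt (f a) * Num.sqrt (f b))) ^+ 2 <= vol B ^+ 2.
  by rewrite ler_sqr ?nnegrE ?vol_ge0.
by rewrite !exprMn !sqr_sqrtr ?vol_ge0// mulrC.
Qed.

Hypotheses (fa0 : 0 < f a) (fb0 : 0 < f b) (ab : a < b)
  (eqB : vol B ^+ 2 = f a * f b * (b - a) ^+ 2).

(** Cut at half height, the body has more than the assumed volume unless the two end
    slices have the same volume. *)
Lemma face_volume_eq : f a = f b /\ vol B = (b - a) * f a.
Proof.
have x0 : 0 < Num.sqrt (f a) by rewrite sqrtr_gt0.
have y0 : 0 < Num.sqrt (f b) by rewrite sqrtr_gt0.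
have a2 := sqr_sqrtr (ltW fa0); have b2 := sqr_sqrtr (ltW fb0).
have VE : vol B = (b - a) * (Num.sqrt (f a) * Num.sqrt (f b)).
  apply/eqP; rewrite -(@eqrXn2 _ 2) ?vol_ge0// ?eqB; last first.
    by rewrite mulr_ge0 ?subr_ge0 ?(ltW ab)// mulr_ge0 ?sqrtr_ge0.
  by rewrite !exprMn a2 b2 mulrC.
have mab : (a + b) / 2 \in `[a, b] by rewrite in_itv/= !midf_le ?(ltW ab).
have := two_slabs_volume mab; rewrite VE.
have : f a * f b <= f ((a + b) / 2) ^+ 2.
  apply: brunn_minkowski; [exact: compact_convex_slice..|].
  exact: slice_midpoint (midpoint_in_self cB).
have m2 := sqr_sqrtr (vol_ge0 (slice B ((a + b) / 2))); rewrite -[vol _]/(f _) in m2.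
have z0 := sqrtr_ge0 (f ((a + b) / 2)).
move: x0 y0 a2 b2 m2 z0.
move: (Num.sqrt (f a)) (Num.sqrt (f b)) (Num.sqrt (f ((a + b) / 2))) => x y z x0 y0 <- <- <- z0 h1 h2.
have xy : x = y.
  apply: (@two_slabs_rigid _ (b - a) x y z) => //; first by rewrite subr_gt0.
  by apply: le_trans h2; rewrite le_eqVlt; apply/orP; left; apply/eqP; field.
by rewrite xy; split=> //; ring.
Qed.

(** Cut at a slice larger than the ends, the body would have more than the assumed
    volume. *)
Lemma slice_vol_le s : s \in `[a, b] -> f s <= f a.
Proof.
move=> ss; have := two_slabs_volume ss.
have [<- ->] := face_volume_eq.
have x0 : 0 < Num.sqrt (f a) by rewrite sqrtr_gt0.
have a2 := sqr_sqrtr (ltW fa0).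
have s2 := sqr_sqrtr (vol_ge0 (slice B s)); rewrite -[vol _]/(f _) in s2.
have y0 := sqrtr_ge0 (f s).
move: x0 a2 s2 y0.
move: (Num.sqrt (f a)) (Num.sqrt (f s)) => x y x0 <- <- y0 h.
have ba : 0 < (b - a) * x by rewrite mulr_gt0// subr_gt0.
have : ((b - a) * x) * y <= ((b - a) * x) * x by lra.
by rewrite ler_pM2l// => yx; rewrite ler_sqr ?nnegrE ?(ltW x0).
Qed.

End Bodies.

(** * Equality and cylinders *)

Section Cylinders.
Context (R : realType).

Lemma translateE n (A : set 'rV[R]_n) t :
  (fun x => x + t) @` A = (fun x => x - t) @^-1` A.
Proof.
apply/seteqP; split=> [_ [x Ax <-]|x Ax]; first by rewrite /= addrK.
by exists (x - t) => //; rewrite subrK.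
Qed.

Lemma compact_convex_translate n (A : set 'rV[R]_n) t :
  compact_convex A -> compact_convex ((fun x => x + t) @` A).
Proof.
move=> [cA convA]; split.
  apply: continuous_compact cA; apply: continuous_subspaceT.
  apply: (@lipschitz_continuous _ 'rV[R]_n 'rV[R]_n _ 1) => // x y.
  by rewrite mul1r opprD addrACA subrr addr0.
rewrite translateE => x y s Ax Ay s01 /=.
rewrite (_ : _ - t = (1 - s) *: (x - t) + s *: (y - t)); first exact: convA.
by apply/rowP => i; rewrite !mxE; ring.
Qed.

Lemma vol_translate n (A : set 'rV[R]_n) t : compact A ->
  vol ((fun x => x + t) @` A) = vol A.
Proof.
by move=> cA; rewrite translateE /vol volume_shift//; exact: compact_row_measurable.
Qed.

(** By the equality case of the Brunn-Minkowski inequality the two bodies are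
    translates of each other; the inclusion forces the translation [t] to be zero,
    because otherwise it would increase the maximum of [dot x t] over the larger body. *)
Lemma compact_convex_eq_vol n (A B : set 'rV[R]_n) :
  compact_convex A -> compact_convex B -> A `<=` B -> 0 < vol A -> vol B <= vol A -> A = B.
Proof.
move=> cA cB AB A0 BA.
have vE : vol B = vol A.
  by apply/le_anti; rewrite BA vol_le//; [exact: cA.1|exact: cB.1].
have ABB : midpoint_in A B B by move=> x y /AB Bx By; exact: (midpoint_in_self cB).
have [t At] := brunn_minkowski_eq cA cB cB ABB A0 erefl vE vE.
suff t0 : t = 0.
  by rewrite At t0 translateE; apply/seteqP; split=> x /=; rewrite subr0.
have B0 : B !=set0 by apply: vol_gt0_nonempty; rewrite vE.
have cd : {within B, continuous (fun x => dot x t)}.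
  by apply: continuous_subspaceT; exact: dot_continuous.
have [q /set_mem Bq qmax] := compact_EVT_max B0 cB.1 cd.
have Bqt : B (q + t) by apply: AB; rewrite At; exists q.
have := qmax _ (mem_set Bqt); rewrite dotDl gerDl => tt.
by apply: dot_eq0; apply/le_anti; rewrite tt dot_ge0.
Qed.

(** An oblique cylinder with generators parallel to [row_cons (b - a) tau]. *)
Definition cylinder n (B : set 'rV[R]_n.+1) a b tau : Prop :=
  forall t, 0 <= t <= 1 ->
    slice B ((1 - t) * a + t * b) = (fun x => x + t *: tau) @` slice B a.

Context n (B : set 'rV[R]_n.+1) (cB : compact_convex B) (a b : R).
Hypotheses (ab : a < b) (Bab : forall x, B x -> a <= x ord0 ord0 <= b).

Lemma cylinder_vol tau : cylinder B a b tau -> vol B = (b - a) * slice_vol B a.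
Proof.
move=> cyl; rewrite /vol (integral_slice_vol cB Bab).
rewrite (_ : (\int[_]_(_ in _) _)%E =
    \int[@lebesgue_measure R]_(s in `[a, b]) (slice_vol B a)%:E)%E; last first.
  apply: eq_integral => s; rewrite inE/= => /(slice_between ab)[t t01 [-> _]].
  rewrite /slice_vol cyl// vol_translate//; exact: compact_slice cB.1.
rewrite integral_cst//= lebesgue_measure_itv/= lte_fin ab -EFinD -EFinM/=.
by rewrite mulrC.
Qed.

(** The two ends and the middle slice have the same volume, so the ends are translates
    of each other. By convexity each slice contains the intermediate translate of the
    bottom, and it is not larger in volume, by [slice_vol_le]. *)
Lemma face_product_eq : 0 < slice_vol B a -> 0 < slice_vol B b ->
  vol B ^+ 2 = slice_vol B a * slice_vol B b * (b - a) ^+ 2 ->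
  slice_vol B a = slice_vol B b /\ exists tau, cylinder B a b tau.
Proof.
move=> a0 b0 eqB.
have Ba := vol_gt0_nonempty a0; have Bb := vol_gt0_nonempty b0.
have [abE VE] := face_volume_eq cB Bab Ba Bb a0 b0 ab eqB.
split=> //.
have le := slice_vol_le cB Bab Ba Bb a0 b0 ab eqB.
have mid : midpoint_in (slice B b) (slice B a) (slice B ((b + a) / 2)).
  exact: slice_midpoint (midpoint_in_self cB).
have cS s := compact_convex_slice s cB.
have vM : vol (slice B ((b + a) / 2)) = slice_vol B a.
  apply/le_anti; rewrite le/=; last first.
    by rewrite addrC in_itv/= !midf_le ?(ltW ab).
  have := brunn_minkowski (cS _) (cS _) (cS _) mid.
  rewrite -[vol (slice B b)]/(slice_vol B b) -abE -expr2.
  by rewrite ler_sqr ?nnegrE ?vol_ge0.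
have [tau tauE] := brunn_minkowski_eq (cS _) (cS _) (cS _) mid a0 (esym abE) erefl vM.
exists tau => t /andP[t0 t1]; apply/esym.
have ss : (1 - t) * a + t * b \in `[a, b] by apply: conv_itv; rewrite ?t0 ?(ltW ab).
apply: compact_convex_eq_vol => //.
- exact: compact_convex_translate.
- move=> _ [x Bx <-].
  have -> : x + t *: tau = (1 - t) *: x + t *: (x + tau).
    by apply/rowP => i; rewrite !mxE; ring.
  apply: slice_conv => //; first by rewrite t0.
  by rewrite tauE; exists x.
- by rewrite vol_translate//; exact: (cS _).1.
- by rewrite vol_translate; [exact: le|exact: (cS _).1].
Qed.

End Cylinders.

(** * Faces and cone volumes *)

(** The integral of a nonnegative function is a supremum over the simple functions
    below it, and extension by zero turns the inclusion of domains into an inequality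
    of functions. *)
Lemma le_integral_domain d (T : measurableType d) (R : realType)
    (mu : {measure set T -> \bar R}) (D E : set T) (f g : T -> \bar R) :
  (forall x, D x -> 0 <= f x)%E -> (forall x, E x -> 0 <= g x)%E ->
  D `<=` E -> (forall x, D x -> f x <= g x)%E ->
  (\int[mu]_(x in D) f x <= \int[mu]_(x in E) g x)%E.
Proof.
move=> f0 g0 DE fg; rewrite !ge0_integralE//.
apply: le_ereal_sup => _ [h hf <-]; exists h => // x.
apply: le_trans (hf x) _; rewrite !patchE.
case: ifPn => [/set_mem Dx|_]; first by rewrite mem_set; [exact: fg|exact: DE].
by case: ifPn => // /set_mem; exact: g0.
Qed.

Section InteriorVolume.
Context (R : realType).

Lemma interior_ball n (A : set 'rV[R]_n) p : interior A p ->
  exists2 r : R, 0 < r & forall x, `|x - p| < r -> A x.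
Proof.
move=> /nbhs_ballP[r /= r0 rA]; exists r => // x xp; apply: rA.
by rewrite -ball_normE/= distrC.
Qed.

Lemma ball_interior n (A : set 'rV[R]_n) p (r : R) : 0 < r ->
  (forall x, `|x - p| < r -> A x) -> interior A p.
Proof.
move=> r0 rA; apply/nbhs_ballP; exists r => // x.
by rewrite -ball_normE/= distrC; exact: rA.
Qed.

Lemma volume_interior_gt0 n (A : set 'rV[R]_n) : measurable A -> interior A !=set0 ->
  (0 < volume A)%E.
Proof.
move=> mA [p /interior_ball[r r0 rA]].
apply: (@lt_le_trans _ _ (volume (box p (r / 2)))).
  by rewrite volume_box ?lte_fin ?exprn_gt0 ?divr_gt0// ltW// divr_gt0.
apply: le_measure; rewrite ?inE//; first exact: measurable_box.
move=> x xb; apply: rA; apply: (@le_lt_trans _ _ (r / 2)); last by lra.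
rewrite /Num.norm/= mx_normrE; apply/bigmax_leP; split; first by rewrite divr_ge0// ltW.
move=> [i j] _ /=; rewrite (ord1 i) !mxE; have := xb j.
by rewrite in_itv/= => /andP[h1 h2]; rewrite ler_norml; apply/andP; split; lra.
Qed.

(** Shrinking a convex body towards an interior point brings it into its interior, at
    an arbitrarily small loss of volume. *)
Lemma volume_interior n (A : set 'rV[R]_n) : compact_convex A -> interior A !=set0 ->
  volume (interior A) = volume A.
Proof.
move=> cA [p /interior_ball[r r0 rA]].
have mA := compact_row_measurable cA.1.
have mI : measurable (interior A) by apply: open_row_measurable; exact: open_interior.
apply/le_anti/andP; split.
  by apply: le_measure; rewrite ?inE//; exact: interior_subset.
have fI : volume (interior A) \is a fin_num.
  rewrite ge0_fin_numE//; apply: le_lt_trans (_ : (volume A < +oo)%E); last first.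
    by rewrite volE ?ltry//; exact: cA.1.
  by apply: le_measure; rewrite ?inE//; exact: interior_subset.
have key t : 0 < t -> t < 1 -> (1 - t) ^+ n * vol A <= fine (volume (interior A)).
  move=> t0 t1; pose phi (x : 'rV[R]_n) := (1 - t) *: x + t *: p.
  have t1' : 0 < 1 - t by rewrite subr_gt0.
  have phi_int x : A x -> interior A (phi x).
    move=> Ax; apply: (@ball_interior _ _ _ (t * r)); first exact: mulr_gt0.
    move=> z zr; pose q := p + t^-1 *: (z - phi x).
    have Aq : A q.
      apply: rA; rewrite /q addrAC subrr add0r normrZ ger0_norm ?invr_ge0 ?(ltW t0)//.
      by rewrite mulrC ltr_pdivrMr// mulrC.
    have -> : z = (1 - t) *: x + t *: q.
      rewrite /q scalerDr scalerA mulfV ?gt_eqF// scale1r addrA -/(phi x).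
      by rewrite addrC subrK.
    by apply: cA.2; rewrite ?(ltW t0) ?(ltW t1).
  have t01 : 0 <= t < 1 by rewrite (ltW t0).
  have [cphi le_phi] := vol_homothety p cA.1 t01.
  apply: le_trans le_phi _; rewrite -lee_fin -(volE cphi) fineK//.
  apply: le_measure; rewrite ?inE//; first exact: compact_row_measurable.
  by move=> _ [x Ax <-]; exact: phi_int.
rewrite volE ?cA.1//; last exact: cA.1.
rewrite -[leRHS]fineK// lee_fin leNgt; apply/negP => lt.
pose v := vol A; pose w := fine (volume (interior A)).
have v0 : 0 < v by apply: le_lt_trans lt; rewrite fine_ge0.
(* small enough for (1 - n * t) * v > w *)
pose t := (v - w) / (2 * (n%:R + 1) * v).
have n0 : 0 <= n%:R :> R by [].
have c0 : 0 < 2 * (n%:R + 1) * v by rewrite !mulr_gt0// ltr_wpDl.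
have tE : t * (2 * (n%:R + 1) * v) = v - w by rewrite /t divfK// gt_eqF.
have t0 : 0 < t by rewrite divr_gt0// subr_gt0.
have w0 : 0 <= w by rewrite fine_ge0.
have t1 : t < 1 by rewrite ltr_pdivrMr// mul1r; nra.
have h1 := key t t0 t1.
have t01 : 0 <= t <= 1 by rewrite !ltW.
have h2 := bernoulli n t01.
have : (1 - n%:R * t) * v <= w by apply: le_trans h1; rewrite ler_wpM2r// ltW.
rewrite -/v -/w in lt.
have : 0 < t * v by rewrite mulr_gt0.
nra.
Qed.

End InteriorVolume.

Section Faces.
Context (R : realType) (m : nat) (K : set 'rV[R]_m.+1).
Hypotheses (bK : convex_body K) (K0 : interior K 0).

Let cK : compact_convex K.
Proof. by have [cK /convex_setP convK _] := bK. Qed.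

Let K_0 : K 0.
Proof. exact: interior_subset K0. Qed.

Lemma support_max (u : 'rV[R]_m.+1) : exists2 q, K q &
  dot q u = support_function K u /\ forall y, K y -> dot y u <= support_function K u.
Proof.
have cd : {within K, continuous (fun x => dot x u)}.
  by apply: continuous_subspaceT; exact: dot_continuous.
have [q /set_mem Kq qmax] := compact_EVT_max (ex_intro _ _ K_0) cK.1 cd.
suff E : support_function K u = dot q u.
  by exists q; rewrite ?E //; split=> // y Ky; apply: qmax; exact: mem_set.
apply/le_anti/andP; split.
  apply: ge_sup; first by exists (dot u 0); exists 0.
  by move=> _ [y Ky <-]; rewrite dotC; apply: qmax; exact: mem_set.
apply: ub_le_sup; last by exists q => //; rewrite dotC.
by exists (dot q u) => _ [y Ky <-]; rewrite dotC; apply: qmax; exact: mem_set.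
Qed.

Lemma le_support u y : K y -> dot y u <= support_function K u.
Proof. by have [q _ [_]] := support_max u; exact. Qed.

Context (u : 'rV[R]_m.+1) (u1 : dot u u = 1).
Local Notation h := (support_function K u).
Local Notation B := (frame u @^-1` K).

Lemma support_gt0 : 0 < h.
Proof.
have [r r0 rK] := interior_ball K0.
pose k := r / (2 * (`|u| + 1)).
have d0 : 0 < 2 * (`|u| + 1) by rewrite mulr_gt0// ltr_wpDl.
have k0 : 0 < k by rewrite divr_gt0.
have Kku : K (k *: u).
  apply: rK; rewrite subr0 normrZ ger0_norm ?(ltW k0)//.
  have : k * (2 * (`|u| + 1)) = r by rewrite /k divfK// gt_eqF.
  have := normr_ge0 u; nra.
by apply: lt_le_trans (le_support u Kku); rewrite dotZl u1 mulr1.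
Qed.

Lemma frame_compact_convex : compact_convex B.
Proof. exact: compact_convex_reflect. Qed.

Lemma frame_range z : B z -> - support_function K (- u) <= z ord0 ord0 <= h.
Proof.
move=> Bz; rewrite -(dot_frame z u1) le_support// andbT lerNl -dotNr.
exact: le_support.
Qed.

Lemma frameK : involutive (frame u).
Proof. exact: reflectK. Qed.

Lemma frame_coord x : (frame u x) ord0 ord0 = dot x u.
Proof. by rewrite -(dot_frame _ u1) frameK. Qed.

Lemma section_slice s :
  [set x | K x /\ dot x u = s] = (fun y => frame u (row_cons s y)) @` slice B s.
Proof.
apply/seteqP; split=> [x [Kx <-]|_ [y By <-]].
  exists (row_tail (frame u x)).
    by rewrite /slice/= -frame_coord row_consK frameK.
  by rewrite -frame_coord row_consK frameK.
by split=> //; rewrite dot_frame// row_cons0.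
Qed.

Lemma face_slice : face K u = (fun y => frame u (row_cons h y)) @` slice B h.
Proof. exact: section_slice. Qed.

Lemma face_opp_slice (h' := support_function K (- u)) :
  face K (- u) = (fun y => frame u (row_cons (- h') y)) @` slice B (- h').
Proof.
rewrite -section_slice; apply/seteqP; split=> x -[Kx].
  by rewrite dotNr -/h' => <-; rewrite opprK.
by rewrite /face/= dotNr => ->; rewrite opprK.
Qed.

Lemma section_isometry s (x y : 'rV[R]_m) :
  enorm (frame u (row_cons s x) - frame u (row_cons s y)) = enorm (x - y).
Proof. by rewrite reflect_isometry row_cons_isometry. Qed.

Lemma hausdorff_section s (A : set 'rV[R]_m) : measurable A ->
  hausdorff m ((fun y => frame u (row_cons s y)) @` A) = volume A.
Proof.
move=> mA; rewrite hausdorff_isometry ?hausdorff_volume// => x y.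
exact: section_isometry.
Qed.

Lemma section_measurable s (A : set 'rV[R]_m) : measurable A ->
  measurable ((fun y => frame u (row_cons s y)) @` A).
Proof.
move=> mA.
rewrite (_ : _ @` A = (fun x => (frame u x) ord0 ord0) @^-1` [set s] `&`
    (fun x => row_tail (frame u x)) @^-1` A).
  have mf : measurable_fun setT (frame u) by apply: measurable_isometry; exact: reflect_isometry.
  apply: measurableI.
    rewrite -[X in measurable X]setTI; apply: (measurableT_comp (measurable_coord ord0) mf) => //.
  rewrite -[X in measurable X]setTI.
  have mt : measurable_fun setT (@row_tail R m).
    apply: measurable_fun_row => i.
    have -> : (fun x => row_tail x ord0 i) = (fun x : 'rV[R]_m.+1 => x ord0 (lift ord0 i)).
      by apply/funext => x; rewrite mxE.
    exact: measurable_coord.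
  exact: (measurableT_comp mt mf).
apply/seteqP; split=> [_ [y Ay <-]|x [/= xs Ax]].
  by rewrite /frame/= reflectK row_cons0 row_tailK.
exists (row_tail (frame u x)) => //.
by rewrite -xs row_consK /frame reflectK.
Qed.

Local Notation D := (regular_boundary K `&` gauss_map K @^-1` [set u]).

Lemma gauss_face x : D x -> face K u x /\ gauss_map K x = u.
Proof.
move=> [[[clx _] [v [nv _]]] /= gx]; split=> //.
have Kx : K x by rewrite -(closure_id _).1// in clx; exact: compact_closed cK.1.
have [_ nu] : outer_unit_normal K x u.
  by rewrite -gx /gauss_map; apply: xgetPex; exists v.
split=> //; apply/le_anti; rewrite le_support//=.
have [q Kq [<- _]] := support_max u.
by have := nu q Kq; rewrite dotBl subr_le0.
Qed.

(** Moving within the face along the tangential part of an outer normal shows that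
    this part vanishes, so the normal is [u] or [- u]; the origin lies in [K] strictly
    below the face, which excludes [- u]. *)
Lemma interior_face_regular y : interior (slice B h) y -> D (frame u (row_cons h y)).
Proof.
move=> Iy; set x := frame u (row_cons h y).
have xu : dot x u = h by rewrite dot_frame// row_cons0.
have Kx : K x by apply: (interior_subset Iy).
have u_unit : sphere u by apply/enorm_eq1.
have nu : outer_unit_normal K x u.
  by split=> // z Kz; rewrite dotBl xu subr_le0 le_support.
have uniq v : outer_unit_normal K x v -> u = v.
  move=> [/enorm_eq1 v1 nv].
  pose w := row_tail (frame u v); pose v0 : R := (frame u v) ord0 ord0.
  have fv : frame u v = row_cons v0 w by rewrite row_consK.
  have [r r0 rB] := interior_ball Iy.
  pose k := r / (2 * (`|w| + 1)).
  have d0 : 0 < 2 * (`|w| + 1) by rewrite mulr_gt0// ltr_wpDl.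
  have k0 : 0 < k by rewrite divr_gt0.
  have Kw : K (frame u (row_cons h (y + k *: w))).
    apply: rB; rewrite addrAC subrr add0r normrZ ger0_norm ?(ltW k0)//.
    have : k * (2 * (`|w| + 1)) = r by rewrite /k divfK// gt_eqF.
    have := normr_ge0 w; nra.
  have := nv _ Kw; rewrite /x -reflectB.
  have -> : row_cons h (y + k *: w) - row_cons h y = row_cons 0 (k *: w).
    by rewrite -scaleN1r -row_consZ -row_consD scaleN1r mulN1r subrr addrAC subrr add0r.
  have vE : v = frame u (row_cons v0 w) by rewrite -fv /frame reflectK.
  rewrite {1}vE reflect_dot dot_cons mul0r add0r dotZl pmulr_rle0// => ww.
  have w0 : w = 0 by apply: dot_eq0; apply/le_anti; rewrite ww dot_ge0.
  have vu : v = v0 *: u.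
    rewrite vE w0 -[X in _ *: X](frame_e0 u1) /frame -reflectZ; congr reflect.
    by rewrite -row_consZ mulr1 scaler0.
  have := nv 0 K_0; rewrite sub0r dotNl vu dotZr xu oppr_le0 pmulr_lge0 ?support_gt0// => v00.
  have v2 : v0 ^+ 2 = 1 by rewrite -v1 vu dotZl dotZr u1 mulr1.
  have -> : v0 = 1 by apply/eqP; rewrite -(@eqrXn2 _ 2) ?v2 ?expr1n.
  by rewrite scale1r.
split; last first.
  by rewrite /= /gauss_map; apply/esym/uniq; apply: xgetPex; exists u.
split; last by exists u; split.
split; first exact: subset_closure.
move=> /interior_ball[r r0 rK].
pose k := r / (2 * (`|u| + 1)).
have d0 : 0 < 2 * (`|u| + 1) by rewrite mulr_gt0// ltr_wpDl.
have k0 : 0 < k by rewrite divr_gt0.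
have : K (x + k *: u).
  apply: rK; rewrite addrAC subrr add0r normrZ ger0_norm ?(ltW k0)//.
  have : k * (2 * (`|u| + 1)) = r by rewrite /k divfK// gt_eqF.
  have := normr_ge0 u; nra.
by move=> /(le_support u); rewrite dotDl xu dotZl u1 mulr1; lra.
Qed.

Lemma cone_volume_integral (E : set 'rV[R]_m.+1) : measurable E ->
  (\int[hausdorff_measure R m.+1 m]_(x in E) (cst h%:E x) = h%:E * hausdorff m E)%E.
Proof. by move=> mE; rewrite integral_cst//; exact: caratheodory_borel. Qed.

Lemma cone_volume_ge0 : (0 <= cone_volume K [set u])%E.
Proof.
rewrite /cone_volume mule_ge0// ?lee_fin ?invr_ge0//.
by apply: integral_ge0 => x /gauss_face[[_ xu] ->]; rewrite lee_fin xu ltW// support_gt0.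
Qed.

(** The points with normal [u] lie on the face, where the integrand is the constant
    [h]. *)
Lemma cone_volume_le : (cone_volume K [set u] <= (h / m.+1%:R * slice_vol B h)%:E)%E.
Proof.
rewrite /cone_volume mulrAC mulrC EFinM.
apply: lee_wpmul2l; first by rewrite lee_fin invr_ge0.
have cS := @compact_slice R m B h frame_compact_convex.1.
have mS := compact_row_measurable cS.
apply: le_trans (_ : \int[hausdorff_measure R m.+1 m]_(x in face K u) (cst h%:E x) <= _)%E.
  apply: le_integral_domain.
  - by move=> x /gauss_face[[_ xu] ->]; rewrite lee_fin xu ltW// support_gt0.
  - by move=> x _; rewrite lee_fin ltW// support_gt0.
  - by move=> x /gauss_face[].
  - by move=> x /gauss_face[[_ xu] ->]; rewrite xu.
rewrite face_slice cone_volume_integral; last exact: section_measurable.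
by rewrite hausdorff_section// volE.
Qed.

(** The points with normal [u] include the relative interior of the face, which
    carries its whole area. *)
Lemma cone_volumeE : interior (slice B h) !=set0 ->
  cone_volume K [set u] = (h / m.+1%:R * slice_vol B h)%:E.
Proof.
move=> I0; apply/le_anti/andP; split; first exact: cone_volume_le.
rewrite /cone_volume mulrAC mulrC EFinM.
apply: lee_wpmul2l; first by rewrite lee_fin invr_ge0.
have cS := compact_convex_slice h frame_compact_convex.
have mI : measurable (interior (slice B h)).
  by apply: open_row_measurable; exact: open_interior.
apply: le_trans (_ : \int[hausdorff_measure R m.+1 m]_(x in
    (fun y => frame u (row_cons h y)) @` interior (slice B h)) (cst h%:E x) <= _)%E; last first.
  apply: le_integral_domain.
  - by move=> x _; rewrite lee_fin ltW// support_gt0.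
  - by move=> x /gauss_face[[_ xu] ->]; rewrite lee_fin xu ltW// support_gt0.
  - by move=> _ [y Iy <-]; exact: interior_face_regular.
  - by move=> _ [y Iy <-]; have [[_ xu] ->] := gauss_face (interior_face_regular Iy); rewrite xu.
rewrite cone_volume_integral; last exact: section_measurable.
by rewrite hausdorff_section// volume_interior// volE//; exact: cS.1.
Qed.

End Faces.

(** * Prisms and the theorem *)

Section Prisms.
Context (R : realType) (m : nat) (K : set 'rV[R]_m.+1).
Hypotheses (bK : convex_body K) (K0 : interior K 0).
Context (u : 'rV[R]_m.+1) (u1 : dot u u = 1).
Local Notation b := (support_function K u).
Local Notation h' := (support_function K (- u)).
Local Notation a := (- h').
Local Notation B := (frame u @^-1` K).

Let uN1 : dot (- u) (- u) = 1.
Proof. by rewrite dotNl dotNr opprK. Qed.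

Let cB : compact_convex B.
Proof. exact: frame_compact_convex. Qed.

Let a_lt0 : a < 0.
Proof. by rewrite oppr_lt0 (support_gt0 bK K0 uN1). Qed.

Let b_gt0 : 0 < b.
Proof. exact: support_gt0. Qed.

Let ab : a < b.
Proof. exact: lt_trans b_gt0. Qed.

(** Both slices parametrise the face with normal [- u] isometrically, and so have its
    Hausdorff measure as their volume. *)
Lemma face_vol_opp : slice_vol (frame (- u) @^-1` K) h' = slice_vol B a.
Proof.
have cF : compact_convex (frame (- u) @^-1` K) by exact: frame_compact_convex.
have cSB : compact (slice B a) by exact: compact_slice cB.1.
have cSF : compact (slice (frame (- u) @^-1` K) h') by exact: compact_slice cF.1.
apply: EFin_inj; rewrite /slice_vol -!volE//.
rewrite -(hausdorff_section (- u) h'); last exact: compact_row_measurable.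
rewrite -(hausdorff_section u a); last exact: compact_row_measurable.
by rewrite -face_opp_slice// -face_slice.
Qed.

(** The cylinder over the lower face that reaches the upper one is convex and contains
    both faces, hence contains their hull. *)
Lemma hull_cylinder t : face K (- u) = (fun x => x + t) @` face K u ->
  K = convex_hull (face K u `|` face K (- u)) -> exists tau, cylinder B a b tau.
Proof.
move=> Ft Khull.
have [q Kq [qb _]] := support_max bK K0 u.
have t0 : dot t u = a - b.
  have : face K (- u) (q + t) by rewrite Ft; exists q.
  by move=> [_]; rewrite dotNr dotDl qb => <-; ring.
pose tau := - row_tail (frame u t).
have tE : frame u t = row_cons (a - b) (- tau).
  by rewrite opprK -t0 -(frame_coord u1) row_consK.
have shift s y : frame u (row_cons s y) + t = frame u (row_cons (s + (a - b)) (y - tau)).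
  by rewrite row_consD -tE /frame reflectD reflectK.
have inj s y s' y' : frame u (row_cons s y) = frame u (row_cons s' y') -> s = s' /\ y = y'.
  by move=> /(can_inj (@frameK R m u)); exact: row_cons_inj.
have up y : slice B a y -> slice B b (y + tau).
  move=> By; have : face K (- u) (frame u (row_cons a y)) by rewrite face_opp_slice//; exists y.
  rewrite Ft face_slice// => -[_ [y' By' <-]].
  rewrite shift => /inj[_ <-].
  by rewrite subrK.
have down y : slice B b y -> slice B a (y - tau).
  move=> By; have : face K u (frame u (row_cons b y)) by rewrite face_slice//; exists y.
  move=> Fy; have : face K (- u) (frame u (row_cons b y) + t) by rewrite Ft; exists (frame u (row_cons b y)).
  by rewrite shift addrC subrK => -[].
pose C := [set z | exists s y, [/\ 0 <= s <= 1, slice B a y &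
  z = row_cons ((1 - s) * a + s * b) (y + s *: tau)]].
have convC : convex_set (frame u @^-1` C).
  apply/convex_setP => x1 x2 l [s1 [y1 [/andP[s10 s11] By1 E1]]] [s2 [y2 [/andP[s20 s21] By2 E2]]].
  move=> /andP[l0 l1].
  exists ((1 - l) * s1 + l * s2), ((1 - l) *: y1 + l *: y2); split.
  - by apply/andP; split; nra.
  - by apply: (compact_convex_slice a cB).2 => //; rewrite l0.
  - rewrite /frame reflectD !reflectZ -!/(frame u _) E1 E2 -!row_consZ -row_consD.
    congr row_cons; first by ring.
    by apply/rowP => i; rewrite !mxE; ring.
have KC : K `<=` frame u @^-1` C.
  rewrite {1}Khull; apply: smallest_sub => // x [|].
    rewrite face_slice// => -[y By <-]; rewrite /= frameK.
    exists 1, (y - tau); split; first by rewrite ler01 lexx.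
      exact: down.
    by rewrite subrr mul0r add0r mul1r scale1r subrK.
  rewrite face_opp_slice// => -[y By <-]; rewrite /= frameK.
  exists 0, y; split; [by rewrite lexx ler01|by []|].
  by rewrite subr0 mul0r addr0 mul1r scale0r addr0.
exists tau => s s01; apply/seteqP; split=> [y By|_ [y By <-]].
  have [s' [y0 [_ By0]]] := KC _ By.
  rewrite frameK => /row_cons_inj[sE yE].
  have d : b - a != 0 by rewrite gt_eqF// subr_gt0.
  have ss : s = s' by apply: (mulIf d); move: sE; lra.
  by rewrite yE ss; exists y0.
have -> : y + s *: tau = (1 - s) *: y + s *: (y + tau).
  by apply/rowP => i; rewrite !mxE; ring.
by apply: slice_conv => //; exact: up.
Qed.

(** The face is a translate of the slice through the origin, and the origin is
    interior to [K]. *)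
Lemma cylinder_interior tau : cylinder B a b tau -> interior (slice B b) !=set0.
Proof.
move=> cyl.
have z : 0 \in `[a, b] by rewrite in_itv/= !ltW.
have [s s01 [sE _]] := slice_between ab z.
have [r r0 rS] : exists2 r : R, 0 < r & forall y, `|y - 0| < r -> slice B 0 y.
  apply: interior_ball.
  have cf : continuous (fun y : 'rV[R]_m => frame u (row_cons 0 y)).
    by apply: isometry_continuous => x y; exact: section_isometry.
  have f0 : frame u (row_cons 0 (0 : 'rV[R]_m)) = 0.
    have -> : row_cons 0 (0 : 'rV[R]_m) = 0 by rewrite -(scale0r (0 : 'rV[R]_m)) -{1}(mul0r 0) row_consZ scale0r.
    by rewrite -(scale0r 0) /frame reflectZ !scale0r.
  by have := cf 0 K; rewrite f0 => /(_ K0).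
exists ((1 - s) *: tau); apply: (ball_interior r0) => y yr.
have := cyl 1; rewrite subrr mul0r add0r mul1r scale1r => -> //; last by rewrite ler01 lexx.
have : slice B ((1 - s) * a + s * b) (y - (1 - s) *: tau) by rewrite -sE; apply: rS; rewrite subr0.
rewrite cyl// => -[x Bx E]; exists x => //.
apply/(addIr (- ((1 - s) *: tau))); rewrite -E.
by apply/rowP => i; rewrite !mxE; ring.
Qed.

Lemma cylinder_hull tau : cylinder B a b tau ->
  (exists t, face K (- u) = (fun x => x + t) @` face K u) /\
  K = convex_hull (face K u `|` face K (- u)).
Proof.
move=> cyl.
have up : slice B b = (fun x => x + tau) @` slice B a.
  by have := cyl 1; rewrite subrr mul0r add0r mul1r scale1r => -> //; rewrite ler01 lexx.
have fD s s' y y' : frame u (row_cons s y) + frame u (row_cons s' y') =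
    frame u (row_cons (s + s') (y + y')) by rewrite row_consD /frame reflectD.
split.
  exists (frame u (row_cons (a - b) (- tau))).
  rewrite (face_slice K u1) face_opp_slice// up; apply/seteqP; split=> [_ [y By <-]|].
    exists (frame u (row_cons b (y + tau))); first by exists (y + tau) => //; exists y.
    by rewrite fD addrK addrC subrK.
  move=> _ [_ [_ [y By <-] <-] <-]; exists y => //.
  by rewrite fD addrK addrC subrK.
apply/seteqP; split; last first.
  apply: smallest_sub; first by apply/convex_setP; have [_ /convex_setP] := bK.
  by move=> x [|] [].
move=> x Kx M [/convex_setP convM FM].
have Bx : B (frame u x) by rewrite /= frameK.
have := frame_range bK K0 u1 Bx; set s := (frame u x) ord0 ord0 => sab.
have [t t01 [sE _]] := slice_between ab (sab : s \in `[a, b]).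
have : slice B ((1 - t) * a + t * b) (row_tail (frame u x)) by rewrite -sE /slice/= row_consK frameK.
rewrite cyl// => -[y By yE].
have xE : x = (1 - t) *: frame u (row_cons a y) + t *: frame u (row_cons b (y + tau)).
  rewrite -(@frameK R m u x) -[frame u x]row_consK -/s sE -yE.
  rewrite /frame -!reflectZ -reflectD -!row_consZ -row_consD; congr (reflect _ (row_cons _ _)).
  by apply/rowP => i; rewrite !mxE; ring.
rewrite xE; apply: convM => //; apply: FM.
  by right; rewrite face_opp_slice//; exists y.
by left; rewrite face_slice//; exists (y + tau) => //; rewrite up; exists y.
Qed.

End Prisms.

Theorem corollary6p4 (R : realType) (n : nat) (hn : (2 <= n)%N)
    (K : set 'rV[R]_n) (hK : convex_body K) (hK0 : interior K 0)
    (u : 'rV[R]_n) (hu : sphere u) :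
  (cone_volume K [set u] * cone_volume K [set (- u)%R]
     <= ((4 * n ^ 2)%:R^-1)%:E * volume K ^+ 2)%E
  /\ ((cone_volume K [set u] * cone_volume K [set (- u)%R]
         = ((4 * n ^ 2)%:R^-1)%:E * volume K ^+ 2)%E
      <-> [/\ exists t : 'rV[R]_n, face K (- u) = (fun x => x + t) @` face K u,
              K = convex_hull (face K u `|` face K (- u))
            & support_function K u = support_function K (- u)]).
Proof.
case: n hn K hK hK0 u hu => // m _ K bK K0 u /enorm_eq1 u1.
have uN1 : dot (- u) (- u) = 1 by rewrite dotNl dotNr opprK.
set b := support_function K u; set h' := support_function K (- u).
have b0 : 0 < b by exact: support_gt0.
have h0 : 0 < h' by exact: support_gt0.
pose B := frame u @^-1` K.
have cB : compact_convex B by exact: frame_compact_convex.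
have ab : - h' < b by apply: lt_trans b0; rewrite oppr_lt0.
have Bab x : B x -> - h' <= x ord0 ord0 <= b by exact: frame_range.
have cK : compact K by have [] := bK.
have KB : vol K = vol B by rewrite vol_reflect.
pose A1 := slice_vol B b; pose A0 := slice_vol B (- h').
have A10 : 0 <= A1 by exact: vol_ge0.
have A00 : 0 <= A0 by exact: vol_ge0.
have V0 : 0 < vol K.
  rewrite -lte_fin -volE//; apply: volume_interior_gt0; last by exists 0.
  exact: compact_row_measurable.
have Pu := cone_volume_le bK K0 u1; have Pv := cone_volume_le bK K0 uN1.
rewrite -/b -/B -/A1 in Pu; rewrite (face_vol_opp bK u1) -/h' -/B -/A0 in Pv.
have prod : (cone_volume K [set u] * cone_volume K [set (- u)%R] <=
    (b / m.+1%:R * A1 * (h' / m.+1%:R * A0))%:E)%E.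
  by rewrite EFinM; apply: lee_pmul => //; exact: cone_volume_ge0.
have N0 : 0 < m.+1%:R :> R by [].
have rhsE : (((4 * m.+1 ^ 2)%:R^-1)%:E * volume K ^+ 2)%E =
    ((vol K ^+ 2) / (4 * m.+1%:R ^+ 2))%:E.
  by rewrite volE// -EFin_expe -EFinM natrM natrX mulrC.
have prodE : b / m.+1%:R * A1 * (h' / m.+1%:R * A0) =
    (4 * (b * h') * (A0 * A1)) / (4 * m.+1%:R ^+ 2).
  by field; rewrite gt_eqF.
have bh : 4 * (b * h') <= (b + h') ^+ 2.
  by have := sqr_ge0 (b - h'); nra.
have slices : A0 * A1 * (b + h') ^+ 2 <= vol K ^+ 2.
  have [->|A0n] := eqVneq A0 0; first by rewrite !mul0r sqr_ge0.
  have [->|A1n] := eqVneq A1 0; first by rewrite mulr0 mul0r sqr_ge0.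
  have Ba : slice B (- h') !=set0 by apply: vol_gt0_nonempty; rewrite lt0r A0n.
  have Bb : slice B b !=set0 by apply: vol_gt0_nonempty; rewrite lt0r A1n.
  have := face_product_le cB Bab Ba Bb.
  by rewrite opprK -KB.
have N4 : 0 < (4 * m.+1%:R ^+ 2)^-1 :> R by rewrite invr_gt0 mulr_gt0// exprn_gt0.
have le : 4 * (b * h') * (A0 * A1) <= vol K ^+ 2.
  apply: le_trans slices; rewrite mulrC ler_wpM2l//; exact: mulr_ge0.
rewrite rhsE; split.
  by apply: le_trans prod _; rewrite prodE lee_fin ler_pM2r.
split=> [eqn|[[t Ft] Khull bE]].
  have ge : vol K ^+ 2 <= 4 * (b * h') * (A0 * A1).
    by move: prod; rewrite eqn prodE lee_fin ler_pM2r.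
  have V2 : 0 < vol K ^+ 2 by rewrite exprn_gt0.
  have bh0 : 0 < 4 * (b * h') by rewrite !mulr_gt0.
  have AA : 0 < A0 * A1 by rewrite -(pmulr_rgt0 _ bh0); exact: lt_le_trans ge.
  have eqbh : b = h'.
    have : A0 * A1 * (b + h') ^+ 2 <= A0 * A1 * (4 * (b * h')).
      by apply: le_trans slices _; rewrite mulrC in ge.
    rewrite ler_pM2l// => h.
    apply/eqP; rewrite -subr_eq0 -sqrf_eq0; apply/eqP/le_anti.
    by rewrite sqr_ge0 andbT; nra.
  have A0p : 0 < A0 by rewrite lt0r A00 andbT; apply: contraTneq AA => ->; rewrite mul0r ltxx.
  have A1p : 0 < A1 by rewrite lt0r A10 andbT; apply: contraTneq AA => ->; rewrite mulr0 ltxx.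
  have eqB : vol B ^+ 2 = A0 * A1 * (b - - h') ^+ 2.
    rewrite opprK -KB; apply/le_anti; rewrite slices andbT.
    apply: le_trans ge _; rewrite mulrC ler_pM2l//.
  have [_ [tau cyl]] := face_product_eq cB ab Bab A0p A1p eqB.
  have [Ft Kh] := cylinder_hull bK K0 u1 cyl.
  by split.
have [tau cyl] := hull_cylinder bK K0 u1 Ft Khull.
have VE : vol K = (b - - h') * A0 by rewrite KB; exact: (cylinder_vol cB ab Bab cyl).
have AE : A1 = A0.
  rewrite /A1 /slice_vol; have := cyl 1.
  rewrite subrr mul0r add0r mul1r scale1r => -> //; last by rewrite ler01 lexx.
  by rewrite vol_translate//; exact: compact_slice cB.1.
have [tau' cyl'] : exists tau, cylinder (frame (- u) @^-1` K)
    (- support_function K (- - u)) (support_function K (- u)) tau.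
  apply: (@hull_cylinder _ _ _ bK K0 (- u) uN1 (- t)).
    rewrite opprK Ft; apply/seteqP; split=> [x Fx|_ [_ [x Fx <-] <-]]; last by rewrite addrK.
    by exists (x + t); rewrite ?addrK//; exists x.
  by rewrite opprK setUC.
rewrite (cone_volumeE bK K0 u1 (cylinder_interior bK K0 u1 cyl)).
rewrite (cone_volumeE bK K0 uN1 (cylinder_interior bK K0 uN1 cyl')).
rewrite (face_vol_opp bK u1) -/b -/h' -/B -/A1 -/A0 -EFinM; congr EFin.
by rewrite VE AE -/b bE -/h'; field; rewrite gt_eqF.
Qed.
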